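(* Suppose $V$ satisfies Assumption 1 (stated in the context) with constants $M,L,m>0$. Let $f\in C^s$ for some $s>0$. 1. For $s\in(0,1]$, $$\sup_{\|f\|_{C^s}\le1}\sup_{\theta\in\mathbb{R}^d}\|f(\hat\theta)-f(\theta)\|_{L_2(\mathbb{P}_\theta)}\lesssim_{L,M,m,s}\Bigl(\sqrt{\frac dn}\Bigr)^s\wedge1.$$ 2. For $s=k+1+\rho$ for some integer $k\ge0$ and $\rho\in(0,1]$, suppose also that $\|\Sigma\|\lesssim1$, where $\Sigma$ is the covariance matrix of $\xi$. If $d\lesssim n^\alpha$ for some $\alpha\in(0,1)$, then $$\sup_{\|f\|_{C^s}\le1}\sup_{\theta\in\mathbb{R}^d}\|f_k(\hat\theta)-f(\theta)\|_{L_2(\mathbb{P}_\theta)}\lesssim_{L,M,m,s}\Bigl(\frac1{\sqrt n}\vee\Bigl(\sqrt{\frac dn}\Bigr)^s\Bigr)\wedge1.$$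
   Context: Notation. For $A,B\ge0$, $A\lesssim B$ means that there is an absolute constant $C>0$ with $A\le CB$; subscripts, as in $A\lesssim_{L,M,m,s}B$, mean that the constant $C$ may depend on the listed parameters. $a\wedge b=\min(a,b)$, $a\vee b=\max(a,b)$. $\|\cdot\|$ is the Euclidean norm of vectors and the operator norm of matrices and multilinear forms. Model. Let $n,d\ge 1$ be integers and let $V:\mathbb{R}^d\to\mathbb{R}$ be a (known) convex function with $\int e^{-V(x)}dx=1$. Put $P(dx)=e^{-V(x)}dx$ and $P_\theta(dx)=e^{-V(x-\theta)}dx$, $\theta\in\mathbb{R}^d$. Under $\mathbb{P}_\theta$, $X_1,\dots,X_n$ are i.i.d. with law $P_\theta$; $\xi$ denotes a random vector with law $P$. The maximum likelihood estimator is $\hat\theta:=\operatorname{argmin}_{\theta\in\mathbb{R}^d}\frac1n\sum_{j=1}^nV(X_j-\theta)$ (it exists and is unique when $V$ is strictly convex). $V',V''$ are the gradient and Hessian of $V$; $\mathcal{I}:=\mathbb{E}V'(\xi)\otimes V'(\xi)$ is the Fisher information matrix (under Assumption 1 it equals $\mathbb{E}V''(\xi)$). Assumption 1 (constants $M,L,m>0$): (i) $V$ is strictly convex and twice continuously differentiable with $\|V''\|_{L_\infty}=\sup_x\|V''(x)\|\le M$ and $\|V''\|_{\rm Lip}=\sup_{x\ne y}\|V''(x)-V''(y)\|/\|x-y\|\le L$; (ii) $\mathcal{I}\succeq mI_d$. Hölder norm: for $s=l+\rho$, $l\ge0$ an integer, $\rho\in(0,1]$, and $f:\mathbb{R}^d\to\mathbb{R}$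 that is $l$ times differentiable, $\|f\|_{C^s}:=\max_{0\le j\le l}\sup_x\|f^{(j)}(x)\|\vee\sup_{x\neq y}\frac{\|f^{(l)}(x)-f^{(l)}(y)\|}{\|x-y\|^\rho}$; $f\in C^s$ means this is finite. The functions $f_k$: for bounded $g$ on $\mathbb{R}^d$ let $(\mathcal{T}g)(\theta):=\mathbb{E}_\theta g(\hat\theta)$ and $(\mathcal{B}g)(\theta):=(\mathcal{T}g)(\theta)-g(\theta)$. Then $f_k:=\sum_{j=0}^k(-1)^j\mathcal{B}^jf$. *)

(* Defs.v *)
From HB Require Import structures.
From mathcomp Require Import all_boot all_order all_algebra.
From mathcomp Require Import all_classical all_reals all_analysis.

Set Implicit Arguments.
Unset Strict Implicit.
Unset Printing Implicit Defensive.

Import Order.TTheory GRing.Theory Num.Theory.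
Import numFieldNormedType.Exports.

Local Open Scope classical_set_scope.
Local Open Scope ring_scope.

(* The library equips tuples, but not row vectors, with the product
   sigma-algebra. *)
Section measurable_row.
Context {R : realType} {d : nat}.

Definition row_coord (i : 'I_d) (x : 'rV[R]_d) : R := x ord0 i.

Let row_set0 : g_sigma_preimage row_coord set0.
Proof. exact: sigma_algebra0. Qed.

Let row_setC A : g_sigma_preimage row_coord A ->
  g_sigma_preimage row_coord (~` A).
Proof. exact: sigma_algebraC. Qed.

Let row_bigcup (F : (set 'rV[R]_d)^nat) :
  (forall i, g_sigma_preimage row_coord (F i)) ->
  g_sigma_preimage row_coord (\bigcup_i (F i)).
Proof. exact: sigma_algebra_bigcup. Qed.

HB.instance Definition _ :=
  @isMeasurable.Build (measure_tuple_display default_measure_display)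
    'rV[R]_d (g_sigma_preimage row_coord) row_set0 row_setC row_bigcup.

Lemma measurable_row_coord (i : 'I_d) :
  measurable_fun [set: 'rV[R]_d] (row_coord i).
Proof.
move=> _ Y mY; rewrite setTI; apply: sub_sigma_algebra => /=.
rewrite -bigcup_seq/=; exists i => /=; first by rewrite mem_index_enum.
by exists Y => //; rewrite setTI.
Qed.

Lemma measurable_fun_row d' (T : measurableType d') (f : T -> 'rV[R]_d) :
  (forall i, measurable_fun [set: T] (row_coord i \o f)) ->
  measurable_fun [set: T] f.
Proof.
move=> mf.
have sub : g_sigma_preimage (fun i => row_coord i \o f) `<=` measurable.
  apply: smallest_sub; first exact: sigma_algebra_measurable.
  rewrite -bigcup_seq; apply: bigcup_sub => i _ _ [B mB <-]; exact: mf.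
by move=> _ A mA; apply: sub; rewrite g_sigma_preimage_comp; exists A.
Qed.

End measurable_row.

Section row_cons.
Context {R : realType} {d : nat}.

Definition row_cons (p : measurableTypeR R * 'rV[R]_d) : 'rV[R]_d.+1 :=
  \row_i (if unlift ord0 i is Some j then p.2 ord0 j else p.1).

Definition row_uncons (x : 'rV[R]_d.+1) : measurableTypeR R * 'rV[R]_d :=
  (x ord0 ord0, \row_j x ord0 (lift ord0 j)).

Lemma row_consK : cancel row_cons row_uncons.
Proof.
move=> [t x]; congr (_, _); first by rewrite mxE unlift_none.
by apply/rowP => j; rewrite !mxE liftK.
Qed.

Lemma measurable_row_cons : measurable_fun [set: _] row_cons.
Proof.
apply: measurable_fun_row => i; have [j ->|->] := unliftP ord0 i.
  rewrite (_ : _ \o _ = row_coord j \o snd).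
    apply: measurableT_comp; first exact: measurable_row_coord.
    exact: measurable_snd.
  by apply/funext => p; rewrite /= /row_coord mxE liftK.
rewrite (_ : _ \o _ = fst); first exact: measurable_fst.
by apply/funext => p; rewrite /= /row_coord mxE unlift_none.
Qed.

Lemma measurable_row_uncons : measurable_fun [set: _] row_uncons.
Proof.
apply/measurable_fun_pair; first exact: measurable_row_coord.
apply: measurable_fun_row => i.
rewrite (_ : _ \o _ = row_coord (lift ord0 i)).
  exact: measurable_row_coord.
by apply/funext => x; rewrite /= /row_coord mxE.
Qed.

Variable mu : {sigma_finite_measure set 'rV[R]_d -> \bar R}.

Definition cons_measure : set 'rV[R]_d.+1 -> \bar R :=
  pushforward (lebesgue_measure \x mu)%E row_cons.

Let nu : {measure set 'rV[R]_d.+1 -> \bar R} :=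
  measure_function_pushforward__canonical__measure_function_Measure
    (lebesgue_measure \x mu)%E measurable_row_cons.

Let cons_measure0 : cons_measure set0 = 0%E.
Proof. exact: (measure0 nu). Qed.

Let cons_measure_ge0 A : (0 <= cons_measure A)%E.
Proof. exact: (measure_ge0 nu). Qed.

Let cons_measure_sigma_additive : semi_sigma_additive cons_measure.
Proof. exact: (@measure_semi_sigma_additive _ _ _ nu). Qed.

HB.instance Definition _ := isMeasure.Build _ _ _ cons_measure
  cons_measure0 cons_measure_ge0 cons_measure_sigma_additive.

Let cons_measure_sigma_finite : sigma_finite setT cons_measure.
Proof.
have /sigma_finiteP[F [TF ndF Foo]] :=
  sigma_finiteT (@lebesgue_measure R : {sigma_finite_measure set _ -> \bar R}).
have /sigma_finiteP[G [TG ndG Goo]] := sigma_finiteT mu.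
exists (fun k => row_uncons @^-1` (F k `*` G k)).
  apply/seteqP; split => // x _.
  have [k _ Fk] : (\bigcup_k F k) (row_uncons x).1 by rewrite -TF.
  have [l _ Gl] : (\bigcup_k G k) (row_uncons x).2 by rewrite -TG.
  exists (maxn k l) => //; split.
    by move: Fk; exact/subsetPset/ndF/leq_maxl.
  by move: Gl; exact/subsetPset/ndG/leq_maxr.
move=> k; have [mF Fk] := Foo k; have [mG Gk] := Goo k; split.
  rewrite -[X in measurable X]setTI.
  by apply: measurable_row_uncons => //; exact: measurableX.
rewrite /cons_measure /pushforward -comp_preimage.
rewrite (_ : _ \o _ = id); last by apply/funext => p; exact: row_consK.
by rewrite preimage_id product_measure1E// lte_mul_pinfty// ge0_fin_numE.
Qed.

HB.instance Definition _ := Measure_isSigmaFinite.Build _ _ _ cons_measure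
  cons_measure_sigma_finite.

End row_cons.

Fixpoint lebesgue_row (R : realType) (d : nat) :
    {sigma_finite_measure set 'rV[R]_d -> \bar R} :=
  if d is d'.+1 then cons_measure (lebesgue_row R d') else \d_(0 : 'rV[R]_0).

Lemma lebesgue_row_box (R : realType) d (A : 'I_d -> set R) :
  (forall i, measurable (A i)) ->
  lebesgue_row R d [set x | forall i, A i (x ord0 i)] =
  (\prod_(i < d) @lebesgue_measure R (A i))%E.
Proof.
elim: d A => [|d IHd] A mA.
  by rewrite big_ord0 /= diracE mem_set // => -[].
rewrite big_ord_recl -IHd; last by move=> i; exact: mA.
rewrite /= /cons_measure /pushforward -product_measure1E//.
- congr (_ _); apply/seteqP; split => -[t x] /=.
    move=> H; split; first by have := H ord0; rewrite mxE unlift_none.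
    by move=> i; have := H (lift ord0 i); rewrite mxE liftK.
  by move=> [At Ax] i; rewrite mxE; case: unliftP => [j ->|->].
- exact: mA.
- rewrite [X in measurable X](_ : _ =
    \bigcap_(i in [set: 'I_d]) (row_coord i @^-1` A (lift ord0 i))).
    apply: fin_bigcap_measurable => // i _.
    by rewrite -[X in measurable X]setTI; exact: measurable_row_coord.
  by apply/seteqP; split => x /= H; [move=> i _; exact: H|move=> i; exact: H].
Qed.

Section norms.
Context {R : realType} {d : nat}.

(* The norm `|x| that the library puts on 'rV[R]_d is the maximum norm. *)
Definition enorm (x : 'rV[R]_d) : R := Num.sqrt (\sum_i x ord0 i ^+ 2).

Definition opnorm (A : 'M[R]_d) : R :=
  sup [set enorm (x *m A) | x in [set x | enorm x <= 1]].

Definition formnorm (j : nat) (T : j.-tuple 'rV[R]_d -> R) : \bar R :=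
  ereal_sup [set `|T v|%:E | v in
    [set v : j.-tuple 'rV[R]_d | forall i, enorm (tnth v i) <= 1]].

Definition loewner_le (A B : 'M[R]_d) : Prop :=
  forall u : 'rV[R]_d, 0 <= (u *m (B - A) *m u^T) ord0 ord0.

End norms.

Section derivatives.
Context {R : realType} {d : nat}.
Implicit Types (f : 'rV[R]_d -> R) (x : 'rV[R]_d).

Definition gradient f x : 'rV[R]_d := \row_i 'd f x (delta_mx ord0 i).

Definition hessian f x : 'M[R]_d := jacobian (gradient f) x.

Definition twice_continuously_differentiable f : Prop :=
  [/\ forall x, differentiable f x,
      forall x, differentiable (gradient f) x &
      continuous (hessian f)].

(* iter_diff f [:: v_1; ...; v_j] x is f^(j)(x)[v_1, ..., v_j]: the form
   f^(j+1)(x)[v, v_1, ..., v_j] is the differential at x, in the direction v,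
   of y |-> f^(j)(y)[v_1, ..., v_j]. *)
Definition iter_diff f (vs : seq 'rV[R]_d) : 'rV[R]_d -> R :=
  foldr (fun v (g : 'rV[R]_d -> R) x => 'd g x v) f vs.

Definition deriv_form f (j : nat) x : j.-tuple 'rV[R]_d -> R :=
  fun vs => iter_diff f vs x.
Arguments deriv_form f j x vs : clear implicits.

(* The space of j-linear forms is finite dimensional, so f^(j) is
   differentiable iff all its evaluations are. *)
Definition times_differentiable (l : nat) f : Prop :=
  forall vs : seq 'rV[R]_d, (size vs < l)%N ->
    forall x, differentiable (iter_diff f vs) x.

Definition hoelder_norm (l : nat) (rho : R) f : \bar R :=
  maxe
    (\big[maxe/0%E]_(j < l.+1)
       ereal_sup [set formnorm (deriv_form f j x) | x in [set: 'rV[R]_d]])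
    (ereal_sup
       [set (formnorm (fun vs =>
                         deriv_form f l z.1 vs - deriv_form f l z.2 vs)%R
             * ((enorm (z.1 - z.2) `^ rho)^-1)%:E)%E
       | z in [set z : 'rV[R]_d * 'rV[R]_d | z.1 != z.2]]).

(* The unit ball of C^s, for s = l + rho. *)
Definition hoelder_ball (l : nat) (rho : R) : set ('rV[R]_d -> R) :=
  [set f | times_differentiable l f /\ (hoelder_norm l rho f <= 1)%E].

End derivatives.

Section location_model.
Context {R : realType} {d : nat}.
Implicit Types (V : 'rV[R]_d -> R) (P : probability 'rV[R]_d R).

Definition has_density (mu : set 'rV[R]_d -> \bar R) (p : 'rV[R]_d -> R) :
    Prop :=
  forall A, measurable A -> mu A = (\int[lebesgue_row R d]_(x in A) (p x)%:E)%E.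

Definition strictly_convex V : Prop :=
  forall x y (t : R), x != y -> 0 < t < 1 ->
    V (t *: x + (1 - t) *: y) < t * V x + (1 - t) * V y.

Definition fisher_information V P : 'M[R]_d :=
  \matrix_(i, j) fine ('E_P[fun x => gradient V x ord0 i * gradient V x ord0 j]).

Definition covariance_matrix P : 'M[R]_d :=
  \matrix_(i, j) fine (covariance P (row_coord i) (row_coord j)).

Definition assumption1 V P (L M m : R) : Prop :=
  [/\ strictly_convex V,
      twice_continuously_differentiable V,
      (ereal_sup [set (opnorm (hessian V x))%:E | x in [set: 'rV[R]_d]]
         <= M%:E)%E,
      (ereal_sup
         [set (opnorm (hessian V z.1 - hessian V z.2)
               / enorm (z.1 - z.2))%:E
         | z in [set z : 'rV[R]_d * 'rV[R]_d | z.1 != z.2]] <= L%:E)%E &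
      loewner_le m%:M (fisher_information V P)].

(* The argmin is unique whenever it exists, by strict convexity; the value 0
   is a dummy for an empty argmin. *)
Definition mle V (n : nat) (x : 'I_n -> 'rV[R]_d) : 'rV[R]_d :=
  let loss theta := n%:R^-1 * \sum_(j < n) V (x j - theta) in
  xget 0 [set theta | forall theta', loss theta <= loss theta'].

Section sample.
Context {disp : measure_display} {Omega : measurableType disp} {n : nat}.
Implicit Types (PP : 'rV[R]_d -> probability Omega R)
  (X : 'I_n -> Omega -> 'rV[R]_d).

Definition independent_vectors (Q : probability Omega R) X : Prop :=
  forall A : 'I_n -> set 'rV[R]_d, (forall j, measurable (A j)) ->
    Q (\bigcap_(j in [set: 'I_n]) (X j @^-1` A j)) =
    (\prod_(j < n) Q (X j @^-1` A j))%E.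

(* Under PP theta, the X_j are i.i.d. with law e^{-V(x - theta)} dx. *)
Definition location_sample V PP X : Prop :=
  (forall j, measurable_fun [set: Omega] (X j)) /\
  forall theta, independent_vectors (PP theta) X /\
    forall j, has_density (pushforward (PP theta) (X j))
                          (fun x => expR (- V (x - theta))).

Definition mle_stat V X (w : Omega) : 'rV[R]_d := mle V (fun j => X j w).

Definition T_op V PP X (g : 'rV[R]_d -> R) : 'rV[R]_d -> R :=
  fun theta => fine ('E_(PP theta)[fun w => g (mle_stat V X w)]).

Definition B_op V PP X (g : 'rV[R]_d -> R) : 'rV[R]_d -> R :=
  fun theta => T_op V PP X g theta - g theta.

Definition f_red V PP X (k : nat) (f : 'rV[R]_d -> R) : 'rV[R]_d -> R :=
  fun theta => \sum_(j < k.+1) (-1) ^+ j * iter j (B_op V PP X) f theta.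

Definition L2_error V PP X (g f : 'rV[R]_d -> R) (theta : 'rV[R]_d) : \bar R :=
  'N[PP theta]_2%:E[EFin \o (fun w => g (mle_stat V X w) - f theta)%R]%E.

End sample.
End location_model.

(* Main.v *)
(* Under P_theta the estimator is theta + Z, where the law of Z does not depend on
   theta. Let S be the empirical mean of V'(xi_j), H = E V''(xi), and let dev measure
   the size of S and of the deviation of the empirical Hessian from H; by a
   Rosenthal inequality the moments of dev are those of sqrt (d / n). When dev <= 1,
   strong convexity near 0 gives |Z| = O(dev) and H Z = S + O(dev^2).

   Bias: E f_k(theta + Z) - f(theta) = (-1)^k B^(k+1) f (theta). Since B commutes
   with differentiation, each application of B trades one derivative for a factor
   E min(1, |Z|) = O(sqrt (d / n)); in the last one the linear term <H^-1 f', S> has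
   mean zero and the rest is O(dev^(1 + rho)).

   Variance: Efron-Stein, the i-th variable being replaced by a critical point of V.
   If both samples have dev <= 1, the estimator moves by O((1 + |V'(xi_i)|) / n), and
   to first order by H^-1 V'(xi_i) / n, so that its increment in a fixed direction
   has second moment O(1 / n^2), without a factor d. *)
Require Import Defs.
From HB Require Import structures.
From mathcomp Require Import all_boot all_order all_algebra.
From mathcomp Require Import all_classical all_reals all_analysis.
From mathcomp Require Import measurable_realfun.
From mathcomp Require Import ring lra.

Set Implicit Arguments.
Unset Strict Implicit.
Unset Printing Implicit Defensive.

Import Order.TTheory GRing.Theory Num.Theory.
Import numFieldNormedType.Exports.

Local Open Scope classical_set_scope.
Local Open Scope ring_scope.


(** Two obstacles shape the proof. First, the estimator is controlled only on samples with
    [dev <= 1]; elsewhere only the boundedness of the functional is available, so bad samples are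
    paid for by moments of [dev] whose order grows with the smoothness, and no constant may depend
    on the dimension. This is why the moment inequality for sums is proved in arbitrary Euclidean
    spaces with a constant free of their dimension: it serves for the score, sub-Gaussian in each
    direction because the Hessian of [V] is bounded, and for the Hessian in Frobenius norm. Second,
    the displacement of the estimator caused by one observation has squared norm of order d / n^2,
    so that Efron-Stein with this bound alone would give d / n instead of 1 / n. The increment is
    therefore linearised at the sample where the observation has been replaced: the dual direction
    against which the removed score is tested depends on the other observations only, stays fixed
    while the removed one is averaged, and meets a single directional second moment. For d > n the
    functionals are bounded and the claimed rate is bounded below, so only d <= n needs the
    analysis. *)

(** * Euclidean geometry of row vectors, Frobenius norm, coercive matrices *)

Section euclid.
Context {R : realType}.

Definition dot {d} (x y : 'rV[R]_d) : R := \sum_i x ord0 i * y ord0 i.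

Lemma dotE d (x y : 'rV[R]_d) : dot x y = \sum_i x ord0 i * y ord0 i.
Proof. by []. Qed.

Lemma dotC d (x y : 'rV[R]_d) : dot x y = dot y x.
Proof. by apply: eq_bigr => i _; rewrite mulrC. Qed.

Lemma dotDl d (x y z : 'rV[R]_d) : dot (x + y) z = dot x z + dot y z.
Proof. by rewrite -big_split; apply: eq_bigr => i _; rewrite mxE mulrDl. Qed.

Lemma dotZl d a (x z : 'rV[R]_d) : dot (a *: x) z = a * dot x z.
Proof. by rewrite mulr_sumr; apply: eq_bigr => i _; rewrite mxE mulrA. Qed.

Lemma dotDr d (x y z : 'rV[R]_d) : dot x (y + z) = dot x y + dot x z.
Proof. by rewrite dotC dotDl !(dotC x). Qed.

Lemma dotZr d a (x z : 'rV[R]_d) : dot x (a *: z) = a * dot x z.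
Proof. by rewrite dotC dotZl dotC. Qed.

Lemma dotNl d (x z : 'rV[R]_d) : dot (- x) z = - dot x z.
Proof. by rewrite -scaleN1r dotZl mulN1r. Qed.

Lemma dotNr d (x z : 'rV[R]_d) : dot x (- z) = - dot x z.
Proof. by rewrite dotC dotNl dotC. Qed.

Lemma dot0l d (z : 'rV[R]_d) : dot 0 z = 0.
Proof. by rewrite -(scale0r 0) dotZl mul0r. Qed.

Lemma dot0r d (z : 'rV[R]_d) : dot z 0 = 0.
Proof. by rewrite dotC dot0l. Qed.

Lemma dotBl d (x y z : 'rV[R]_d) : dot (x - y) z = dot x z - dot y z.
Proof. by rewrite dotDl dotNl. Qed.

Lemma dotBr d (x y z : 'rV[R]_d) : dot x (y - z) = dot x y - dot x z.
Proof. by rewrite dotDr dotNr. Qed.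

Lemma dot_sumr d I (r : seq I) (Q : pred I) (x : 'rV[R]_d) (F : I -> 'rV[R]_d) :
  dot x (\sum_(i <- r | Q i) F i) = \sum_(i <- r | Q i) dot x (F i).
Proof. exact: (big_morph (dot x) (dotDr x) (dot0r x)). Qed.

Lemma dot_ge0 d (x : 'rV[R]_d) : 0 <= dot x x.
Proof. by apply: sumr_ge0 => i _; rewrite -expr2 sqr_ge0. Qed.

Lemma dot_mulmx d e (x : 'rV[R]_d) (A : 'M[R]_(d, e)) y :
  dot (x *m A) y = dot x (y *m A^T).
Proof.
rewrite /dot; under eq_bigr do rewrite mxE mulr_suml.
under [RHS]eq_bigr do rewrite mxE mulr_sumr.
rewrite exchange_big; apply: eq_bigr => i _; apply: eq_bigr => j _.
by rewrite mxE; ring.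
Qed.

Lemma mulmx_dot d (x y : 'rV[R]_d) : (x *m y^T) ord0 ord0 = dot x y.
Proof. by rewrite mxE; apply: eq_bigr => i _; rewrite mxE. Qed.

Lemma dot_deltar d (x : 'rV[R]_d) i : dot x (delta_mx ord0 i) = x ord0 i.
Proof.
rewrite /dot (bigD1 i)//= big1 ?addr0; first by rewrite mxE !eqxx mulr1.
by move=> j /negPf ji; rewrite mxE ji andbF mulr0.
Qed.

Lemma enormE d (x : 'rV[R]_d) : enorm x = Num.sqrt (dot x x).
Proof. by congr Num.sqrt; apply: eq_bigr => i _; rewrite expr2. Qed.

Lemma enorm_ge0 d (x : 'rV[R]_d) : 0 <= enorm x.
Proof. exact: sqrtr_ge0. Qed.
Hint Resolve enorm_ge0 : core.

Lemma sqr_enorm d (x : 'rV[R]_d) : enorm x ^+ 2 = dot x x.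
Proof. by rewrite enormE sqr_sqrtr// dot_ge0. Qed.

Lemma enorm0 d : enorm (0 : 'rV[R]_d) = 0.
Proof. by rewrite enormE dot0l sqrtr0. Qed.

Lemma enorm_eq0 d (x : 'rV[R]_d) : (enorm x == 0) = (x == 0).
Proof.
apply/eqP/eqP => [x0|->]; last exact: enorm0.
have /eqP : dot x x = 0 by rewrite -sqr_enorm x0 expr0n.
rewrite psumr_eq0; last by move=> i _; rewrite -expr2 sqr_ge0.
move=> /allP h; apply/rowP => i; have := h i; rewrite mem_index_enum => /(_ isT).
by rewrite mulf_eq0 orbb mxE => /eqP.
Qed.

Lemma enorm_gt0 d (x : 'rV[R]_d) : (0 < enorm x) = (x != 0).
Proof. by rewrite lt_neqAle eq_sym enorm_eq0 enorm_ge0 andbT. Qed.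

Lemma enormZ d a (x : 'rV[R]_d) : enorm (a *: x) = `|a| * enorm x.
Proof. by rewrite !enormE dotZl dotZr mulrA -expr2 sqrtrM ?sqr_ge0// sqrtr_sqr. Qed.

Lemma enormN d (x : 'rV[R]_d) : enorm (- x) = enorm x.
Proof. by rewrite -scaleN1r enormZ normrN1 mul1r. Qed.

Lemma enormBC d (x y : 'rV[R]_d) : enorm (x - y) = enorm (y - x).
Proof. by rewrite -enormN opprB. Qed.

Lemma dot_le d (x y : 'rV[R]_d) : dot x y <= enorm x * enorm y.
Proof.
have [->|y0] := eqVneq y 0; first by rewrite dot0r enorm0 mulr0.
have [->|x0] := eqVneq x 0; first by rewrite dot0l enorm0 mul0r.
have nx : 0 < enorm x by rewrite enorm_gt0.
have ny : 0 < enorm y by rewrite enorm_gt0.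
have := dot_ge0 (enorm y *: x - enorm x *: y).
rewrite dotBl !dotBr !dotZl !dotZr -!sqr_enorm (dotC y x) => h.
rewrite -(ler_pM2l (mulr_gt0 nx ny)); nra.
Qed.

Lemma normr_dot_le d (x y : 'rV[R]_d) : `|dot x y| <= enorm x * enorm y.
Proof.
rewrite ler_norml dot_le andbT -lerN2 opprK -dotNl -(enormN x).
exact: dot_le.
Qed.

Lemma ler_enormD d (x y : 'rV[R]_d) : enorm (x + y) <= enorm x + enorm y.
Proof.
rewrite -(@ler_pXn2r _ 2)// ?nnegrE ?addr_ge0// sqr_enorm sqrrD !sqr_enorm.
by rewrite dotDl !dotDr (dotC y x); have := dot_le x y; lra.
Qed.

Lemma ler_enormB d (x y : 'rV[R]_d) : enorm (x - y) <= enorm x + enorm y.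
Proof. by rewrite -(enormN y) ler_enormD. Qed.

Lemma ler_enorm_dist d (x y : 'rV[R]_d) : enorm x <= enorm y + enorm (x - y).
Proof. by rewrite -{1}(subrKC y x) ler_enormD. Qed.

Lemma enorm_sum d I (r : seq I) (Q : pred I) (F : I -> 'rV[R]_d) :
  enorm (\sum_(i <- r | Q i) F i) <= \sum_(i <- r | Q i) enorm (F i).
Proof.
elim/big_ind2 : _ => [|x a y b xa yb|//]; first by rewrite enorm0.
exact: le_trans (ler_enormD _ _) (lerD xa yb).
Qed.

Lemma coord_enorm d (x : 'rV[R]_d) i : `|x ord0 i| <= enorm x.
Proof.
rewrite -dot_deltar -[leRHS]mulr1; apply: (le_trans (normr_dot_le _ _)).
by rewrite ler_wpM2l// enormE dot_deltar mxE !eqxx sqrtr1.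
Qed.

Lemma enorm_delta d (i : 'I_d) : enorm (delta_mx ord0 i : 'rV[R]_d) = 1.
Proof. by rewrite enormE dot_deltar mxE !eqxx sqrtr1. Qed.

Lemma enorm_le_sum d (x : 'rV[R]_d) : enorm x <= \sum_i `|x ord0 i|.
Proof.
rewrite {1}(row_sum_delta x); apply: (le_trans (enorm_sum _ _ _)).
by apply: ler_sum => i _; rewrite enormZ enorm_delta mulr1.
Qed.

Lemma normr_enorm d (x : 'rV[R]_d) : `|x| <= enorm x.
Proof.
rewrite /Num.norm /= mx_normrE.
elim/big_ind : _ => [//|a b ha hb|[i j] _ /=].
  by rewrite ge_max ha hb.
by rewrite ord1 coord_enorm.
Qed.

(* Duality: the norm is attained against the unit vector along x. *)
Lemma enorm_le_dot d (x : 'rV[R]_d) C : 0 <= C ->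
  (forall u, enorm u <= 1 -> dot u x <= C) -> enorm x <= C.
Proof.
move=> C0 h; have [->|x0] := eqVneq x 0; first by rewrite enorm0.
have nx : 0 < enorm x by rewrite enorm_gt0.
have := h ((enorm x)^-1 *: x).
rewrite enormZ dotZl ger0_norm ?invr_ge0// mulVf ?gt_eqF// => /(_ (lexx _)).
by rewrite -sqr_enorm expr2 mulrA mulVf ?gt_eqF// mul1r.
Qed.

Definition fnorm {d e} (A : 'M[R]_(d, e)) : R := enorm (mxvec A).

Lemma fnormE d e (A : 'M[R]_(d, e)) : fnorm A = enorm (mxvec A).
Proof. by []. Qed.

Lemma fnorm_sum d e (A : 'M[R]_(d, e)) :
  fnorm A ^+ 2 = \sum_i enorm (row i A) ^+ 2.
Proof.
rewrite sqr_enorm /dot; under [RHS]eq_bigr do rewrite sqr_enorm /dot.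
rewrite pair_bigA/= (reindex _ (curry_mxvec_bij d e))/=.
by apply: eq_bigr => -[i j] _ /=; rewrite !mxvecE !mxE.
Qed.

Lemma enorm_mulmx_fnorm d e (x : 'rV[R]_d) (A : 'M[R]_(d, e)) :
  enorm (x *m A) <= enorm x * fnorm A.
Proof.
have f0 : 0 <= fnorm A by exact: enorm_ge0.
apply: enorm_le_dot; first exact: mulr_ge0.
move=> u u1; rewrite dotC dot_mulmx; apply: (le_trans (dot_le _ _)).
rewrite ler_wpM2l//.
rewrite -(@ler_pXn2r _ 2)// ?nnegrE// fnorm_sum sqr_enorm.
apply: ler_sum => i _.
have -> : (u *m A^T) ord0 i = dot u (row i A).
  by rewrite mxE; apply: eq_bigr => j _; rewrite !mxE.
rewrite -expr2 -real_normK ?num_real// lerXn2r ?nnegrE//.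
apply: (le_trans (normr_dot_le _ _)).
by rewrite -[leRHS]mul1r ler_wpM2r.
Qed.

Lemma opnorm_bounded d (A : 'M[R]_d) x : enorm x <= 1 -> enorm (x *m A) <= opnorm A.
Proof.
move=> x1; apply: ub_le_sup; last by exists x.
exists (fnorm A) => _ [y /= y1 <-]; apply: (le_trans (enorm_mulmx_fnorm _ _)).
by rewrite -[leRHS]mul1r ler_wpM2r//; exact: enorm_ge0.
Qed.

Lemma enorm_mulmx_opnorm d (A : 'M[R]_d) x : enorm (x *m A) <= opnorm A * enorm x.
Proof.
have [->|x0] := eqVneq x 0; first by rewrite mul0mx enorm0 mulr0.
have nx : 0 < enorm x by rewrite enorm_gt0.
have := @opnorm_bounded _ A ((enorm x)^-1 *: x).
rewrite -scalemxAl !enormZ ger0_norm ?invr_ge0// mulVf ?gt_eqF// => /(_ (lexx _)).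
by rewrite mulrC ler_pdivrMr.
Qed.

(** The rows of [A] are the images of the [d] coordinate vectors. This factor [d] is the source of
    the [d / n] in the fluctuations of the empirical Hessian. *)
Lemma fnorm_le_opnorm d (A : 'M[R]_d) C : 0 <= C ->
  (forall x, enorm (x *m A) <= C * enorm x) -> fnorm A ^+ 2 <= d%:R * C ^+ 2.
Proof.
move=> C0 h; rewrite fnorm_sum.
apply: (@le_trans _ _ (\sum_(i < d) C ^+ 2)); last by rewrite sumr_const card_ord mulr_natl.
apply: ler_sum => i _; rewrite lerXn2r ?nnegrE//.
by have := h (delta_mx ord0 i); rewrite enorm_delta mulr1 -rowE.
Qed.

(** Coercivity makes the transpose of [K] injective, hence invertible. The lemma moves a test
    direction [g] for a displacement [h] to a test direction [w] for [h *m K], whose size is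
    governed by the coercivity constant and not by the dimension. *)
Lemma coercive_solve d (K : 'M[R]_d) (c : R) (g : 'rV[R]_d) : 0 < c ->
  (forall x, c * enorm x ^+ 2 <= dot (x *m K) x) ->
  exists2 w, (forall h, dot w (h *m K) = dot g h) & c * enorm w <= enorm g.
Proof.
move=> c0 hK.
have uK : K^T \in unitmx.
  rewrite -row_free_unit; apply/inj_row_free => v vK; apply/eqP.
  rewrite -enorm_eq0 -[_ == 0]sqrf_eq0; have := hK v.
  rewrite dot_mulmx vK dot0r; rewrite eq_le sqr_ge0 andbT => h.
  by rewrite -(ler_pM2l c0) mulr0.
exists (g *m invmx K^T).
  move=> h; rewrite dotC dot_mulmx -mulmxA mulVmx// mulmx1; exact: dotC.
set w := _ *m _.
have [w0|w0] := eqVneq w 0; first by rewrite w0 enorm0 mulr0.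
have nw : 0 < enorm w by rewrite enorm_gt0.
rewrite -(ler_pM2r nw) -mulrA -expr2; apply: (le_trans (hK w)).
by rewrite dot_mulmx -mulmxA mulVmx// mulmx1 dotC dot_le.
Qed.

End euclid.
#[global] Hint Extern 0 (is_true (0 <= enorm _)) => exact: enorm_ge0 : core.

(** * Derivatives along lines *)

Section calculus1.
Context {R : realType}.

Lemma is_derive_line (U W : normedModType R) (g : U -> W) (x u : U) (t : R) :
  differentiable g (x + t *: u) ->
  is_derive t (1 : R) (fun s : R => g (x + s *: u)) ('d g (x + t *: u) u).
Proof.
move=> dg.
have dl : is_diff t (fun s : R => x + s *: u) (fun s : R => s *: u).
  apply: is_diff_eq (_ : 0 + _ = _); last by rewrite add0r.
have dc := @is_diff_comp _ _ _ _ _ _ g _ t dl (differentiableP dg).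
have dd : differentiable (fun s : R => g (x + s *: u)) t by case: dc.
apply: DeriveDef; first exact/derivable1_diffP.
rewrite deriveE//.
have -> : 'd (fun s : R => g (x + s *: u)) t = 'd g (x + t *: u) \o (fun s : R => s *: u) :> (R -> W).
  by case: dc.
by rewrite /= scale1r.
Qed.

Lemma derive_mvt (f df : R -> R) (b : R) : 0 <= b ->
  (forall t : R, is_derive t (1 : R) f (df t)) ->
  exists2 c, 0 <= c <= b & f b - f 0 = df c * b.
Proof.
move=> b0 dfh; have [|c] := @MVT_segment R f df 0 b b0 (fun x _ => dfh x).
  apply: continuous_subspaceT => x; apply: differentiable_continuous.
  by apply/derivable1_diffP; case: (dfh x).
by rewrite in_itv/= subr0 => ? ->; exists c.
Qed.

Lemma derive_bound (f df : R -> R) (b B : R) : 0 <= b ->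
  (forall t : R, is_derive t (1 : R) f (df t)) ->
  (forall t, 0 <= t <= b -> `|df t| <= B) -> `|f b - f 0| <= B * b.
Proof.
move=> b0 dfh dB; have [c cb ->] := derive_mvt b0 dfh.
by rewrite normrM (ger0_norm b0) ler_wpM2r// dB.
Qed.

End calculus1.

(** * Taylor and convexity bounds for the potential *)

Section potential.
Context {R : realType} {d : nat} (V : 'rV[R]_d -> R) (L M : R).
Hypotheses (L0 : 0 < L) (M0 : 0 < M).
Hypothesis V_sc : strictly_convex V.
Hypothesis V_C2 : twice_continuously_differentiable V.
Hypothesis V_M : (ereal_sup [set (opnorm (hessian V x))%:E | x in [set: 'rV[R]_d]]
         <= M%:E)%E.
Hypothesis V_L : (ereal_sup
         [set (opnorm (hessian V z.1 - hessian V z.2)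
               / enorm (z.1 - z.2))%:E
         | z in [set z : 'rV[R]_d * 'rV[R]_d | z.1 != z.2]] <= L%:E)%E.

Local Notation DV := (gradient V).
Local Notation HV := (hessian V).

Lemma diffV_dot x u : 'd V x u = dot u (DV x).
Proof.
rewrite {1}(row_sum_delta u) linear_sum; apply: eq_bigr => i _.
by rewrite linearZ /= mxE.
Qed.

Lemma diffDV_hessian x u : 'd DV x u = u *m HV x.
Proof.
have [_ dDV _] := V_C2.
by rewrite -deriveE// deriveEjacobian.
Qed.

Lemma hessian_bound x u : enorm (u *m HV x) <= M * enorm u.
Proof.
apply: (le_trans (enorm_mulmx_opnorm _ _)); rewrite ler_wpM2r//.
rewrite -lee_fin; apply: le_trans V_M; apply: ereal_sup_ubound; by exists x.
Qed.

Lemma hessian_lip x y u : enorm (u *m (HV x - HV y)) <= L * enorm (x - y) * enorm u.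
Proof.
have [->|xy] := eqVneq x y.
  by rewrite !subrr mulmx0 enorm0 mulr0 mul0r.
apply: (le_trans (enorm_mulmx_opnorm _ _)); rewrite ler_wpM2r//.
rewrite -ler_pdivrMr ?enorm_gt0 ?subr_eq0//.
rewrite -lee_fin; apply: le_trans V_L; apply: ereal_sup_ubound; by exists (x, y).
Qed.

Lemma is_derive_V x u t : is_derive t (1 : R) (fun s : R => V (x + s *: u)) (dot u (DV (x + t *: u))).
Proof.
by have [dV _ _] := V_C2; rewrite -diffV_dot; apply: is_derive_line.
Qed.

Lemma is_derive_DV x u w t : is_derive t (1 : R) (fun s : R => dot w (DV (x + s *: u)))
  (dot w (u *m HV (x + t *: u))).
Proof.
have [_ dDV _] := V_C2.
have h := is_derive_line (dDV (x + t *: u)).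
rewrite diffDV_hessian in h.
have [dh eh] := h.
have cd i : is_derive t (1 : R) (fun s : R => DV (x + s *: u) ord0 i)
    ((u *m HV (x + t *: u)) ord0 i).
  apply: DeriveDef.
    by move/derivable_mxP : dh => /(_ ord0 i).
  by rewrite -eh derive_mx// mxE.
rewrite /dot.
have -> : (fun s : R => \sum_i w ord0 i * DV (x + s *: u) ord0 i) =
   \sum_i (fun s : R => w ord0 i * DV (x + s *: u) ord0 i).
  by apply/funext => s; rewrite fct_sumE.
exact: is_derive_sum.
Qed.

#[local] Opaque gradient hessian dot enorm.

Lemma gradient_lip x h : enorm (DV (x + h) - DV x) <= M * enorm h.
Proof.
apply: enorm_le_dot; first by rewrite mulr_ge0// ltW.
move=> u u1; rewrite dotBr.
have := @derive_bound _ _ _ 1 (M * enorm h) ler01 (is_derive_DV x h u).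
rewrite scale1r scale0r addr0 mulr1 => /(_ _)/(le_trans (ler_norm _)); apply.
move=> t _; apply: (le_trans (normr_dot_le _ _)).
rewrite -[leRHS]mul1r; apply: ler_pM => //; exact: hessian_bound.
Qed.

Lemma gradient_taylor x h : enorm (DV (x + h) - DV x - h *m HV x) <= L * enorm h ^+ 2.
Proof.
apply: enorm_le_dot; first by rewrite mulr_ge0 ?exprn_ge0// ltW.
move=> u u1; rewrite dotBr dotBr.
have [k kE] : exists k, k = dot u (h *m HV x) by exists (dot u (h *m HV x)).
rewrite -kE.
(* Subtracting the linear part leaves a function whose derivative at [t] pairs [u] with the image of
   [h] under the Hessian increment from [x] to [x + t *: h]. *)
pose F : R -> R := (fun s : R => dot u (DV (x + s *: h))) - (fun s : R => k * s).
have h2 (t : R) : is_derive t (1 : R) (fun s : R => k * s) k.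
  exact: is_derive_eq (is_deriveZ k (is_derive_id t (1 : R))) (mulr1 k).
have hd t : is_derive t (1 : R) F (dot u (h *m HV (x + t *: h)) - k).
  exact: is_deriveB (is_derive_DV x h u t) (h2 t).
have : `|dot u (DV (x + 1 *: h)) - k * 1 - (dot u (DV (x + 0 *: h)) - k * 0)|
    <= L * enorm h ^+ 2 * 1.
  apply: derive_bound ler01 hd _ => t /andP[t0 t1].
  rewrite kE -dotBr -mulmxBr.
  apply: (le_trans (normr_dot_le _ _)).
  rewrite -[leRHS]mul1r; apply: ler_pM => //.
  apply: (le_trans (hessian_lip _ _ _)).
  rewrite [x + _]addrC addrK enormZ ger0_norm// expr2 -!mulrA ler_wpM2l ?(ltW L0)//.
  by rewrite ler_piMl ?mulr_ge0.
rewrite [1 *: h]scale1r [0 *: h]scale0r [x + 0]addr0 [k * 1]mulr1 [k * 0]mulr0 [leRHS]mulr1.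
have aux (a b c B : R) : `|a - c - (b - 0)| <= B -> a - b - c <= B.
  by rewrite ler_norml subr0 => /andP[_]; rewrite addrAC.
exact: aux.
Qed.

Lemma V_upper x h : V (x + h) <= V x + dot h (DV x) + M * enorm h ^+ 2.
Proof.
have [c /andP[c0 c1]] := derive_mvt ler01 (is_derive_V x h).
rewrite scale1r scale0r addr0 mulr1 => /eqP; rewrite subr_eq => /eqP ->.
rewrite addrC -addrA lerD2l -lerBlDl -dotBr.
apply: (le_trans (dot_le _ _)); rewrite expr2 mulrCA ler_wpM2l//.
apply: (le_trans (gradient_lip _ _)).
by rewrite enormZ ger0_norm// ler_wpM2l ?(ltW M0)// ler_piMl.
Qed.

Lemma V_convex x y (t : R) : 0 <= t <= 1 -> V (x + t *: (y - x)) <= V x + t * (V y - V x).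
Proof.
move=> /andP[t0 t1].
have [->|xy] := eqVneq y x; first by rewrite !subrr scaler0 addr0 mulr0 addr0.
have [->|t0'] := eqVneq t 0; first by rewrite scale0r addr0 mul0r addr0.
have [->|t1'] := eqVneq t 1; first by rewrite scale1r mul1r addrC subrK addrC subrK.
have := V_sc (t := t) xy; rewrite lt_neqAle eq_sym t0' t0 lt_neqAle t1' t1 => /(_ isT) /ltW.
have -> : t *: y + (1 - t) *: x = x + t *: (y - x).
  by rewrite scalerBl scalerBr scale1r addrCA addrA addrC addrCA addrA.
by move=> h; apply: (le_trans h); lra.
Qed.

Lemma gradient_ineq x h : V x + dot h (DV x) <= V (x + h).
Proof.
apply/ler_addgt0Pr => e e0.
(* By convexity the slope of V at scale t is at most V (x + h) - V x, and it is
   within M t |h|^2 of the derivative. *)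
have K0 : 0 < M * enorm h ^+ 2 + 1 by rewrite ltr_wpDl// mulr_ge0 ?exprn_ge0// ltW.
pose t := Num.min 1 (e / (M * enorm h ^+ 2 + 1)).
have t0 : 0 < t by rewrite lt_min ltr01 divr_gt0.
have t1 : t <= 1 by rewrite ge_min lexx.
have := @V_convex x (x + h) t; rewrite (ltW t0) t1 => /(_ isT).
have [c /andP[c0 ct]] := derive_mvt (ltW t0) (is_derive_V x h).
rewrite [0 *: h]scale0r [x + 0]addr0 [x + h - x]addrC addKr => E1 E2.
have hh : dot h (DV (x + c *: h)) <= V (x + h) - V x.
  by rewrite -(ler_pM2r t0) -E1 lerBlDl [_ * t]mulrC.
have hc : `|dot h (DV (x + c *: h)) - dot h (DV x)| <= M * enorm h ^+ 2 * t.
  rewrite -dotBr; apply: (le_trans (normr_dot_le _ _)).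
  rewrite expr2 mulrCA -!mulrA ler_wpM2l//; apply: (le_trans (gradient_lip _ _)).
  by rewrite enormZ ger0_norm// ler_wpM2l ?(ltW M0)// mulrC ler_wpM2l.
have ht : (M * enorm h ^+ 2 + 1) * t <= e.
  by rewrite mulrC -ler_pdivlMr// ge_min lexx orbT.
move: hc; rewrite ler_norml => /andP[hc _].
have aux (a b c' e' s u w : R) :
    a <= b - c' -> - (u * s) <= a - w -> (u + 1) * s <= e' -> 0 < s -> c' + w <= b + e'.
  by clear; move=> *; lra.
exact: aux hh hc ht t0.
Qed.

Lemma continuous_V : continuous V.
Proof. by move=> x; apply: differentiable_continuous; case: V_C2. Qed.

Lemma continuous_gradient : continuous DV.
Proof. by move=> x; apply: differentiable_continuous; case: V_C2. Qed.

End potential.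

#[local] Opaque gradient hessian dot enorm opnorm fnorm.

(** * The Euclidean norm in the topology of row vectors *)

Section enorm_topology.
Context {R : realType} {d : nat}.
Implicit Types x y : 'rV[R]_d.

Lemma coord_normr x i : `|x ord0 i| <= `|x|.
Proof.
have /mapP[j Hj ->] : `|x ord0 i| \in [seq `|x z.1 z.2| | z : 'I_1 * 'I_d].
  by apply/mapP; exists (ord0, i) => //=; rewrite mem_enum.
by rewrite [leRHS]/Num.norm /= mx_normrE; apply/bigmax_geP; right => /=; exists j.
Qed.

Lemma enorm_normr x : enorm x <= d%:R * `|x|.
Proof.
apply: (le_trans (enorm_le_sum x)).
apply: (@le_trans _ _ (\sum_(i < d) `|x|)); last by rewrite sumr_const card_ord mulr_natl.
by apply: ler_sum => i _; exact: coord_normr.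
Qed.

Lemma near_enorm x e : 0 < e -> \forall y \near x, enorm (x - y) < e.
Proof.
move=> e0; have K0 : 0 < d%:R + 1 :> R by rewrite ltr_wpDl.
have := nbhsx_ballx x _ (divr_gt0 e0 K0); apply: filterS => y.
rewrite -ball_normE /= ltr_pdivlMr// mulrC => h.
apply: le_lt_trans h; apply: (le_trans (enorm_normr _)).
by rewrite ler_wpM2r// lerDl.
Qed.

Lemma dist_enorm x y : `|enorm x - enorm y| <= enorm (x - y).
Proof.
rewrite ler_norml; have := ler_enorm_dist x y; have := ler_enorm_dist y x.
rewrite (enormBC y); lra.
Qed.

Lemma continuous_enormB c : continuous (fun x : 'rV[R]_d => enorm (x - c)).
Proof.
move=> x; apply/(@cvgrPdist_le _ _ _ (nbhs x)) => e e0.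
apply: filterS (near_enorm x e0) => y /ltW; apply: le_trans.
by apply: (le_trans (dist_enorm _ _)); rewrite opprB addrA subrK.
Qed.

Lemma enorm_bounded (A : set 'rV[R]_d) r :
  (forall x, A x -> enorm x <= r) -> bounded_set A.
Proof.
move=> Ar; exists r; split; first exact: num_real.
move=> s rs x /Ar xr; apply: (le_trans (normr_enorm x)).
exact: le_trans xr (ltW rs).
Qed.

Lemma compact_enorm_ball (c : 'rV[R]_d) r : compact [set x | enorm (x - c) <= r].
Proof.
apply: bounded_closed_compact.
  apply: (@enorm_bounded _ (enorm c + r)) => x /= xr.
  by apply: (le_trans (ler_enorm_dist x c)); rewrite lerD2l.
rewrite (_ : mkset _ = (fun x => enorm (x - c)) @^-1` [set y | y <= r])//.
by apply: closed_comp; [move=> x _; exact: continuous_enormB|exact: closed_le].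
Qed.

Lemma compact_enorm_sphere (c : 'rV[R]_d) r : compact [set x | enorm (x - c) = r].
Proof.
apply: bounded_closed_compact.
  apply: (@enorm_bounded _ (enorm c + r)) => x /= xr.
  by apply: (le_trans (ler_enorm_dist x c)); rewrite xr.
rewrite (_ : mkset _ = (fun x => enorm (x - c)) @^-1` [set y | y = r])//.
by apply: closed_comp; [move=> x _; exact: continuous_enormB|exact: closed_eq].
Qed.

End enorm_topology.

(** * Existence, equivariance and continuity of the estimator *)

Section mle_theory.
Context {R : realType} {d : nat} (V : 'rV[R]_d -> R) (L M : R).
Hypotheses (L0 : 0 < L) (M0 : 0 < M).
Hypothesis V_sc : strictly_convex V.
Hypothesis V_C2 : twice_continuously_differentiable V.
Hypothesis V_M : (ereal_sup [set (opnorm (hessian V x))%:E | x in [set: 'rV[R]_d]]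
         <= M%:E)%E.
Hypothesis V_nrec : forall u,
  (forall x t, 0 <= t -> V (x + t *: u) <= V x) -> u = 0.

Local Notation DV := (gradient V).

Let grad_ineq := gradient_ineq M0 V_sc V_C2 V_M.
Let cV := continuous_V V_C2.

(** By compactness: if [V] stayed below [V 0 + 1] at points escaping to infinity, their directions
    would cluster at a unit vector, and convexity would make it a direction of recession, excluded
    by [V_nrec]. *)
Lemma V_coercive : exists2 r, 0 < r & forall x, r <= enorm x -> V 0 + 1 <= V x.
Proof.
apply: contrapT => /forall2NP nco.
have ex (N : nat) : exists x, N.+1%:R <= enorm x /\ V x < V 0 + 1.
  have [/negP|/existsNP[x /not_implyP[xN /negP]]] := nco N.+1%:R.
    by rewrite ltr0n.
  by rewrite -ltNge => Vx; exists x.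
have [x xP] := choice ex.
pose u N := (enorm (x N))^-1 *: x N.
have nx N : 0 < enorm (x N) by apply: lt_le_trans (xP N).1; rewrite ltr0n.
have nu N : enorm (u N) = 1.
  by rewrite enormZ ger0_norm ?invr_ge0// mulVf// gt_eqF.
have [v [/= v1 cl]] : [set x | enorm (x - 0) = 1] `&` cluster (u @ \oo) !=set0.
  apply: compact_enorm_sphere; exists 0%N => // N _ /=.
  by rewrite subr0; exact: nu.
have v0 : v = 0.
  apply: V_nrec => y t t0.
  apply/ler_addgt0Pl => e e0.
  (* [D] bounds the slope of [V] at [z], and [E] collects the two errors proportional to
     [s = t / enorm (x N)]. Closeness of [u N] to the cluster point and remoteness of [x N] then
     each cost at most [e / 2]. *)
  pose z := y + t *: v; pose D := enorm (DV z) + 1.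
  have D0 : 0 < D by rewrite ltr_wpDl.
  pose E := `|V 0 + 1 - V y| + D * enorm y + 1.
  have E0 : 0 < E by rewrite ltr_wpDl// addr_ge0 ?mulr_ge0// ltW.
  have t1 : 0 < t + 1 by rewrite ltr_wpDl.
  have eta0 : 0 < e / 2 / (t + 1) / D by rewrite !divr_gt0.
  have eta1 : 0 < e / 2 / (t + 1) / E by rewrite !divr_gt0.
  have [N0 _ hN0] : \forall N \near \oo, (enorm (x N))^-1 <= (e / 2 / (t + 1)) / E /\ t <= enorm (x N).
    near=> N; split.
      rewrite -[leRHS]invrK lef_pV2 ?posrE ?invr_gt0//.
      apply: le_trans (xP N).1; apply: (@le_trans _ _ N%:R); last by rewrite ler_nat.
      by near: N; exact: nbhs_infty_ger.
    apply: le_trans (xP N).1; apply: (@le_trans _ _ N%:R); last by rewrite ler_nat.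
    by near: N; exact: nbhs_infty_ger.
  have [w [[N /= N0N <-] /= wv]] := cl [set u N | N in [set N | (N0 <= N)%N]] _
     (ex_intro2 _ _ N0 I (fun N h => ex_intro2 _ _ N h erefl)) (near_enorm v eta0).
  have [hN tN] := hN0 _ N0N.
  set s := t / enorm (x N).
  have s0 : 0 <= s by rewrite divr_ge0.
  have s1 : s <= 1 by rewrite ler_pdivrMr// mul1r.
  have := V_convex V_sc y (x N) (t := s); rewrite s0 s1 => /(_ isT) hc.
  have yN : y + s *: (x N - y) = z + (t *: (u N - v) - s *: y).
    by rewrite /z /u /s; apply/rowP => i; rewrite !mxE; ring.
  have hg := grad_ineq z (t *: (u N - v) - s *: y).
  rewrite yN in hc.
  have hn : `|dot (t *: (u N - v) - s *: y) (DV z)| <= (t * enorm (v - u N) + s * enorm y) * D.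
    apply: (le_trans (normr_dot_le _ _)); apply: ler_pM => //; last by rewrite /D lerDl.
    apply: (le_trans (ler_enormB _ _)).
    by rewrite !enormZ !ger0_norm// (enormBC v).
  have tq : t * (e / 2 / (t + 1)) <= e / 2.
    by rewrite mulrA ler_pdivrMr// mulrC ler_wpM2l ?divr_ge0 ?(ltW e0)// lerDl.
  have hs : s * E <= e / 2.
    by rewrite /s -mulrA; apply: le_trans tq; rewrite ler_wpM2l// -ler_pdivlMr.
  have ht : t * enorm (v - u N) * D <= e / 2.
    by rewrite -mulrA; apply: le_trans tq; rewrite ler_wpM2l// -ler_pdivlMr// ltW.
  move: hn; rewrite ler_norml => /andP[hn _].
  have hV : s * (V 0 + 1 - V y) <= s * `|V 0 + 1 - V y| by rewrite ler_wpM2l// ler_norm.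
  have hx : s * (V (x N) - V y) <= s * (V 0 + 1 - V y).
    by rewrite ler_wpM2l// lerD2r ltW// (xP N).2.
  rewrite /E !mulrDr in hs; rewrite mulrDl -[X in _ + X]mulrA [enorm y * D]mulrC in hn.
  have aux (e' Vz g Vw Vy Vx c1 c2 c3 c4 : R) : c1 + c3 + c4 <= e' / 2 -> c2 <= e' / 2 ->
      Vz + g <= Vw -> Vw <= Vy + Vx -> Vx <= c1 -> - (c2 + c3) <= g -> 0 <= c4 -> Vz <= e' + Vy.
    by clear; move=> *; lra.
  by apply: aux hs ht hg hc (le_trans hx hV) hn _; rewrite mulr1.
by move/eqP: v1; rewrite subr0 v0 enorm0 eq_sym oner_eq0.
Unshelve. all: by end_near. Qed.

(** Outside the ball, convexity along the ray from 0 turns the gain of 1 at distance [r] into the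
    slope [1 / r]; inside, the gradient inequality at 0 fixes the constant [K]. *)
Lemma V_linear_growth : exists r K, 0 < r /\
  forall x, V 0 + enorm x / r - K <= V x.
Proof.
have [r r0 hr] := V_coercive; exists r, (1 + r * enorm (DV 0)); split => // x.
have rn0 : 0 <= r * enorm (DV 0) by rewrite mulr_ge0// ltW.
have [xr|rx] := ltP (enorm x) r.
  have := grad_ineq 0 x; rewrite add0r; apply: le_trans; rewrite -addrA lerD2l.
  have h1 : - (enorm x * enorm (DV 0)) <= dot x (DV 0).
    by have := normr_dot_le x (DV 0); rewrite ler_norml => /andP[].
  apply: le_trans h1.
  have h2 : enorm x / r <= 1 by rewrite ler_pdivrMr// mul1r ltW.
  have h3 : enorm x * enorm (DV 0) <= r * enorm (DV 0) by rewrite ler_wpM2r// ltW.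
  by move: (enorm x / r) (enorm x * enorm (DV 0)) (r * enorm (DV 0)) h2 h3 => *; lra.
have nx : 0 < enorm x by apply: lt_le_trans rx.
have s0 : 0 < r / enorm x by rewrite divr_gt0.
have s1 : r / enorm x <= 1 by rewrite ler_pdivrMr// mul1r.
have := V_convex V_sc 0 x (t := r / enorm x); rewrite (ltW s0) s1 => /(_ isT).
rewrite subr0 add0r => hc.
have := hr ((r / enorm x) *: x); rewrite enormZ gtr0_norm// divfK ?gt_eqF// => /(_ (lexx _)) h.
have h1 : 1 <= r / enorm x * (V x - V 0).
  by move: (le_trans h hc); rewrite lerD2l.
have h2 : enorm x / r <= V x - V 0.
  by rewrite -(ler_pM2l s0); apply: le_trans h1; rewrite mulrA divfK ?gt_eqF// divff// gt_eqF.
by move: (enorm x / r) (r * enorm (DV 0)) (V x) (V 0) h2 rn0 => *; lra.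
Qed.

Lemma continuous_Vshift (a : 'rV[R]_d) : continuous (fun t : 'rV[R]_d => V (a - t)).
Proof.
move=> t; have h : continuous (fun t : 'rV[R]_d => a - t).
  by move=> {}t; apply: differentiable_continuous; apply: differentiableB.
exact: (cvg_comp _ _ (h t) (@cV (a - t))).
Qed.

Section sample_loss.
Context {n : nat}.
Hypothesis n0 : (0 < n)%N.
Implicit Types x y : 'I_n -> 'rV[R]_d.

Definition loss x (theta : 'rV[R]_d) : R := n%:R^-1 * \sum_(j < n) V (x j - theta).

Let ni0 : 0 < (n%:R : R)^-1. Proof. by rewrite invr_gt0 ltr0n. Qed.

Lemma mean_cst (c : R) : n%:R^-1 * \sum_(j < n) c = c.
Proof. by rewrite sumr_const card_ord -[c *+ n]mulr_natl mulKf// pnatr_eq0 -lt0n. Qed.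

Lemma loss_grad_ineq x t h :
  loss x t - dot h (n%:R^-1 *: \sum_(j < n) DV (x j - t)) <= loss x (t + h).
Proof.
rewrite /loss dotZr dot_sumr -mulrBr ler_wpM2l ?(ltW ni0)//.
rewrite -sumrB; apply: ler_sum => j _.
have := grad_ineq (x j - t) (- h); rewrite dotNl.
by rewrite opprD addrA.
Qed.

Lemma continuous_loss x : continuous (loss x).
Proof.
have h (r : seq 'I_n) : continuous (fun t : 'rV[R]_d => \sum_(j <- r) V (x j - t) : R).
  elim: r => [|j r IH].
    rewrite (_ : (fun t => _) = cst 0); first exact: cst_continuous.
    by apply/funext => t; rewrite big_nil.
  rewrite (_ : (fun t => _) = (fun t : 'rV[R]_d => V (x j - t)) \+ (fun t => \sum_(j <- r) V (x j - t))); last first.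
    by apply/funext => t; rewrite big_cons.
  by move=> t; exact: (cvgD (@continuous_Vshift (x j) t) (@IH t)).
by move=> t; exact: (cvgMl_tmp (@h _ t)).
Qed.

Lemma loss_min_exists x : exists t, forall t', loss x t <= loss x t'.
Proof.
have [r [K [r0 hK]]] := V_linear_growth.
pose B := \sum_j enorm (x j).
have hB t : V 0 + (enorm t - B) / r - K <= loss x t.
  rewrite -[leLHS]mean_cst ler_wpM2l ?(ltW ni0)//; apply: ler_sum => j _.
  apply: le_trans (hK _); rewrite lerD2r lerD2l ler_pM2r ?invr_gt0//.
  have := ler_enorm_dist t (x j); rewrite enormBC => h1.
  have h2 : enorm (x j) <= B by rewrite /B (bigD1 j)//= lerDl sumr_ge0.
  by move: (enorm t) (enorm (x j)) (enorm (x j - t)) B h1 h2 => *; lra.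
(* Beyond this radius the linear lower bound [hB] is at least [loss x 0], so the minimum over the
   ball is global. *)
pose rho := `|loss x 0 - V 0 + K| * r + `|B|.
have A0 : [set y : 'rV[R]_d | enorm (y - 0) <= rho] !=set0.
  by exists 0; rewrite /= subr0 enorm0 addr_ge0// mulr_ge0// ltW.
have [t0 t0A t0min] := EVT_min_rV A0 (@compact_enorm_ball _ _ 0 rho)
  (continuous_subspaceT (@continuous_loss x)).
exists t0 => t'.
have [t'r|t'r] := leP (enorm t') rho.
  by apply: t0min; rewrite inE /= subr0.
have h0 : loss x t0 <= loss x 0.
  by apply: t0min; rewrite inE /= subr0 enorm0 addr_ge0// mulr_ge0// ltW.
apply: (le_trans h0); apply: le_trans (hB t').
have : loss x 0 - V 0 + K <= (enorm t' - B) / r.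
  rewrite ler_pdivlMr//; apply: (@le_trans _ _ (`|loss x 0 - V 0 + K| * r)).
    by rewrite ler_wpM2r ?(ltW r0)// ler_norm.
  have := ler_norm B; move: t'r; rewrite /rho; move: (_ * r) `|B| (enorm t') => q b e.
  by move=> *; lra.
by move: (loss x 0) (_ / r) (V 0) => *; lra.
Qed.

Lemma loss_min_unique x t t' :
  (forall u, loss x t <= loss x u) -> (forall u, loss x t' <= loss x u) -> t = t'.
Proof.
move=> ht ht'; apply/eqP; apply: contrapT => /negP tt'.
have : loss x (2^-1 *: t + (1 - 2^-1) *: t') < 2^-1 * loss x t + (1 - 2^-1) * loss x t'.
  have -> : 2^-1 * loss x t + (1 - 2^-1) * loss x t' =
      n%:R^-1 * \sum_(j < n) (2^-1 * V (x j - t) + (1 - 2^-1) * V (x j - t')).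
    by rewrite big_split -!mulr_sumr /loss /=; ring.
  rewrite /loss ltr_pM2l//; apply: ltr_sum; first by apply/hasP; exists (Ordinal n0); rewrite ?mem_index_enum.
  move=> j _.
  have -> : x j - (2^-1 *: t + (1 - 2^-1) *: t') = 2^-1 *: (x j - t) + (1 - 2^-1) *: (x j - t').
    by apply/rowP => i; rewrite !mxE; field.
  apply: V_sc; last by lra.
  by apply: contra tt' => /eqP/addrI/oppr_inj ->.
apply/negP; rewrite -leNgt.
have -> : 2^-1 * loss x t + (1 - 2^-1) * loss x t' = loss x t.
  have -> : loss x t' = loss x t by apply/eqP; rewrite eq_le ht ht'.
  by field.
exact: ht.
Qed.

Lemma mle_min x t : loss x (mle V x) <= loss x t.
Proof.
have [t0 h] := loss_min_exists x.
exact: (@xgetI _ 0 [set theta | forall theta', loss x theta <= loss x theta'] _ h).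
Qed.

Lemma mle_unique x t : (forall u, loss x t <= loss x u) -> mle V x = t.
Proof. by move=> ht; apply: (loss_min_unique _ ht) => u; exact: mle_min. Qed.

(** This equivariance is what makes the law of the estimation error the same for every parameter. *)
Lemma mle_shift x a : mle V (fun j => x j + a) = mle V x + a.
Proof.
apply: mle_unique => u.
have e t : loss (fun j => x j + a) t = loss x (t - a).
  by congr (_ * _); apply: eq_bigr => j _; rewrite opprB addrA.
by rewrite !e addrK; exact: mle_min.
Qed.

Lemma mle_score x : \sum_(j < n) DV (x j - mle V x) = 0.
Proof.
set t := mle V x; set g := \sum_j _; apply/eqP; rewrite -enorm_eq0 -sqrf_eq0.
rewrite eq_le sqr_ge0 andbT.
have K0 : 0 < n%:R * M + 1 :> R by rewrite ltr_wpDl// mulr_ge0// ltW.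
(* With this step [s * (n%:R * M) = 1 - s], so the quadratic term stays strictly below the
   first-order gain. *)
pose s := (n%:R * M + 1)^-1.
have s0 : 0 < s by rewrite invr_gt0.
(* Moving along the score would decrease the loss at first order. *)
have := mle_min x (t + s *: g); rewrite -/t /loss ler_pM2l// => h.
have : \sum_j V (x j - (t + s *: g)) <= \sum_j (V (x j - t) - s * dot g (DV (x j - t)) + M * (s ^+ 2 * enorm g ^+ 2)).
  apply: ler_sum => j _; have := V_upper M0 V_C2 V_M (x j - t) (- (s *: g)).
  rewrite opprD addrA enormN enormZ gtr0_norm// exprMn dotNl dotZl => h1.
  by apply: (le_trans h1).
move=> /(le_trans h); rewrite big_split sumrB /= -mulr_sumr -dot_sumr -/g -sqr_enorm.
rewrite sumr_const card_ord -[_ *+ n]mulr_natl -addrA -[leLHS]addr0 lerD2l.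
have -> : n%:R * (M * (s ^+ 2 * enorm g ^+ 2)) = s * (s * (n%:R * M) * enorm g ^+ 2) by ring.
rewrite -mulrN -mulrDr pmulr_rge0// => h2.
have hs : s * (n%:R * M) = 1 - s.
  by rewrite /s; field; rewrite gt_eqF.
rewrite hs in h2.
have : 0 <= - s * enorm g ^+ 2.
  by apply: (le_trans h2); rewrite mulrBl mul1r mulNr addrA addNr add0r.
by rewrite mulNr oppr_ge0 pmulr_rle0.
Qed.

(** On the sphere of radius [e] around the estimator of [x] the loss exceeds its minimum by a fixed
    gap. Losses of nearby samples differ little on the ball, and by convexity a minimiser outside it
    would force a low value on the sphere. *)
Lemma mle_continuous x e : 0 < e -> exists2 t, 0 < t &
  forall y, (forall j, enorm (y j - x j) <= t) -> enorm (mle V y - mle V x) <= e.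
Proof.
move=> e0; set c := mle V x.
pose S := [set t : 'rV[R]_d | enorm (t - c) = e].
(* The sphere is empty when [d = 0]; rescaling would bring any estimator outside the ball onto
   it. *)
have [[u uS]|Sempty] := pselect (S !=set0); last first.
  exists 1 => // y _; rewrite leNgt; apply/negP => hlt; apply: Sempty.
  have h0 : 0 < enorm (mle V y - c) by apply: lt_trans hlt.
  exists (c + (e / enorm (mle V y - c)) *: (mle V y - c)).
  by rewrite /S /= [c + _]addrC addrK enormZ gtr0_norm ?divr_gt0// divfK// gt_eqF.
have [t1 t1S t1min] := EVT_min_rV (ex_intro _ u uS : S !=set0) (@compact_enorm_sphere _ _ c e) (continuous_subspaceT (@continuous_loss x)).
have eta0 : 0 < loss x t1 - loss x c.
  rewrite subr_gt0 lt_neqAle mle_min andbT; apply/eqP => eq1.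
  have : mle V x = t1 by apply: mle_unique => v; rewrite -eq1; exact: mle_min.
  move=> h; rewrite inE /S /= -h subrr enorm0 in t1S.
  by rewrite t1S ltxx in e0.
set eta := loss x t1 - loss x c in eta0.
pose K := \sum_j enorm (DV (x j - c)) + M * e + M.
have K0 : 0 < K by rewrite ltr_wpDl// addr_ge0 ?sumr_ge0// mulr_ge0// ltW.
have lossd (y : 'I_n -> 'rV[R]_d) t tau : 0 <= tau <= 1 -> (forall j, enorm (y j - x j) <= tau) ->
    enorm (t - c) <= e -> `|loss y t - loss x t| <= K * tau.
  move=> /andP[tau0 tau1] hy ht.
  rewrite /loss -mulrBr -sumrB normrM gtr0_norm// -[leRHS]mean_cst ler_wpM2l ?(ltW ni0)//.
  apply: (le_trans (ler_norm_sum _ _ _)); apply: ler_sum => j _.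
  have hD : enorm (DV (x j - t)) <= \sum_j enorm (DV (x j - c)) + M * e.
    have -> : x j - t = (x j - c) + (c - t) by rewrite addrA subrK.
    apply: (le_trans (ler_enorm_dist _ (DV (x j - c)))); apply: lerD.
      by rewrite (bigD1 j)//= lerDl sumr_ge0.
    apply: (le_trans (gradient_lip M0 V_C2 V_M _ _)).
    by rewrite ler_wpM2l ?(ltW M0)// enormBC.
  have e1 : y j - t = (x j - t) + (y j - x j) by rewrite [RHS]addrC addrA subrK.
  have lo := grad_ineq (x j - t) (y j - x j).
  have up := V_upper M0 V_C2 V_M (x j - t) (y j - x j).
  rewrite -e1 in lo up.
  have hd : `|dot (y j - x j) (DV (x j - t))| <= (\sum_j enorm (DV (x j - c)) + M * e) * tau.
    by apply: (le_trans (normr_dot_le _ _)); rewrite mulrC; apply: ler_pM.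
  have hm : M * enorm (y j - x j) ^+ 2 <= M * tau.
    rewrite ler_wpM2l ?(ltW M0)//; apply: (@le_trans _ _ (tau ^+ 2)).
      by rewrite lerXn2r// nnegrE.
    by rewrite expr2 ler_piMl.
  move: hd; rewrite !ler_norml => /andP[hd1 hd2].
  have hKt : K * tau = (\sum_j enorm (DV (x j - c)) + M * e) * tau + M * tau by rewrite -mulrDl.
  rewrite hKt.
  have Mt0 : 0 <= M * tau by rewrite mulr_ge0// ltW.
  have aux (a b g q r' w : R) : a + g <= b -> b <= a + g + r' -> r' <= q -> - w <= g -> g <= w -> 0 <= q ->
      - (w + q) <= b - a <= w + q.
    by move=> *; apply/andP; split; lra.
  exact: aux lo up hm hd1 hd2 Mt0.
(* The comparison of the losses is used at two points, each costing at most [eta / 3], which leaves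
   part of the gap [eta]. *)
pose tau := Num.min 1 (eta / 3 / K).
have tau0 : 0 < tau by rewrite lt_min ltr01 !divr_gt0.
have tau1 : tau <= 1 by rewrite ge_min lexx.
have Ktau : K * tau <= eta / 3 by rewrite mulrC -ler_pdivlMr// ge_min lexx orbT.
exists tau => // y hy; rewrite leNgt; apply/negP => hlt.
set t2 := mle V y in hlt.
have h0 : 0 < enorm (t2 - c) by apply: lt_trans hlt.
pose s := e / enorm (t2 - c).
have s0 : 0 < s by rewrite divr_gt0.
have s1 : s <= 1 by rewrite ler_pdivrMr// mul1r ltW.
pose p := c + s *: (t2 - c).
have pS : enorm (p - c) = e.
  by rewrite /p [c + _]addrC addrK enormZ gtr0_norm// divfK// gt_eqF.
have h01 : 0 <= tau <= 1 by rewrite (ltW tau0) tau1.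
have hp := lossd y p tau h01 hy; rewrite pS lexx in hp; have {}hp := hp isT.
have hc := lossd y c tau h01 hy; rewrite subrr enorm0 (ltW e0) in hc; have {}hc := hc isT.
have hpx : loss x t1 <= loss x p by apply: t1min; rewrite inE.
have hconv : loss y p <= loss y c.
  have h2 := mle_min y c; rewrite -/t2 in h2.
  have : loss y p <= loss y c + s * (loss y t2 - loss y c).
    rewrite /loss -mulrBr mulrCA -mulrDr ler_wpM2l ?(ltW ni0)// -sumrB mulr_sumr -big_split /=.
    apply: ler_sum => j _.
    have := V_convex V_sc (y j - c) (y j - t2) (t := s); rewrite (ltW s0) s1 => /(_ isT).
    have -> : y j - c + s *: (y j - t2 - (y j - c)) = y j - p.
      by rewrite /p; apply/rowP => i; rewrite !mxE; ring.
    by [].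
  move/le_trans; apply; rewrite -[leRHS]addr0 lerD2l pmulr_rle0// subr_le0//.
move: hp hc; rewrite !ler_norml => /andP[hp _] /andP[_ hc].
have aux (a b c1 d1 f k q : R) : - k <= a - b -> c1 - d1 <= k -> f <= b -> a <= c1 -> k <= q / 3 -> f - d1 = q -> 0 < q -> False.
  by clear; move=> *; lra.
exact: aux hp hc hpx hconv Ktau erefl eta0.
Qed.

End sample_loss.

(** The score equation for the one-point sample at 0. Such a point is the neutral value put in place
    of an observation in the leave-one-out argument, since it contributes no score. *)
Lemma V_critical_point : exists z, DV z = 0.
Proof.
exists (0 - mle V (fun _ : 'I_1 => 0)).
by rewrite -[RHS](@mle_score 1 isT (fun _ => 0)) big_ord1.
Qed.

End mle_theory.

(** * Measurability of continuous functionals of a sample *)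

Section measurability.
Context {R : realType}.

Lemma floor_approx (a : R) (k : nat) :
  `|(Num.floor (a * k.+1%:R))%:~R / k.+1%:R - a| <= k.+1%:R^-1.
Proof.
have k0 : 0 < k.+1%:R :> R by rewrite ltr0n.
set b := a * k.+1%:R.
have -> : (Num.floor b)%:~R / k.+1%:R - a = ((Num.floor b)%:~R - b) / k.+1%:R.
  by rewrite mulrBl /b mulfK ?gt_eqF.
rewrite normrM normfV (gtr0_norm k0) -[leRHS]mul1r ler_wpM2r ?invr_ge0 ?(ltW k0)//.
have h1 := floor_le_tmp b; have h2 := floorD1_gt b.
rewrite intrD in h2.
by rewrite ler_norml; apply/andP; split; lra.
Qed.

(* Round every coordinate down to a grid: the rounded sample takes countably
   many values, and continuity recovers h as the limit over finer grids. *)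
Lemma measurable_continuous_sample dO (O : measurableType dO) n d
    (X : 'I_n -> O -> 'rV[R]_d) (h : ('I_n -> 'rV[R]_d) -> R) :
  (forall j, measurable_fun [set: O] (X j)) ->
  (forall x e, 0 < e -> exists2 t, 0 < t &
     forall y, (forall j, enorm (y j - x j) <= t) -> `|h y - h x| <= e) ->
  measurable_fun [set: O] (fun w => h (fun j => X j w)).
Proof.
move=> mX ch; apply/measurable_EFinP.
pose H (k : nat) (c : {ffun 'I_n * 'I_d -> int}) :=
  h (fun j => \row_i ((c (j, i))%:~R / k.+1%:R)).
pose F (k : nat) w : {ffun 'I_n * 'I_d -> int} :=
  [ffun p => Num.floor (X p.1 w ord0 p.2 * k.+1%:R)].
apply: (emeasurable_fun_cvg (fun k w => (H k (F k w))%:E)) => [k|w _]; last first.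
  apply: cvg_EFin; first by apply: nearW.
  apply/(@cvgrPdist_le _ _ _ \oo) => e /(ch (fun j => X j w))[t t0 ht].
  near=> k; rewrite /= distrC; apply: ht => j.
  apply: (le_trans (enorm_le_sum _)).
  apply: (@le_trans _ _ (\sum_(i < d) k.+1%:R^-1)).
    by apply: ler_sum => i _; rewrite !mxE ffunE; exact: floor_approx.
  rewrite sumr_const card_ord -[_ *+ d]mulr_natl ler_pdivrMr ?ltr0n// mulrC -ler_pdivrMr//.
  apply: (@le_trans _ _ k%:R); last by rewrite ler_nat.
  by near: k; exact: nbhs_infty_ger.
apply/measurable_EFinP => _ B mB; rewrite setTI.
have -> : (fun w => H k (F k w)) @^-1` B =
    \bigcup_c (if `[< B (H k c) >] then F k @^-1` [set c] else set0).
  apply/seteqP; split => [w /= Bw|w [c _]].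
    by exists (F k w) => //=; rewrite asboolT.
  by case: asboolP => //= Bc Fc; rewrite Fc.
apply: countable_bigcupT_measurable => [|c]; first exact: countableP.
case: asboolP => // _.
have -> : F k @^-1` [set c] = \bigcap_(p in [set: 'I_n * 'I_d])
    ((fun w => X p.1 w ord0 p.2) @^-1` [set a | Num.floor (a * k.+1%:R) = c p]).
  apply/seteqP; split => w /=.
    by move=> <- p _ /=; rewrite ffunE.
  by move=> hw; apply/ffunP => p; rewrite ffunE; exact: hw.
apply: fin_bigcap_measurable => // p _.
have mc : measurable_fun [set: O] (fun w => X p.1 w ord0 p.2).
  by apply: (measurableT_comp (measurable_row_coord p.2)); exact: mX.
rewrite -[X in measurable X]setTI; apply: mc => //.
have k0 : 0 < k.+1%:R :> R by rewrite ltr0n.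
rewrite (_ : mkset _ = `[(c p)%:~R / k.+1%:R, (c p + 1)%:~R / k.+1%:R[%classic)//.
apply/seteqP; split => a /=; rewrite in_itv /= ler_pdivrMr// ltr_pdivlMr//.
  by move=> <-; rewrite floor_le_tmp floorD1_gt.
by move=> h'; apply/floor_def.
Unshelve. all: by end_near. Qed.

Lemma measurable_enorm_continuous d (h : 'rV[R]_d -> R) :
  continuous h -> measurable_fun [set: 'rV[R]_d] h.
Proof.
move=> ch.
pose X (_ : 'I_1) : 'rV[R]_d -> 'rV[R]_d := id.
have mX j : measurable_fun [set: 'rV[R]_d] (X j) by exact: measurable_id.
apply: (@measurable_continuous_sample _ _ 1 d X (fun x => h (x ord0)) mX) => x e e0.
have /(@cvgrPdist_le _ _ _ (nbhs (x ord0)))/(_ _ e0) := ch (x ord0).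
move=> /nbhs_ballP[r /= r0 hr]; exists (r / 2); first by rewrite divr_gt0.
move=> y hy; rewrite distrC; apply: hr.
rewrite -ball_normE /= distrC; apply: le_lt_trans (normr_enorm _) _.
by apply: le_lt_trans (hy ord0) _; rewrite ltr_pdivrMr// ltr_pMr// ltr1n.
Qed.

Lemma measurable_row_continuous d e (h : 'rV[R]_d -> 'rV[R]_e) :
  continuous h -> measurable_fun [set: 'rV[R]_d] h.
Proof.
move=> ch; apply: measurable_fun_row => i; apply: measurable_enorm_continuous => x.
by apply: (@continuous_comp _ _ _ h (row_coord i)); [exact: ch|exact: coord_continuous].
Qed.

Lemma measurable_fun_coord dO (O : measurableType dO) d (X : O -> 'rV[R]_d) i :
  measurable_fun [set: O] X -> measurable_fun [set: O] (fun w => X w ord0 i).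
Proof. by move=> mX; exact: (measurableT_comp (measurable_row_coord i) mX). Qed.

Lemma measurable_fun_dot dO (O : measurableType dO) d (X Y : O -> 'rV[R]_d) :
  measurable_fun [set: O] X -> measurable_fun [set: O] Y ->
  measurable_fun [set: O] (fun w => dot (X w) (Y w)).
Proof.
move=> mX mY; under eq_fun do rewrite dotE.
apply: (@measurable_sum _ _ _ _ _ _ (fun i w => X w ord0 i * Y w ord0 i)) => i.
by apply: measurable_funM; exact: measurable_fun_coord.
Qed.

Lemma measurable_fun_enorm dO (O : measurableType dO) d (X : O -> 'rV[R]_d) :
  measurable_fun [set: O] X -> measurable_fun [set: O] (fun w => enorm (X w)).
Proof.
move=> mX; apply: (measurableT_comp (measurable_enorm_continuous _) mX).
by move=> x; have := @continuous_enormB _ _ 0 x; under eq_fun do rewrite subr0.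
Qed.

Lemma measurable_fun_rowD dO (O : measurableType dO) d (X Y : O -> 'rV[R]_d) :
  measurable_fun [set: O] X -> measurable_fun [set: O] Y ->
  measurable_fun [set: O] (fun w => X w + Y w).
Proof.
move=> mX mY; apply: measurable_fun_row => i.
rewrite (_ : _ \o _ = fun w => X w ord0 i + Y w ord0 i).
  by apply: measurable_funD; exact: measurable_fun_coord.
by apply/funext => w; rewrite /= /row_coord mxE.
Qed.

Lemma measurable_fun_row_sum dO (O : measurableType dO) d I (r : seq I)
    (X : I -> O -> 'rV[R]_d) :
  (forall i, measurable_fun [set: O] (X i)) ->
  measurable_fun [set: O] (fun w => \sum_(i <- r) X i w).
Proof.
move=> mX; elim: r => [|i r IH].
  rewrite (_ : (fun w => _) = cst 0); first exact: measurable_cst.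
  by apply/funext => w; rewrite big_nil.
rewrite (_ : (fun w => _) = fun w => X i w + \sum_(i <- r) X i w).
  exact: measurable_fun_rowD.
by apply/funext => w; rewrite big_cons.
Qed.

Lemma measurable_fun_rowZ dO (O : measurableType dO) d (X : O -> 'rV[R]_d) a :
  measurable_fun [set: O] X -> measurable_fun [set: O] (fun w => a *: X w).
Proof.
move=> mX; apply: measurable_fun_row => i.
rewrite (_ : _ \o _ = fun w => a * X w ord0 i).
  by apply: measurable_funM => //; exact: measurable_fun_coord.
by apply/funext => w; rewrite /= /row_coord mxE.
Qed.

End measurability.

(** * Translation invariance of Lebesgue measure on rows *)

Section lebesgue_shift.
Context {R : realType}.

Lemma lebesgue_measure_shift (u : R) (A : set R) : measurable A ->
  @lebesgue_measure R ((fun a => a + u) @^-1` A) = lebesgue_measure A.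
Proof.
have mu : measurable_fun [set: measurableTypeR R] (fun a : measurableTypeR R => (a + u : measurableTypeR R)).
  exact: measurable_funD.
pose nu : {measure set (measurableTypeR R) -> \bar R} :=
  measure_function_pushforward__canonical__measure_function_Measure
    (@lebesgue_measure R) mu.
move=> mA; apply/esym; apply: (@lebesgue_measure_unique R nu) => // X [[a b] _ <-].
rewrite /nu /= /pushforward.
rewrite (_ : _ @^-1` _ = `]a - u, b - u]%classic).
  by rewrite !lebesgue_measure_itv /= !lte_fin ltrD2r; case: ifP => // _; rewrite -!EFinB opprB addrA subrK.
by apply/seteqP; split => x /=; rewrite !in_itv /= ltrBlDr lerBrDr.
Qed.

Definition row_box d (A : 'I_d -> set R) : set 'rV[R]_d :=
  [set x | forall i, A i (x ord0 i)].

Definition row_cube d (k : nat) : set 'rV[R]_d :=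
  row_box (fun _ => `](- k%:R), k%:R]%classic).

Lemma measurable_row_box d (A : 'I_d -> set R) :
  (forall i, measurable (A i)) -> measurable (row_box A).
Proof.
move=> mA; rewrite (_ : row_box A = \bigcap_(i in [set: 'I_d]) (row_coord i @^-1` A i)).
  apply: fin_bigcap_measurable => // i _.
  by rewrite -[X in measurable X]setTI; exact: measurable_row_coord.
by apply/seteqP; split => x h; [move=> i _; exact: h|move=> i; exact: h].
Qed.

(** Boxes form a generating pi-system, and the cubes, of finite mass, exhaust the space. *)
Lemma row_measure_unique d (m1 m2 : {measure set 'rV[R]_d -> \bar R}) :
  (forall A, (forall i, measurable (A i)) -> m1 (row_box A) = m2 (row_box A)) ->
  (forall k : nat, (m1 (@row_cube d k) < +oo)%E) ->
  forall A, measurable A -> m1 A = m2 A.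
Proof.
move=> h fin A mA.
pose G : set (set 'rV[R]_d) :=
  [set B | exists A : 'I_d -> set R, (forall i, measurable (A i)) /\ B = row_box A].
apply: (measure_unique G (fun k => @row_cube d k)) => //.
- rewrite [LHS](_ : _ = <<s \big[setU/set0]_(i < d) preimage_set_system setT (row_coord i) measurable >>)//.
  apply/seteqP; split; apply: smallest_sub; try exact: smallest_sigma_algebra.
    rewrite -bigcup_seq; apply: bigcup_sub => i _ _ [B mB <-].
    apply: sub_sigma_algebra; exists (fun j => if j == i then B else setT); split.
      by move=> j; case: ifP.
    apply/seteqP; split => x /=.
      by move=> [_ Bx] j; case: eqP => [->|].
    by move=> /(_ i); rewrite eqxx.
  by move=> _ [C [mC ->]]; exact: measurable_row_box.
- move=> _ _ [A1 [m1' ->]] [A2 [m2' ->]]; exists (fun i => A1 i `&` A2 i); split.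
    by move=> i; exact: measurableI.
  by apply/seteqP; split => x /= => [[h1 h2] i|h12]; [split|split => i; have [] := h12 i].
- by move=> k; exists (fun _ => `](- k%:R), k%:R]%classic); split.
- apply/seteqP; split => // x _.
  have [k hk] : exists k : nat, `|x| < k%:R.
    by exists (Num.bound `|x|); exact/archi_boundP/normr_ge0.
  exists k => // i; rewrite /= in_itv /=.
  have := le_lt_trans (coord_normr x i) hk; rewrite ltr_norml => /andP[-> /ltW ->] //.
- by move=> _ [C [mC ->]]; exact: h.
Qed.

Lemma measurable_row_shift d (u : 'rV[R]_d) : measurable_fun [set: 'rV[R]_d] (fun x => x + u).
Proof. by apply: measurable_fun_rowD => //; exact: measurable_cst. Qed.

Lemma lebesgue_row_shift d (u : 'rV[R]_d) A : measurable A ->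
  lebesgue_row R d ((fun x => x + u) @^-1` A) = lebesgue_row R d A.
Proof.
pose nu : {measure set 'rV[R]_d -> \bar R} :=
  measure_function_pushforward__canonical__measure_function_Measure
    (lebesgue_row R d) (measurable_row_shift u).
move=> mA; apply/esym; apply: (@row_measure_unique d (lebesgue_row R d) nu) => //.
  move=> B mB; rewrite /nu /= /pushforward lebesgue_row_box//.
  rewrite (_ : _ @^-1` _ = row_box (fun i => (fun a => a + u ord0 i) @^-1` B i)); last first.
    by apply/seteqP; split => x /= hx i; have := hx i; rewrite mxE.
  rewrite lebesgue_row_box; last first.
    move=> i; rewrite -[X in measurable X]setTI; have : measurable_fun [set: R] (fun a => a + u ord0 i) by exact: measurable_funD.
    exact.
  by apply: eq_bigr => i _; rewrite lebesgue_measure_shift.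
move=> k; rewrite [X in (X < _)%E](_ : _ = lebesgue_row R d (row_box (fun _ => `](- k%:R : R)%R, k%:R]%classic)))// lebesgue_row_box//.
suff /andP[_ ->] : (0 <= \prod_(i < d) @lebesgue_measure R (`](- k%:R)%R, k%:R%R]%classic : set R) < +oo)%E by [].
elim/big_ind : _ => [|a b /andP[a0 ha] /andP[b0 hb]|i _].
- by rewrite lee01 ltry.
- by rewrite mule_ge0// lte_mul_pinfty// ge0_fin_numE.
- by rewrite measure_ge0 lebesgue_measure_itv /=; case: ifP => _; rewrite ?ltry.
Qed.

End lebesgue_shift.

(** * Integration against a density *)

Section densities.
Context {R : realType} {d : nat}.
Implicit Types (P : probability 'rV[R]_d R) (p : 'rV[R]_d -> R).

(** [has_density] speaks of sets only. It makes [P] absolutely continuous; the Radon-Nikodym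
    derivative then agrees with [p] almost everywhere, and the change of variables extends the
    identity to functions. *)
Lemma ge0_integral_density P p (g : 'rV[R]_d -> \bar R) :
  has_density P p -> measurable_fun [set: 'rV[R]_d] p -> (forall x, 0 <= p x) ->
  measurable_fun [set: 'rV[R]_d] g -> (forall x, (0 <= g x)%E) ->
  (\int[P]_x g x = \int[lebesgue_row R d]_x (g x * (p x)%:E))%E.
Proof.
move=> dP mp p0 mg g0.
have mpE : measurable_fun [set: 'rV[R]_d] (EFin \o p) by exact/measurable_EFinP.
have dom : P `<< lebesgue_row R d.
  apply/null_content_dominatesP => A mA A0.
  by rewrite dP//; apply: null_set_integral => //; exact: measurable_funTS.
have ip : (lebesgue_row R d).-integrable setT (EFin \o p).
  apply/integrableP; split => //.
  under eq_integral do rewrite gee0_abs ?lee_fin//.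
  by have := dP setT measurableT; rewrite probability_setT => <-; rewrite ltry.
rewrite -(Radon_Nikodym_SigmaFinite.change_of_variables dom)//.
apply: ae_eq_integral => //.
- apply: emeasurable_funM => //.
  exact: measurable_int (Radon_Nikodym_SigmaFinite.f_integrable dom).
- exact: emeasurable_funM.
apply: ae_eqe_mul2l; apply/ae_eq_sym; apply: integral_ae_eq => //.
- exact: measurable_int (Radon_Nikodym_SigmaFinite.f_integrable dom).
- by move=> E _ mE; rewrite -Radon_Nikodym_SigmaFinite.f_integral// -dP.
Qed.

Lemma integral_row_shift (u : 'rV[R]_d) (g : 'rV[R]_d -> \bar R) :
  measurable_fun [set: 'rV[R]_d] g -> (forall x, (0 <= g x)%E) ->
  (\int[lebesgue_row R d]_x g (x + u)%R = \int[lebesgue_row R d]_x g x)%E.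
Proof.
move=> mg g0.
have := @ge0_integral_pushforward _ _ _ _ R _ (measurable_row_shift u) (lebesgue_row R d) setT g
  measurableT mg (fun x _ => g0 x).
rewrite preimage_setT => <-.
pose nu : {measure set 'rV[R]_d -> \bar R} :=
  measure_function_pushforward__canonical__measure_function_Measure
    (lebesgue_row R d) (measurable_row_shift u).
have h A : measurable A -> A `<=` setT -> nu A = lebesgue_row R d A.
  by move=> mA _; exact: lebesgue_row_shift.
exact: (eq_measure_integral (lebesgue_row R d) h).
Qed.

End densities.

(** * Expectations of bounded measurable functions *)

Section expectation.
Context {R : realType} {d} {S : measurableType d} (P : probability S R).
Implicit Types g h : S -> R.

Definition bounded_measurable g :=
  measurable_fun [set: S] g /\ exists K, forall x, `|g x| <= K.

Lemma bounded_measurable_integrable g :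
  bounded_measurable g -> P.-integrable setT (EFin \o g).
Proof.
move=> [mg [K gK]]; apply: measurable_bounded_integrable => //.
  by rewrite [X in (X < _)%E]probability_setT ltry.
exists K; split; first exact: num_real.
by move=> K' /ltW KK' x _; exact: le_trans (gK x) KK'.
Qed.

Lemma EFin_Rintegral g : P.-integrable setT (EFin \o g) ->
  (\int[P]_x (g x))%:E = (\int[P]_x (g x)%:E)%E.
Proof. by move=> ig; rewrite /Rintegral fineK//; exact: integrable_fin_num. Qed.

Lemma Rintegral_cst1 (c : R) : \int[P]_x c = c.
Proof. by rewrite Rintegral_cst// [X in fine X]probability_setT mulr1. Qed.

Lemma ge0_integrable g (K : R) : measurable_fun [set: S] g -> (forall x, 0 <= g x) ->
  (\int[P]_x (g x)%:E <= K%:E)%E -> P.-integrable setT (EFin \o g).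
Proof.
move=> mg g0 gK; apply/integrableP; split; first exact/measurable_EFinP.
under eq_integral do rewrite gee0_abs ?lee_fin//.
by apply: le_lt_trans gK _; rewrite ltry.
Qed.

Lemma bounded_measurableD g h :
  bounded_measurable g -> bounded_measurable h -> bounded_measurable (fun x => g x + h x).
Proof.
move=> [mg [K gK]] [mh [K' hK]]; split; first exact: measurable_funD.
exists (K + K') => x; apply: (le_trans (ler_normD _ _)); exact: lerD.
Qed.

Lemma bounded_measurableB g h :
  bounded_measurable g -> bounded_measurable h -> bounded_measurable (fun x => g x - h x).
Proof.
move=> [mg [K gK]] [mh [K' hK]]; split; first exact: measurable_funB.
exists (K + K') => x; apply: (le_trans (ler_normB _ _)); exact: lerD.
Qed.

Lemma bounded_measurableM g h :
  bounded_measurable g -> bounded_measurable h -> bounded_measurable (fun x => g x * h x).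
Proof.
move=> [mg [K gK]] [mh [K' hK]]; split; first exact: measurable_funM.
exists (K * K') => x; rewrite normrM; exact: ler_pM.
Qed.

Lemma bounded_measurable_cst (c : R) : bounded_measurable (fun _ => c).
Proof. by split; [exact: measurable_cst|exists `|c|]. Qed.

Lemma bounded_measurable_sqr g :
  bounded_measurable g -> bounded_measurable (fun x => g x ^+ 2).
Proof. by move=> bg; exact: bounded_measurableM. Qed.

Lemma Rintegral_sqr_le g : bounded_measurable g ->
  (\int[P]_x g x) ^+ 2 <= \int[P]_x (g x ^+ 2).
Proof.
move=> bg; set c := \int[P]_x g x.
have : 0 <= \int[P]_x ((g x - c) ^+ 2) by apply: Rintegral_ge0 => x _; exact: sqr_ge0.
have -> : \int[P]_x ((g x - c) ^+ 2) = \int[P]_x (g x ^+ 2 - (2 * c) * g x + c ^+ 2).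
  by apply: eq_Rintegral => x _; ring.
rewrite RintegralD//; last 2 first.
- apply: bounded_measurable_integrable; apply: bounded_measurableB.
    exact: bounded_measurable_sqr.
  by apply: bounded_measurableM => //; exact: bounded_measurable_cst.
- exact/bounded_measurable_integrable/bounded_measurable_cst.
rewrite RintegralB//; last 2 first.
- exact/bounded_measurable_integrable/bounded_measurable_sqr.
- apply: bounded_measurable_integrable.
  by apply: bounded_measurableM => //; exact: bounded_measurable_cst.
rewrite RintegralZl//; last exact: bounded_measurable_integrable.
rewrite Rintegral_cst1 -/c; lra.
Qed.

End expectation.

(** * Resampling of one coordinate and the Efron-Stein inequality *)

Section sampling.
Context {R : realType} {dT} {T : measurableType dT} {n : nat}.
Variables (P : probability T R) (Q : probability (n.-tuple T) R).

Definition tuple_box (A : 'I_n -> set T) : set (n.-tuple T) :=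
  [set x | forall i, A i (tnth x i)].

Definition iid_law : Prop := forall A : 'I_n -> set T,
  (forall i, measurable (A i)) -> Q (tuple_box A) = (\prod_(i < n) P (A i))%E.

Definition upd (i : 'I_n) (y : T) (x : n.-tuple T) : n.-tuple T :=
  [tuple if j == i then y else tnth x j | j < n].

Lemma tnth_upd i y x j : tnth (upd i y x) j = if j == i then y else tnth x j.
Proof. by rewrite tnth_mktuple. Qed.

Lemma upd_upd i y z x : upd i y (upd i z x) = upd i y x.
Proof. by apply: eq_from_tnth => j; rewrite !tnth_upd; case: eqP. Qed.

Lemma updC i j y z x : i != j -> upd i y (upd j z x) = upd j z (upd i y x).
Proof.
move=> ij; apply: eq_from_tnth => k; rewrite !tnth_upd.
by case: (eqVneq k i) => [->|//]; rewrite (negPf ij).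
Qed.

Lemma measurable_tuple_box A : (forall i, measurable (A i)) -> measurable (tuple_box A).
Proof.
move=> mA; rewrite (_ : tuple_box A = \bigcap_(i in [set: 'I_n]) ((@tnth _ _ ^~ i) @^-1` A i)).
  apply: fin_bigcap_measurable => // i _.
  by rewrite -[X in measurable X]setTI; exact: measurable_tnth.
by apply/seteqP; split => x h; [move=> i _; exact: h|move=> i; exact: h].
Qed.

Lemma tuple_measure_unique (m1 m2 : {measure set (n.-tuple T) -> \bar R}) :
  (forall A, (forall i, measurable (A i)) -> m1 (tuple_box A) = m2 (tuple_box A)) ->
  (m1 setT < +oo)%E -> forall A, measurable A -> m1 A = m2 A.
Proof.
move=> h fin A mA.
pose G : set (set (n.-tuple T)) :=
  [set B | exists A : 'I_n -> set T, (forall i, measurable (A i)) /\ B = tuple_box A].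
apply: (measure_unique G (fun k => setT)) => //.
- rewrite [LHS](_ : _ = <<s \big[setU/set0]_(i < n) preimage_set_system setT (@tnth _ _ ^~ i) measurable >>)//.
  apply/seteqP; split; apply: smallest_sub; try exact: smallest_sigma_algebra.
    rewrite -bigcup_seq; apply: bigcup_sub => i _ _ [B mB <-].
    apply: sub_sigma_algebra; exists (fun j => if j == i then B else setT); split.
      by move=> j; case: ifP.
    apply/seteqP; split => x /=.
      by move=> [_ Bx] j; case: eqP => [->|].
    by move=> /(_ i); rewrite eqxx.
  by move=> _ [C [mC ->]]; exact: measurable_tuple_box.
- move=> _ _ [A1 [m1' ->]] [A2 [m2' ->]]; exists (fun i => A1 i `&` A2 i); split.
    by move=> i; exact: measurableI.
  by apply/seteqP; split => x /= => [[h1 h2] i|h12]; [split|split => i; have [] := h12 i].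
- by move=> k; exists (fun _ => setT); split => //; apply/seteqP; split.
- by rewrite bigcup_const.
- by move=> _ [C [mC ->]]; exact: h.
Qed.

Lemma measurable_upd2 i :
  measurable_fun [set: n.-tuple T * T] (fun p => upd i p.2 p.1).
Proof.
apply/measurable_fun_tnthP => j; rewrite (_ : _ \o _ =
  fun p : n.-tuple T * T => if j == i then p.2 else tnth p.1 j); last first.
  by apply/funext => p /=; rewrite tnth_upd.
case: (j == i); first exact: measurable_snd.
exact: (measurableT_comp (measurable_tnth j) measurable_fst).
Qed.

Lemma measurable_upd i x : measurable_fun [set: T] (fun y => upd i y x).
Proof.
apply/measurable_fun_tnthP => j; rewrite (_ : _ \o _ =
  fun y : T => if j == i then y else tnth x j); last first.
  by apply/funext => p /=; rewrite tnth_upd.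
by case: (j == i); [exact: measurable_id|exact: measurable_cst].
Qed.

Lemma measurable_updr i y : measurable_fun [set: n.-tuple T] (upd i y).
Proof.
apply/measurable_fun_tnthP => j; rewrite (_ : _ \o _ =
  fun x : n.-tuple T => if j == i then y else tnth x j); last first.
  by apply/funext => p /=; rewrite tnth_upd.
by case: (j == i); [exact: measurable_cst|exact: measurable_tnth].
Qed.

Hypothesis QP : iid_law.

Let upd_law i : {measure set (n.-tuple T) -> \bar R} :=
  measure_function_pushforward__canonical__measure_function_Measure
    (Q \x P)%E (measurable_upd2 i).

(** Redrawing one coordinate independently preserves an i.i.d. law; on boxes this is a rearrangement
    of a product. Fubini on the pair of sample and new value then yields conditional
    expectations. *)
Lemma upd_lawE i A : measurable A -> Q A = upd_law i A.
Proof.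
move=> mA; apply: (@tuple_measure_unique Q (upd_law i)) => //; last first.
  by rewrite [X in (X < _)%E]probability_setT ltry.
move=> B mB; rewrite /upd_law /= /pushforward.
rewrite (_ : _ @^-1` _ = tuple_box (fun j => if j == i then setT else B j) `*` B i); last first.
  apply/seteqP; split => -[x y] /=.
    move=> h; split => [j|]; last by have := h i; rewrite tnth_upd eqxx.
    by have := h j; rewrite tnth_upd; case: eqP.
  move=> [h1 h2] j; rewrite tnth_upd; have := h1 j; case: eqP => [->//|_]; exact.
have mB' j : measurable (if j == i then setT else B j) by case: ifP.
rewrite product_measure1E//; last exact: measurable_tuple_box.
rewrite (QP mB) [X in (X * _)%E](QP mB') (bigD1 i)//= [in X in _ = X](bigD1 i)//= eqxx.
have -> : (\prod_(j < n | j != i) P (if j == i then setT else B j) = \prod_(j < n | j != i) P (B j))%E.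
  by apply: eq_bigr => j /negPf ->.
by rewrite [X in _ = (X * _ * _)%E]probability_setT mul1e muleC.
Qed.

Lemma ge0_resample i (f : n.-tuple T -> \bar R) :
  measurable_fun setT f -> (forall x, 0 <= f x)%E ->
  (\int[Q]_x f x = \int[Q]_x \int[P]_y f (upd i y x))%E.
Proof.
move=> mf f0.
have h A : measurable A -> A `<=` setT -> Q A = upd_law i A by move=> mA _; exact: upd_lawE.
rewrite (eq_measure_integral (upd_law i) h).
have := @ge0_integral_pushforward _ _ _ _ R _ (measurable_upd2 i) (Q \x P)%E setT f measurableT mf (fun x _ => f0 x).
rewrite preimage_setT => ->.
by rewrite fubini_tonelli1//=; exact: (measurableT_comp mf (measurable_upd2 i)).
Qed.

(** The conditional expectation given all coordinates but [i], realised as an honest function of the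
    sample so that it can be iterated. *)
Definition cexp i (g : n.-tuple T -> R) x : R := \int[P]_y g (upd i y x).

Lemma bounded_measurable_upd i (g : n.-tuple T -> R) x : bounded_measurable g ->
  bounded_measurable (fun y => g (upd i y x) : R).
Proof.
move=> [mg [K gK]]; split; last by exists K.
exact: (measurableT_comp mg (measurable_upd i x)).
Qed.

Lemma product_bounded_integrable (f : n.-tuple T * T -> R) :
  bounded_measurable f -> (Q \x P)%E.-integrable setT (EFin \o f).
Proof.
move=> [mf [K fK]]; apply: measurable_bounded_integrable => //.
  rewrite -setXTT [X in (X < _)%E]product_measure1E// [X in (X * _)%E]probability_setT.
  rewrite [X in (_ * X)%E]probability_setT mule1.
  by rewrite ltry.
exists K; split; first exact: num_real.
by move=> K' /ltW KK' x _; exact: le_trans (fK x) KK'.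
Qed.

Lemma cexpE i g x : bounded_measurable g ->
  (cexp i g x)%:E = (\int[P]_y (g (upd i y x))%:E)%E.
Proof.
move=> bg; rewrite /cexp EFin_Rintegral//.
exact/bounded_measurable_integrable/bounded_measurable_upd.
Qed.

Lemma bounded_measurable_cexp i g :
  bounded_measurable g -> bounded_measurable (cexp i g).
Proof.
move=> bg; split.
  apply/measurable_EFinP; rewrite (_ : _ \o _ = fubini_F P (EFin \o (fun p : n.-tuple T * T => g (upd i p.2 p.1)))).
    apply: measurable_fubini_F; apply: product_bounded_integrable.
    case: bg => mg [K gK]; split; last by exists K.
    exact: (measurableT_comp mg (measurable_upd2 i)).
  by apply/funext => x; rewrite /= cexpE.
have [mg [K gK]] := bg; exists K => x.
apply: le_trans (le_normr_Rintegral _ _) _ => //.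
  exact/bounded_measurable_integrable/bounded_measurable_upd.
rewrite -[leRHS](Rintegral_cst1 P); apply: le_Rintegral => //.
- apply: bounded_measurable_integrable; have [m1 [K1 h1]] := bounded_measurable_upd i x bg.
  by split; [exact: measurableT_comp|exists K1 => y; rewrite normr_id].
- exact/bounded_measurable_integrable/bounded_measurable_cst.
Qed.

Lemma resample i g : bounded_measurable g -> \int[Q]_x g x = \int[Q]_x cexp i g x.
Proof.
move=> bg; apply: EFin_inj; rewrite !EFin_Rintegral; last 2 first.
- exact/bounded_measurable_integrable/bounded_measurable_cexp.
- exact: bounded_measurable_integrable.
under [RHS]eq_integral do rewrite cexpE//.
have [mg [K gK]] := bg.
have h A : measurable A -> A `<=` setT -> Q A = upd_law i A by move=> mA _; exact: upd_lawE.
rewrite (eq_measure_integral (upd_law i) h).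
have bf : bounded_measurable (fun p : n.-tuple T * T => g (upd i p.2 p.1)).
  by split; [exact: (measurableT_comp mg (measurable_upd2 i))|exists K].
rewrite (integral_pushforward (measurable_upd2 i))//; last 2 first.
- exact/measurable_EFinP.
- by rewrite preimage_setT; exact: (product_bounded_integrable bf).
rewrite preimage_setT -[LHS](integral12_prod_meas1 (product_bounded_integrable bf)).
by apply: eq_integral.
Qed.

Definition free_of i (h : n.-tuple T -> R) := forall x y, h (upd i y x) = h x.

Lemma free_of_cexp i g : free_of i (cexp i g).
Proof. by move=> x y; apply: eq_Rintegral => z _; rewrite upd_upd. Qed.

Lemma free_of_cexp_neq i j g : free_of i g -> free_of i (cexp j g).
Proof.
move=> fg; have [->|ij] := eqVneq i j; first exact: free_of_cexp.
by move=> x y; apply: eq_Rintegral => z _; rewrite updC 1?eq_sym// fg.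
Qed.

Lemma cexp_free i h g x : bounded_measurable g -> free_of i h ->
  cexp i (fun x => h x * g x) x = h x * cexp i g x.
Proof.
move=> bg fh; rewrite /cexp -RintegralZl//; last first.
  exact/bounded_measurable_integrable/bounded_measurable_upd.
by apply: eq_Rintegral => y _; rewrite fh.
Qed.

(* cexp i is the orthogonal projection onto the functions free of coordinate i. *)
Lemma cexp_pythagoras i g h : bounded_measurable g -> bounded_measurable h -> free_of i h ->
  \int[Q]_x ((g x - h x) ^+ 2) =
  \int[Q]_x ((g x - cexp i g x) ^+ 2) + \int[Q]_x ((cexp i g x - h x) ^+ 2).
Proof.
move=> bg bh fh.
have bE := bounded_measurable_cexp i bg.
have b1 := bounded_measurableB bg bE.
have b2 := bounded_measurableB bE bh.
have cross : \int[Q]_x ((cexp i g x - h x) * (g x - cexp i g x)) = 0.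
  rewrite (resample i); last exact: bounded_measurableM.
  rewrite -[RHS](Rintegral_cst1 Q); apply: eq_Rintegral => x _.
  rewrite cexp_free//; last by move=> y z; rewrite fh free_of_cexp.
  rewrite (_ : cexp i (fun z => g z - cexp i g z) x = 0) ?mulr0//.
  rewrite /cexp RintegralB//; last 2 first.
  - exact/bounded_measurable_integrable/bounded_measurable_upd.
  - exact: (bounded_measurable_integrable P (bounded_measurable_upd i x bE)).
  have e1 : \int[P]_y cexp i g (upd i y x) = cexp i g x.
    transitivity (\int[P]_y ((fun=> cexp i g x) y)); last exact: Rintegral_cst1.
    by apply: eq_Rintegral => y _; exact: free_of_cexp.
  by rewrite e1; exact: subrr.
have -> : \int[Q]_x ((g x - h x) ^+ 2) =
    \int[Q]_x (((g x - cexp i g x) ^+ 2 + 2 * ((cexp i g x - h x) * (g x - cexp i g x)))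
      + (cexp i g x - h x) ^+ 2).
  by apply: eq_Rintegral => x _; ring.
rewrite RintegralD//; last 2 first.
- apply: bounded_measurable_integrable; apply: bounded_measurableD.
    exact: bounded_measurable_sqr.
  apply: bounded_measurableM; first exact: bounded_measurable_cst.
  exact: bounded_measurableM.
- exact/bounded_measurable_integrable/bounded_measurable_sqr.
congr (_ + _); rewrite RintegralD//; last 2 first.
- exact/bounded_measurable_integrable/bounded_measurable_sqr.
- apply: bounded_measurable_integrable; apply: bounded_measurableM; first exact: bounded_measurable_cst.
  exact: bounded_measurableM.
rewrite RintegralZl//; last exact/bounded_measurable_integrable/bounded_measurableM.
by rewrite cross mulr0 addr0.
Qed.

Definition cexps (s : seq 'I_n) (g : n.-tuple T -> R) := foldr cexp g s.

Lemma bounded_measurable_cexps s g :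
  bounded_measurable g -> bounded_measurable (cexps s g).
Proof. by move=> bg; elim: s => // i s IH; exact: bounded_measurable_cexp. Qed.

Lemma free_of_cexps i s g : free_of i g -> free_of i (cexps s g).
Proof. by move=> fg; elim: s => // j s IH; exact: free_of_cexp_neq. Qed.

Lemma free_of_cexps_mem i s g : i \in s -> free_of i (cexps s g).
Proof.
elim: s => // j s IH; rewrite inE => /predU1P[->|/IH]; first exact: free_of_cexp.
exact: free_of_cexp_neq.
Qed.

Lemma cexpB i g h x : bounded_measurable g -> bounded_measurable h ->
  cexp i (fun x => g x - h x) x = cexp i g x - cexp i h x.
Proof.
by move=> bg bh; rewrite /cexp RintegralB//;
  apply: bounded_measurable_integrable; exact: bounded_measurable_upd.
Qed.

Lemma cexpsB s g h x : bounded_measurable g -> bounded_measurable h ->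
  cexps s (fun x => g x - h x) x = cexps s g x - cexps s h x.
Proof.
move=> bg bh; elim: s x => [//|i s IH] x /=.
rewrite -cexpB; [|exact: bounded_measurable_cexps..].
by apply: eq_Rintegral => y _; exact: IH.
Qed.

Lemma Rintegral_cexps s g : bounded_measurable g ->
  \int[Q]_x cexps s g x = \int[Q]_x g x.
Proof.
move=> bg; elim: s => [//|i s <-] /=.
by rewrite -resample//; exact: bounded_measurable_cexps.
Qed.

Lemma Rintegral_cexps_sqr s g : bounded_measurable g ->
  \int[Q]_x (cexps s g x ^+ 2) <= \int[Q]_x (g x ^+ 2).
Proof.
move=> bg; elim: s => [//|i s IH]; apply: le_trans IH.
have bs := bounded_measurable_cexps s bg.
rewrite [leRHS](resample i); last exact: bounded_measurable_sqr.
apply: le_Rintegral => //.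
- exact/bounded_measurable_integrable/bounded_measurable_sqr/bounded_measurable_cexp.
- exact/bounded_measurable_integrable/bounded_measurable_cexp/bounded_measurable_sqr.
- by move=> x _; apply: Rintegral_sqr_le; exact: bounded_measurable_upd.
Qed.

Lemma cexps_cst g x : bounded_measurable g ->
  cexps (enum 'I_n) g x = \int[Q]_x g x.
Proof.
move=> bg; rewrite -(Rintegral_cexps (enum 'I_n) bg) -[LHS](Rintegral_cst1 Q).
apply: eq_Rintegral => z _; set F := cexps _ _.
(* F is free of every coordinate, so z can be turned into x one coordinate at a time. *)
have fF i : free_of i F by apply: free_of_cexps_mem; rewrite mem_enum.
have : F z = F (foldr (fun i w => upd i (tnth x i) w) z (enum 'I_n)).
  by elim: (enum 'I_n) => //= i s IH; rewrite fF.
move=> ->; congr F; apply: eq_from_tnth => j.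
have : j \in enum 'I_n by rewrite mem_enum.
elim: (enum 'I_n) => // i s IH; rewrite inE /= tnth_upd => js.
by move: js; case: (eqVneq j i) => [->//|_] /= js; exact: IH.
Qed.

(** Integrate out the coordinates one after the other. By Pythagoras each step lowers the second
    moment by the squared distance to the functions free of coordinate [i], hence by at most the
    squared distance to [cexps s] of the centred [c i]; and [cexps s] contracts the second
    moment. *)
Lemma efron_stein g (c : 'I_n -> n.-tuple T -> R) : bounded_measurable g ->
  (forall i, bounded_measurable (c i)) -> (forall i, free_of i (c i)) ->
  \int[Q]_x ((g x - \int[Q]_z g z) ^+ 2) <= \sum_(i < n) \int[Q]_x ((g x - c i x) ^+ 2).
Proof.
move=> bg bc fc; set m := \int[Q]_z g z.
pose g0 x := g x - m.
have bg0 : bounded_measurable g0 by apply: bounded_measurableB => //; exact: bounded_measurable_cst.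
suff h s : \int[Q]_x (g0 x ^+ 2) - \int[Q]_x (cexps s g0 x ^+ 2) <=
    \sum_(i <- s) \int[Q]_x ((g x - c i x) ^+ 2).
  have := h (enum 'I_n); rewrite big_enum /=.
  rewrite [X in _ - X <= _](_ : _ = 0) ?subr0//.
  rewrite -[RHS](Rintegral_cst1 Q); apply: eq_Rintegral => x _.
  rewrite cexps_cst// /g0 RintegralB//; last 2 first.
  - exact: bounded_measurable_integrable.
  - exact/bounded_measurable_integrable/bounded_measurable_cst.
  by rewrite Rintegral_cst1 -/m subrr expr0n.
elim: s => [|i s IH]; first by rewrite big_nil subrr.
rewrite big_cons.
have bs := bounded_measurable_cexps s bg0.
have b0 := @bounded_measurable_cst _ _ (n.-tuple T) (0 : R).
have f0 : free_of i (fun _ : n.-tuple T => 0 : R) by [].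
have := cexp_pythagoras bs b0 f0.
under eq_Rintegral do rewrite subr0.
under [X in _ = _ + X]eq_Rintegral do rewrite subr0.
move=> pyth.
pose ci x := c i x - m.
have bci : bounded_measurable ci by apply: bounded_measurableB => //; exact: bounded_measurable_cst.
have fci : free_of i ci by move=> x y; rewrite /ci fc.
have := cexp_pythagoras bs (bounded_measurable_cexps s bci) (free_of_cexps s fci).
move=> pyth2.
have le1 : \int[Q]_x ((cexps s g0 x - cexp i (cexps s g0) x) ^+ 2) <=
    \int[Q]_x ((g x - c i x) ^+ 2).
  apply: (@le_trans _ _ (\int[Q]_x ((cexps s g0 x - cexps s ci x) ^+ 2))).
    by rewrite pyth2 lerDl; apply: Rintegral_ge0 => x _; exact: sqr_ge0.
  apply: (@le_trans _ _ (\int[Q]_x (cexps s (fun x => g0 x - ci x) x ^+ 2))).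
    by rewrite le_eqVlt; apply/orP; left; apply/eqP; apply: eq_Rintegral => x _; rewrite cexpsB.
  apply: (le_trans (Rintegral_cexps_sqr s (bounded_measurableB bg0 bci))).
  rewrite le_eqVlt; apply/orP; left; apply/eqP; apply: eq_Rintegral => x _.
  by rewrite /g0 /ci; ring.
have aux (a b c' d e u : R) : a - b <= u -> b = c' + e -> c' <= d -> a - e <= d + u.
  by clear; move=> *; lra.
exact: aux IH pyth le1.
Qed.

End sampling.

(** * Moments of sums of independent centred vectors *)

Section norm_power.
Context {R : realType}.

(** This inequality and the next absorb the mixed monomials created by one more factor in the
    induction below; each follows by comparing [a] with [b]. *)
Lemma pow_mix1 (a b : R) p : 0 <= a -> 0 <= b ->
  a ^+ (2 * p) * b ^+ 4 <= a ^+ (2 * p.+1) * b ^+ 2 + b ^+ (2 * p.+2).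
Proof.
move=> a0 b0; have a2p : 0 <= a ^+ (2 * p) by exact: exprn_ge0.
have [ab|ba] := leP b a.
  rewrite -[leLHS]addr0; apply: lerD; last exact: exprn_ge0.
  rewrite mulnS addnC exprD -mulrA ler_wpM2l// (exprD b 2 2) ler_wpM2r ?exprn_ge0//.
  by rewrite lerXn2r.
rewrite -[leLHS]add0r; apply: lerD; first by rewrite mulr_ge0 ?exprn_ge0.
rewrite (_ : (2 * p.+2 = 2 * p + 4)%N); last by rewrite !mulnS addnA addnC.
by rewrite exprD ler_wpM2r ?exprn_ge0// lerXn2r// ltW.
Qed.

Lemma pow_mix2 (a b : R) p : 0 <= a -> 0 <= b ->
  a ^+ 2 * b ^+ (2 * p.+1) <= a ^+ (2 * p.+1) * b ^+ 2 + b ^+ (2 * p.+2).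
Proof.
move=> a0 b0; have [ab|ba] := leP b a.
  rewrite -[leLHS]addr0; apply: lerD; last exact: exprn_ge0.
  have e x : x ^+ (2 * p.+1) = x ^+ (2 * p) * x ^+ 2 :> R by rewrite mulnS addnC exprD.
  rewrite !e.
  have -> : a ^+ 2 * (b ^+ (2 * p) * b ^+ 2) = a ^+ 2 * b ^+ 2 * b ^+ (2 * p) by ring.
  have -> : a ^+ (2 * p) * a ^+ 2 * b ^+ 2 = a ^+ 2 * b ^+ 2 * a ^+ (2 * p) by ring.
  by rewrite ler_wpM2l ?mulr_ge0 ?exprn_ge0// lerXn2r.
rewrite -[leLHS]add0r; apply: lerD; first by rewrite mulr_ge0 ?exprn_ge0.
rewrite (_ : (2 * p.+2 = 2 + 2 * p.+1)%N); last by rewrite !mulnS addnA addnC.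
by rewrite exprD ler_wpM2r ?exprn_ge0// lerXn2r// ltW.
Qed.

(* With a = |s|, b = |y| and c = <s, y>, the base of the power is |s + y|^2; the
   term linear in y is kept exactly because its expectation vanishes. *)
Lemma norm_pow_expand p : exists2 C : R, 0 <= C & forall a b c : R, 0 <= a -> 0 <= b ->
  `|c| <= a * b -> (a ^+ 2 + 2 * c + b ^+ 2) ^+ p.+1 <=
    a ^+ (2 * p.+1) + (2 * p.+1)%:R * a ^+ (2 * p) * c
      + C * (a ^+ (2 * p) * b ^+ 2 + b ^+ (2 * p.+1)).
Proof.
elim: p => [|p [C C0 IH]].
  exists 1 => // a b c a0 b0 _; rewrite muln0 muln1 expr0 expr1 !mul1r mulr1.
  have := sqr_ge0 b; lra.
exists (8 * p.+2%:R + 8 * C) => [|a b c a0 b0 cab].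
  by rewrite addr_ge0// mulr_ge0.
set X := a ^+ 2 + 2 * c + b ^+ 2.
move: (cab); rewrite ler_norml => /andP[c1 c2].
have X0 : 0 <= X.
  by have := sqr_ge0 (a - b); rewrite /X sqrrB; lra.
have X1 : X <= 2 * (a ^+ 2 + b ^+ 2).
  by have := sqr_ge0 (a - b); rewrite /X sqrrB; lra.
set A := a ^+ (2 * p); have A0 : 0 <= A by exact: exprn_ge0.
have eA : a ^+ (2 * p.+1) = A * a ^+ 2 by rewrite mulnS addnC exprD.
have eA2 : a ^+ (2 * p.+2) = A * a ^+ 2 * a ^+ 2 by rewrite mulnS addnC exprD eA.
set B := b ^+ (2 * p.+1); have B0 : 0 <= B by exact: exprn_ge0.
have eB : b ^+ (2 * p.+2) = B * b ^+ 2 by rewrite mulnS addnC exprD.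
have m1 := pow_mix1 p a0 b0; have m2 := pow_mix2 p a0 b0.
rewrite eA eB -/A -/B in m1 m2.
have := IH a b c a0 b0 cab; rewrite -/X eA -/A -/B => h.
rewrite exprSr; apply: (le_trans (ler_wpM2r X0 h)).
rewrite eA2 eB.
set k := p.+1%:R : R.
have k0 : 0 <= k by [].
have ek : p.+2%:R = k + 1 :> R by rewrite /k -natr1.
rewrite !natrM ek -/k.
have T0 : 0 <= A * b ^+ 2 + B by rewrite addr_ge0// mulr_ge0 ?sqr_ge0.
have h1 : C * (A * b ^+ 2 + B) * X <= C * (A * b ^+ 2 + B) * (2 * (a ^+ 2 + b ^+ 2)).
  by rewrite ler_wpM2l// mulr_ge0.
have cc : c ^+ 2 <= a ^+ 2 * b ^+ 2.
  by rewrite -exprMn -real_normK ?num_real// lerXn2r ?nnegrE ?mulr_ge0.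
have h2 : A * c ^+ 2 <= A * (a ^+ 2 * b ^+ 2) by rewrite ler_wpM2l.
have h3 : A * (c * b ^+ 2) <= A * (a ^+ 2 * b ^+ 2) + A * b ^+ 4.
  rewrite -mulrDr ler_wpM2l//; apply: (@le_trans _ _ (a * b * b ^+ 2)).
    by rewrite ler_wpM2r ?sqr_ge0.
  have := mulr_ge0 (sqr_ge0 b) (sqr_ge0 (a - b)); have : 0 <= a ^+ 2 * b ^+ 2 by rewrite mulr_ge0 ?sqr_ge0.
  have : 0 <= b ^+ 4 by exact: exprn_ge0.
  have -> : b ^+ 2 * (a - b) ^+ 2 = a ^+ 2 * b ^+ 2 - 2 * (a * b * b ^+ 2) + b ^+ 4 by ring.
  lra.
(* [u] and [v] are the two error terms allowed at the next exponent; every other monomial is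
   compared with them. *)
set u := A * a ^+ 2 * b ^+ 2 in m1 m2 *; set v := B * b ^+ 2 in m1 m2 *.
have u0 : 0 <= u by rewrite !mulr_ge0 ?sqr_ge0.
have v0 : 0 <= v by rewrite mulr_ge0 ?sqr_ge0.
have eu : A * (a ^+ 2 * b ^+ 2) = u by rewrite /u mulrA.
rewrite eu in h2 h3.
have -> : (A * a ^+ 2 + 2 * k * A * c + C * (A * b ^+ 2 + B)) * X =
   A * a ^+ 2 * a ^+ 2 + 2 * (k + 1) * (A * a ^+ 2) * c + u + 4 * k * (A * c ^+ 2)
    + 2 * k * (A * (c * b ^+ 2)) + C * (A * b ^+ 2 + B) * X.
  by rewrite /X /u; ring.
have h4 : C * (A * b ^+ 2 + B) * (2 * (a ^+ 2 + b ^+ 2)) <= C * (8 * (u + v)).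
  have -> : C * (A * b ^+ 2 + B) * (2 * (a ^+ 2 + b ^+ 2)) =
     C * (2 * (u + A * b ^+ 4 + a ^+ 2 * B + v)) by rewrite /u /v; ring.
  by rewrite ler_wpM2l//; lra.
have h5 : k * (A * c ^+ 2) <= k * u by rewrite ler_wpM2l.
have h6 : k * (A * (c * b ^+ 2)) <= k * (2 * (u + v)) by rewrite ler_wpM2l//; lra.
have ku : 0 <= k * u by exact: mulr_ge0.
have kv : 0 <= k * v by exact: mulr_ge0.
rewrite mulrDr in h6; rewrite !mulrDr in h6 h4.
lra.
Qed.

End norm_power.

Section rosenthal.
Context {R : realType}.

Lemma integrable_dominated {d} {S : measurableType d} (P : probability S R) (g h : S -> R) :
  measurable_fun [set: S] g -> (forall x, `|g x| <= h x) ->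
  P.-integrable setT (EFin \o h) -> P.-integrable setT (EFin \o g).
Proof.
move=> mg gh ih; apply: le_integrable ih => //; first exact/measurable_EFinP.
by move=> x _ /=; rewrite lee_fin (le_trans (gh x))// ler_norm.
Qed.

Lemma integrable_real_cst {d} {S : measurableType d} (P : probability S R) (c : R) :
  P.-integrable setT (EFin \o (fun _ : S => c)).
Proof. exact/bounded_measurable_integrable/bounded_measurable_cst. Qed.

Lemma integrable_realZ {d} {S : measurableType d} (P : probability S R) (c : R) (g : S -> R) :
  P.-integrable setT (EFin \o g) -> P.-integrable setT (EFin \o (fun x => c * g x)).
Proof.
move=> ig; rewrite (_ : _ \o _ = (fun x => c%:E * (EFin \o g) x)%E); last by apply/funext.
exact: integrableZl.
Qed.

Lemma integrable_realD {d} {S : measurableType d} (P : probability S R) (g h : S -> R) :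
  P.-integrable setT (EFin \o g) -> P.-integrable setT (EFin \o h) ->
  P.-integrable setT (EFin \o (fun x => g x + h x)).
Proof.
move=> ig ih; rewrite (_ : _ \o _ = (EFin \o g) \+ (EFin \o h))%E; last by apply/funext.
exact: integrableD.
Qed.

(** Induction on the exponent, then on the number of summands. Redrawing the newest summand kills
    the term linear in it, and the rest involves only the previous exponent, so each summand adds
    one power of the size less than the target. Only norms and inner products occur, so [K] does not
    depend on [N]. *)
Lemma rosenthal (p : nat) : exists2 K : R, 0 <= K &
  forall dT (T : measurableType dT) n (P : probability T R) (Q : probability (n.-tuple T) R),
  iid_law P Q -> forall N (Y : T -> 'rV[R]_N) (B : R),
  measurable_fun [set: T] Y -> 0 <= B ->
  (forall u, \int[P]_y dot u (Y y) = 0) ->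
  (forall q, (q <= p)%N -> (\int[P]_y (enorm (Y y) ^+ (2 * q))%:E <= (B ^+ (2 * q))%:E)%E) ->
  forall s : seq 'I_n, uniq s ->
  (\int[Q]_x (enorm (\sum_(j <- s) Y (tnth x j)) ^+ (2 * p))%:E
    <= (K * (size s)%:R ^+ p * B ^+ (2 * p))%:E)%E.
Proof.
elim: p => [|p [K K0 IHp]].
  exists 1 => // dT T n P Q QP N Y B mY B0 Y0 YB s us.
  under eq_integral do rewrite muln0 expr0.
  by rewrite integral_cst// [X in (_ * X)%E]probability_setT mul1e muln0 !expr0 !mulr1.
have [C C0 hC] := @norm_pow_expand R p.
exists (C * K + C) => [|dT T n P Q QP N Y B mY B0 Y0 YB]; first by rewrite addr_ge0// mulr_ge0.
have mS s : measurable_fun [set: n.-tuple T] (fun x => \sum_(j <- s) Y (tnth x j)).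
  by apply: measurable_fun_row_sum => j; exact: (measurableT_comp mY (measurable_tnth j)).
have mSq s q : measurable_fun [set: n.-tuple T] (fun x => enorm (\sum_(j <- s) Y (tnth x j)) ^+ q).
  by apply: measurable_funX; exact: measurable_fun_enorm.
have mYq q : measurable_fun [set: T] (fun y => enorm (Y y) ^+ q).
  by apply: measurable_funX; exact: measurable_fun_enorm.
have iY q : (q <= p.+1)%N -> P.-integrable setT (EFin \o (fun y => enorm (Y y) ^+ (2 * q))).
  move=> qp; apply: (@ge0_integrable _ _ _ _ _ (B ^+ (2 * q))) => //; last exact: YB.
  by move=> y; exact: exprn_ge0.
have inner (S : 'rV[R]_N) :
    (\int[P]_y (enorm (S + Y y) ^+ (2 * p.+1))%:E <=
      (enorm S ^+ (2 * p.+1) + C * (enorm S ^+ (2 * p) * B ^+ 2 + B ^+ (2 * p.+1)))%:E)%E.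
  pose g y := enorm S ^+ (2 * p.+1) + (2 * p.+1)%:R * enorm S ^+ (2 * p) * dot S (Y y)
      + C * (enorm S ^+ (2 * p) * enorm (Y y) ^+ 2 + enorm (Y y) ^+ (2 * p.+1)).
  have gle y : enorm (S + Y y) ^+ (2 * p.+1) <= g y.
    have -> : enorm (S + Y y) ^+ (2 * p.+1) =
        (enorm S ^+ 2 + 2 * dot S (Y y) + enorm (Y y) ^+ 2) ^+ p.+1.
      rewrite exprM; congr (_ ^+ _); rewrite !sqr_enorm dotDl !dotDr (dotC (Y y) S).
      by move: (dot S S) (dot S (Y y)) (dot (Y y) (Y y)) => *; ring.
    by apply: hC => //; exact: normr_dot_le.
  have mdot : measurable_fun [set: T] (fun y => dot S (Y y)).
    by apply: measurable_fun_dot => //; exact: measurable_cst.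
  have i2 := iY 1%N isT; rewrite muln1 in i2.
  have ip := iY p.+1 (leqnn _).
  have ic := integrable_real_cst P.
  have id : P.-integrable setT (EFin \o (fun y => dot S (Y y))).
    apply: (@integrable_dominated _ _ _ _ (fun y => enorm S * (1 + enorm (Y y) ^+ 2))) => //.
      move=> y; apply: (le_trans (normr_dot_le _ _)); rewrite ler_wpM2l//.
      by have := sqr_ge0 (enorm (Y y) - 1); have := enorm_ge0 (Y y); move: (enorm (Y y)) => t; nra.
    exact/integrable_realZ/integrable_realD.
  have i3 := integrable_realZ ((2 * p.+1)%:R * enorm S ^+ (2 * p)) id.
  have i4 := integrable_realZ (enorm S ^+ (2 * p)) i2.
  have i5 := integrable_realD i4 ip.
  have i6 := integrable_realZ C i5.
  have i7 := integrable_realD (ic (enorm S ^+ (2 * p.+1))) i3.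
  have ig : P.-integrable setT (EFin \o g) := integrable_realD i7 i6.
  apply: (@le_trans _ _ (\int[P]_y (g y)%:E)%E).
    apply: ge0_le_integral => //.
    - by move=> y _; rewrite lee_fin exprn_ge0.
    - apply/measurable_EFinP/measurable_funX/measurable_fun_enorm/measurable_fun_rowD => //.
    - exact: measurable_int ig.
    - by move=> y _; rewrite lee_fin.
  rewrite -EFin_Rintegral// lee_fin /g RintegralD// RintegralD// Rintegral_cst1.
  rewrite RintegralZl// Y0 mulr0 addr0 lerD2l RintegralZl// ler_wpM2l// RintegralD//.
  rewrite RintegralZl//; apply: lerD; last first.
    by rewrite -lee_fin EFin_Rintegral//; exact: YB.
  rewrite ler_wpM2l ?exprn_ge0//; have := YB 1%N isT; rewrite muln1.
  by rewrite -EFin_Rintegral.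
elim => [_|i s IHs /= /andP[ins us]].
  under eq_integral do rewrite big_nil enorm0 expr0n.
  by rewrite integral_cst// mul0e expr0n mulr0 mul0r.
rewrite (ge0_resample QP i); last 2 first.
- exact/measurable_EFinP.
- by move=> x; rewrite lee_fin exprn_ge0.
have eS x y : \sum_(j <- i :: s) Y (tnth (upd i y x) j) = \sum_(j <- s) Y (tnth x j) + Y y.
  rewrite big_cons tnth_upd eqxx addrC; congr (_ + _).
  apply: eq_big_seq => j js; rewrite tnth_upd; case: eqP => // ji.
  by rewrite -ji js in ins.
under eq_integral => x _ do under eq_integral do rewrite eS.
set S := fun x : n.-tuple T => \sum_(j <- s) Y (tnth x j).
have b1 : (\int[Q]_x (enorm (S x) ^+ (2 * p))%:E <= (K * (size s)%:R ^+ p * B ^+ (2 * p))%:E)%E.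
  by apply: (IHp _ _ _ _ _ QP) => // q qp; apply: YB; exact: leqW.
have b2 := IHs us; rewrite -/(S _) in b2.
have i1 : Q.-integrable setT (EFin \o (fun x => enorm (S x) ^+ (2 * p))).
  by apply: ge0_integrable b1 => [|x]; [exact: mSq|exact: exprn_ge0].
have i2 : Q.-integrable setT (EFin \o (fun x => enorm (S x) ^+ (2 * p.+1))).
  by apply: ge0_integrable b2 => [|x]; [exact: mSq|exact: exprn_ge0].
pose G x := enorm (S x) ^+ (2 * p.+1) + (C * B ^+ 2 * enorm (S x) ^+ (2 * p) + C * B ^+ (2 * p.+1)).
have i3 := integrable_realD (integrable_realZ (C * B ^+ 2) i1) (integrable_real_cst Q (C * B ^+ (2 * p.+1))).
have iG : Q.-integrable setT (EFin \o G) := integrable_realD i2 i3.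
apply: (@le_trans _ _ (\int[Q]_x (G x)%:E)%E).
  apply: ge0_le_integral => //.
  - by move=> x _; apply: integral_ge0 => y _; rewrite lee_fin exprn_ge0.
  - apply: (measurable_fun_fubini_tonelli_F (fun xy => (enorm (S xy.1 + Y xy.2) ^+ (2 * p.+1))%:E)) => [|z].
      apply/measurable_EFinP/measurable_funX/measurable_fun_enorm/measurable_fun_rowD.
        exact: (measurableT_comp (mS s) measurable_fst).
      exact: (measurableT_comp mY measurable_snd).
    by rewrite lee_fin exprn_ge0.
  - exact: measurable_int iG.
  - move=> x _; apply: (le_trans (inner (S x))); rewrite lee_fin /G lerD2l mulrDr.
    by rewrite (mulrC (enorm _ ^+ _)) mulrA.
rewrite -EFin_Rintegral// lee_fin /G RintegralD// RintegralD//; last 2 first.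
- exact: integrable_realZ.
- exact: integrable_real_cst.
rewrite RintegralZl// Rintegral_cst1.
have c1 : \int[Q]_x (enorm (S x) ^+ (2 * p)) <= K * (size s)%:R ^+ p * B ^+ (2 * p).
  by rewrite -lee_fin EFin_Rintegral.
have c2 : \int[Q]_x (enorm (S x) ^+ (2 * p.+1)) <= (C * K + C) * (size s)%:R ^+ p.+1 * B ^+ (2 * p.+1).
  by rewrite -lee_fin EFin_Rintegral.
set I1 := \int[Q]_x _ in c1 *; set I2 := \int[Q]_x _ in c2 *.
set l := (size s)%:R : R in c1 c2 *; have l0 : 0 <= l by [].
have -> : (size s).+1%:R = l + 1 :> R by rewrite /l -natr1.
set D := B ^+ (2 * p.+1) in c2 *.
have eD : D = B ^+ 2 * B ^+ (2 * p) by rewrite /D mulnS exprD.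
have D0 : 0 <= D by exact: exprn_ge0.
have c3 : C * B ^+ 2 * I1 <= C * K * l ^+ p * D.
  have -> : C * K * l ^+ p * D = C * B ^+ 2 * (K * l ^+ p * B ^+ (2 * p)) by rewrite eD; ring.
  by rewrite ler_wpM2l// mulr_ge0// exprn_ge0.
apply: (le_trans (lerD c2 (lerD c3 (lexx _)))).
rewrite -!mulrDl ler_wpM2r//.
have lp : l ^+ p <= (l + 1) ^+ p by rewrite lerXn2r ?nnegrE ?addr_ge0// lerDl.
have l1 : 1 <= (l + 1) ^+ p by rewrite exprn_ege1// lerDr.
have lS : l ^+ p.+1 <= l * (l + 1) ^+ p by rewrite exprS ler_wpM2l.
have CK : 0 <= C * K by exact: mulr_ge0.
(* Passing from [l] to [l + 1] summands frees one copy of [(C * K + C) * (l + 1) ^+ p], which pays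
   for the two new terms. *)
have e : (C * K + C) * (l + 1) ^+ p.+1 = (C * K + C) * (l * (l + 1) ^+ p) + C * K * (l + 1) ^+ p + C * (l + 1) ^+ p.
  by rewrite exprS; ring.
rewrite e -addrA; apply: lerD; first by rewrite ler_wpM2l// addr_ge0.
by apply: lerD; [rewrite ler_wpM2l|rewrite ler_peMr].
Qed.

End rosenthal.

(** * Elementary inequalities for powers and exponentials *)

Section power_mean.
Context {R : realType}.

(** Chebyshev's sum inequality for the similarly ordered families [x i] and [x i ^+ q]: twice the
    difference is the double sum of the products [(x i - x j) * (x i ^+ q - x j ^+ q)], all
    nonnegative. *)
Lemma sum_mul_pow_le (I : finType) q (x : I -> R) : (forall i, 0 <= x i) ->
  (\sum_i x i) * (\sum_i x i ^+ q) <= #|I|%:R * \sum_i x i ^+ q.+1.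
Proof.
move=> x0.
suff : 2 * ((\sum_i x i) * (\sum_i x i ^+ q)) <= 2 * (#|I|%:R * \sum_i x i ^+ q.+1).
  by rewrite ler_pM2l.
have e1 : (\sum_i x i) * (\sum_i x i ^+ q) = \sum_i \sum_j x i * x j ^+ q.
  by rewrite mulr_suml; apply: eq_bigr => i _; rewrite mulr_sumr.
have e2 : (\sum_i x i) * (\sum_i x i ^+ q) = \sum_i \sum_j x j * x i ^+ q.
  by rewrite e1 exchange_big.
have e3 : #|I|%:R * \sum_i x i ^+ q.+1 = \sum_(i : I) \sum_(j : I) x i ^+ q.+1.
  by rewrite mulr_sumr; apply: eq_bigr => i _; rewrite sumr_const mulr_natl.
have e4 : #|I|%:R * \sum_i x i ^+ q.+1 = \sum_(i : I) \sum_(j : I) x j ^+ q.+1.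
  by rewrite e3 exchange_big.
rewrite !mulr2n !mulrDl !mul1r {1}e1 e2 {1}e3 e4 -!big_split.
apply: ler_sum => i _; rewrite -!big_split; apply: ler_sum => j _ /=.
rewrite !exprS -subr_ge0.
have -> : x i * x i ^+ q + x j * x j ^+ q - (x i * x j ^+ q + x j * x i ^+ q) =
   (x i - x j) * (x i ^+ q - x j ^+ q) by ring.
have [ij|/ltW ij] := leP (x j) (x i).
  by rewrite mulr_ge0 ?subr_ge0 ?lerXn2r ?nnegrE.
by rewrite mulr_le0 ?subr_le0 ?lerXn2r ?nnegrE.
Qed.

Lemma sum_pow_le (I : finType) q (x : I -> R) : (forall i, 0 <= x i) ->
  (\sum_i x i) ^+ q.+1 <= #|I|%:R ^+ q * \sum_i x i ^+ q.+1.
Proof.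
move=> x0; elim: q => [|q IH]; first by rewrite expr0 mul1r expr1; under [leRHS]eq_bigr do rewrite expr1.
rewrite exprS; apply: (@le_trans _ _ ((\sum_i x i) * (#|I|%:R ^+ q * \sum_i x i ^+ q.+1))).
  by rewrite ler_wpM2l// sumr_ge0.
rewrite mulrCA exprSr -mulrA ler_wpM2l ?exprn_ge0//; exact: sum_mul_pow_le.
Qed.

(** This bound and the next come from [1 - z <= expR (- z)]: in the stated range of [z], the product
    of [1 - z] with the right side is at least 1. *)
Lemma expR_le_1D2x (z : R) : 0 <= z <= 2^-1 -> expR z <= 1 + 2 * z.
Proof.
move=> /andP[z0 z1]; have := expR_ge1Dx (- z); rewrite expRN => h.
have e0 := expR_gt0 z.
have {}h : (1 - z) * expR z <= 1.
  by rewrite -ler_pdivlMr// div1r.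
have hz : 0 < 1 - z by lra.
rewrite -(ler_pM2l hz); apply: (le_trans h); nra.
Qed.

Lemma expR_le_quad (z : R) : z <= 0 -> expR z <= 1 + z + z ^+ 2.
Proof.
move=> z0; have := expR_ge1Dx (- z); rewrite expRN => h.
have e0 := expR_gt0 z.
have {}h : (1 - z) * expR z <= 1.
  by rewrite -ler_pdivlMr// div1r.
have hz : 0 < 1 - z by lra.
rewrite -(ler_pM2l hz); apply: (le_trans h).
have : 0 <= - z * z ^+ 2 by rewrite mulr_ge0 ?sqr_ge0// oppr_ge0.
nra.
Qed.

Lemma pow_le_expR (t : R) n : `|t| ^+ n <= n`!%:R * (expR t + expR (- t)).
Proof.
have h : `|t| ^+ n <= n`!%:R * expR `|t|.
  case: n => [|n]; first by rewrite expr0 fact0 mul1r; have := expR_ge1Dx `|t|; have := normr_ge0 t; lra.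
  have := expR_ge1Dxn n (normr_ge0 t) => h.
  rewrite mulrC -ler_pdivrMr ?ltr0n ?fact_gt0//.
  by apply: le_trans h; rewrite lerDr.
apply: (le_trans h); rewrite ler_wpM2l//.
by case: (ger0P t) => _; rewrite ?lerDl ?lerDr expR_ge0.
Qed.

End power_mean.

(** * The score is centred, with dimension-free moments in each direction *)

Section score_moments.
Context {R : realType} {d : nat} (V : 'rV[R]_d -> R) (L M m : R).
Hypotheses (L0 : 0 < L) (M0 : 0 < M) (m0 : 0 < m).
Hypothesis V_sc : strictly_convex V.
Hypothesis V_C2 : twice_continuously_differentiable V.
Hypothesis V_M : (ereal_sup [set (opnorm (hessian V x))%:E | x in [set: 'rV[R]_d]]
         <= M%:E)%E.
Hypothesis V_L : (ereal_sup
         [set (opnorm (hessian V z.1 - hessian V z.2)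
               / enorm (z.1 - z.2))%:E
         | z in [set z : 'rV[R]_d * 'rV[R]_d | z.1 != z.2]] <= L%:E)%E.
Variable P : probability 'rV[R]_d R.
Hypothesis PV : has_density P (fun x => expR (- V x)).

Local Notation DV := (gradient V).
Local Notation HV := (hessian V).

Lemma measurable_V : measurable_fun [set: 'rV[R]_d] V.
Proof. by apply: measurable_enorm_continuous; exact: continuous_V. Qed.

Lemma measurable_gradient : measurable_fun [set: 'rV[R]_d] DV.
Proof. by apply: measurable_row_continuous; exact: continuous_gradient. Qed.

Lemma measurable_hessian i j : measurable_fun [set: 'rV[R]_d] (fun x => HV x i j).
Proof.
have [_ _ cH] := V_C2; apply: measurable_enorm_continuous => x.
exact: (cvg_comp _ _ (cH x) (@coord_continuous _ _ _ i j (HV x))).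
Qed.

Lemma measurable_score u : measurable_fun [set: 'rV[R]_d] (fun x => dot u (DV x)).
Proof. by apply: measurable_fun_dot; [exact: measurable_cst|exact: measurable_gradient]. Qed.

Lemma measurable_density : measurable_fun [set: 'rV[R]_d] (fun x => expR (- V x)).
Proof. by apply: measurableT_comp => //; apply: measurableT_comp => //; exact: measurable_V. Qed.

Lemma measurable_comp_shift (h : 'rV[R]_d -> R) u :
  measurable_fun setT h -> measurable_fun [set: 'rV[R]_d] (fun x => h (x + u)).
Proof. by move=> mh; exact: (measurableT_comp mh (measurable_row_shift u)). Qed.

Lemma density_shift_mass u :
  (\int[lebesgue_row R d]_x (expR (- V (x - u)))%:E = 1)%E.
Proof.
rewrite (integral_row_shift (- u) (g := fun x => (expR (- V x))%:E)); last 2 first.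
- by apply/measurable_EFinP; exact: measurable_density.
- by move=> x; rewrite lee_fin expR_ge0.
by have := PV measurableT; rewrite [X in X = _]probability_setT => <-.
Qed.

(* V (x - u) <= V x - <u, DV x> + M |u|^2 turns the exponential moment into a
   shifted copy of the density: smoothness makes the score sub-Gaussian. *)
Lemma score_mgf u :
  (\int[P]_x (expR (dot u (DV x)))%:E <= (expR (M * enorm u ^+ 2))%:E)%E.
Proof.
have mE : measurable_fun [set: 'rV[R]_d] (fun x => expR (dot u (DV x))).
  by apply: measurableT_comp => //; exact: measurable_score.
rewrite (ge0_integral_density PV measurable_density) => [|x||x]; last 3 first.
- exact: expR_ge0.
- exact/measurable_EFinP.
- by rewrite lee_fin expR_ge0.
apply: (@le_trans _ _ (\int[lebesgue_row R d]_x ((expR (M * enorm u ^+ 2))%:E * (expR (- V (x - u)))%:E))%E).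
  apply: ge0_le_integral => //.
  - by apply: emeasurable_funM; apply/measurable_EFinP => //; exact: measurable_density.
  - apply: emeasurable_funM; apply/measurable_EFinP => //.
    exact: (measurable_comp_shift (- u) measurable_density).
  - move=> x _; rewrite -!EFinM lee_fin -!expRD ler_expR.
    have := V_upper M0 V_C2 V_M x (- u); rewrite dotNl enormN.
    by move: (V (x - u)) (V x) (dot u (DV x)) (M * enorm u ^+ 2) => *; lra.
rewrite ge0_integralZl_EFin ?expR_ge0//; first by rewrite density_shift_mass mule1.
by apply/measurable_EFinP; exact: (measurable_comp_shift (- u) measurable_density).
Qed.

Lemma integrable_exp_score u : P.-integrable setT (EFin \o (fun x => expR (dot u (DV x)))).
Proof.
apply: ge0_integrable (score_mgf u) => [|x]; last exact: expR_ge0.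
by apply: measurableT_comp => //; exact: measurable_score.
Qed.

Lemma integrable_score_pow u n : P.-integrable setT (EFin \o (fun x => `|dot u (DV x)| ^+ n)).
Proof.
apply: (@integrable_dominated _ _ _ _ _ (fun x => n`!%:R * (expR (dot u (DV x)) + expR (dot (- u) (DV x))))).
- by apply: measurable_funX; apply: measurableT_comp => //; exact: measurable_score.
- by move=> x; rewrite ger0_norm ?exprn_ge0// dotNl; exact: pow_le_expR.
- by apply: integrable_realZ; apply: integrable_realD; exact: integrable_exp_score.
Qed.

Lemma integrable_score u : P.-integrable setT (EFin \o (fun x => dot u (DV x))).
Proof.
apply: (@integrable_dominated _ _ _ _ _ (fun x => `|dot u (DV x)| ^+ 1)).
- exact: measurable_score.
- by move=> x; rewrite expr1.
- exact: integrable_score_pow.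
Qed.

(** Exponential moments at [u] and [- u] control all powers. A single direction is tested, so the
    bound is free of [d]; the variance estimate relies on this. *)
Lemma score_moment u n : enorm u <= 1 ->
  \int[P]_x (`|dot u (DV x)| ^+ n) <= n`!%:R * (2 * expR M).
Proof.
move=> u1.
apply: (@le_trans _ _ (\int[P]_x (n`!%:R * (expR (dot u (DV x)) + expR (dot (- u) (DV x)))))).
  apply: le_Rintegral => //.
  - exact: integrable_score_pow.
  - by apply: integrable_realZ; apply: integrable_realD; exact: integrable_exp_score.
  - by move=> x _; rewrite dotNl; exact: pow_le_expR.
rewrite RintegralZl//; last by apply: integrable_realD; exact: integrable_exp_score.
rewrite ler_wpM2l// RintegralD//; [|exact: integrable_exp_score..].
have h v : enorm v <= 1 -> \int[P]_x expR (dot v (DV x)) <= expR M.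
  move=> v1; rewrite -lee_fin EFin_Rintegral; last exact: integrable_exp_score.
  apply: (le_trans (score_mgf v)); rewrite lee_fin ler_expR -[leRHS]mulr1.
  by rewrite ler_wpM2l ?(ltW M0)// exprn_ile1.
by rewrite mulr2n mulrDl mul1r; apply: lerD; apply: h; rewrite ?enormN.
Qed.

(** The exponential moments suffice: if the mean [c] in some direction were positive, then
    [1 + l * c <= expR (l ^+ 2 * N)] for all small [l > 0], which fails to first order in [l]. *)
Lemma score_mean0 u : \int[P]_x dot u (DV x) = 0.
Proof.
suff h v : \int[P]_x dot v (DV x) <= 0.
  apply/eqP; rewrite eq_le h /= -oppr_le0.
  have := h (- u); rewrite (_ : \int[P]_x dot (- u) (DV x) = - \int[P]_x dot u (DV x))//.
  rewrite -mulN1r -RintegralZl//; last exact: integrable_score.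
  by apply: eq_Rintegral => x _; rewrite dotNl mulN1r.
rewrite leNgt; apply/negP; set c := \int[P]_x _ => c0.
set N := M * enorm v ^+ 2; have N0 : 0 <= N by rewrite mulr_ge0 ?exprn_ge0// ltW.
have N1 : 0 < N + 1 by lra.
(* The first entry makes [2 * (l * N)] smaller than [c]; the second keeps the exponent within the
   range of [expR_le_1D2x]. *)
pose l := Num.min (c / (4 * (N + 1))) (1 / (2 * (N + 1))).
have l0 : 0 < l by rewrite lt_min !divr_gt0// mulr_gt0.
have l1 : l * (N + 1) <= c / 4.
  have : l <= c / (4 * (N + 1)) by rewrite ge_min lexx.
  rewrite ler_pdivlMr ?mulr_gt0// => h; lra.
have l2 : l * (N + 1) <= 2^-1.
  have : l <= 1 / (2 * (N + 1)) by rewrite ge_min lexx orbT.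
  rewrite ler_pdivlMr ?mulr_gt0// => h; lra.
have ll : l <= 2^-1 by apply: le_trans l2; rewrite ler_peMr ?(ltW l0)// lerDr.
have lN : l * N <= 2^-1 by apply: le_trans l2; rewrite ler_wpM2l ?(ltW l0)// lerDl.
have hexp : expR (l ^+ 2 * N) <= 1 + 2 * (l ^+ 2 * N).
  apply: expR_le_1D2x; apply/andP; split; first by rewrite mulr_ge0 ?sqr_ge0.
  apply: le_trans lN; rewrite expr2 -mulrA ler_piMl//; first by rewrite mulr_ge0 ?(ltW l0).
  by apply: (le_trans ll); rewrite invf_le1 ?ler1n.
have h1 : 1 + l * c <= expR (l ^+ 2 * N).
  rewrite -lee_fin; have := score_mgf (l *: v); rewrite enormZ exprMn real_normK ?num_real//.
  rewrite mulrCA -/N; apply: le_trans.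
  rewrite /c -RintegralZl//; last exact: integrable_score.
  rewrite -[X in (X + _)%:E](Rintegral_cst1 P) -RintegralD//; last 2 first.
  - exact: integrable_real_cst.
  - by apply: integrable_realZ; exact: integrable_score.
  rewrite -EFin_Rintegral; last exact: integrable_exp_score.
  rewrite lee_fin; apply: le_Rintegral => //.
  - apply: integrable_realD; first exact: integrable_real_cst.
    by apply: integrable_realZ; exact: integrable_score.
  - exact: integrable_exp_score.
  - by move=> x _; rewrite dotZl; exact: expR_ge1Dx.
have h2 : l * c <= l * (2 * (l * N)).
  have := le_trans h1 hexp; rewrite expr2; move: (l * c) => t; rewrite -mulrA; lra.
rewrite ler_pM2l// in h2.
have : l * N <= l * (N + 1) by rewrite ler_wpM2l ?(ltW l0)// lerDl.
by move: (l * N) (l * (N + 1)) l1 h2 => *; lra.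
Qed.

(** Each coordinate is one direction; the power mean inequality over the [d] coordinates produces
    the factor [d ^+ q]. *)
Lemma score_norm_moment q :
  (\int[P]_x (enorm (DV x) ^+ (2 * q))%:E <= (d%:R ^+ q * ((2 * q)`!%:R * (2 * expR M)))%:E)%E.
Proof.
have e1 : 1 <= 2 * expR M :> R.
  by have := expR_ge1Dx M; have := M0; lra.
case: q => [|q].
  under eq_integral do rewrite muln0 expr0.
  by rewrite integral_cst// [X in (_ * X)%E]probability_setT mul1e muln0 fact0 expr0 !mul1r lee_fin.
pose e (i : 'I_d) : 'rV[R]_d := delta_mx ord0 i.
pose T (x : 'rV[R]_d) := \sum_i `|dot (e i) (DV x)| ^+ (2 * q.+1).
have ii i := integrable_score_pow (e i) (2 * q.+1).
have iTs (s : seq 'I_d) : P.-integrable setT (EFin \o (fun x => \sum_(i <- s) `|dot (e i) (DV x)| ^+ (2 * q.+1))).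
  elim: s => [|i s IH].
    rewrite (_ : (fun x => _) = (fun=> 0)); first exact: integrable_real_cst.
    by apply/funext => x; rewrite big_nil.
  rewrite (_ : (fun x => _) = (fun x => `|dot (e i) (DV x)| ^+ (2 * q.+1) + \sum_(i <- s) `|dot (e i) (DV x)| ^+ (2 * q.+1))).
    exact: integrable_realD.
  by apply/funext => x; rewrite big_cons.
have hT (s : seq 'I_d) : \int[P]_x (\sum_(i <- s) `|dot (e i) (DV x)| ^+ (2 * q.+1)) <= (size s)%:R * ((2 * q.+1)`!%:R * (2 * expR M)).
  elim: s => [|i s IH].
    under eq_Rintegral do rewrite big_nil.
    by rewrite Rintegral_cst1 mul0r.
  under eq_Rintegral do rewrite big_cons.
  rewrite RintegralD// /= -natr1 mulrDl mul1r addrC; apply: lerD => //.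
  by apply: score_moment; rewrite enorm_delta.
have dT x : enorm (DV x) ^+ (2 * q.+1) <= d%:R ^+ q * T x.
  rewrite exprM sqr_enorm dotE.
  have := @sum_pow_le R _ q (fun i => DV x ord0 i * DV x ord0 i) _; rewrite card_ord.
  move=> /(_ _)/le_trans; apply; first by move=> i; rewrite -expr2 sqr_ge0.
  rewrite ler_wpM2l ?exprn_ge0//; apply: ler_sum => i _.
  by rewrite dotC dot_deltar exprM real_normK ?num_real// expr2.
have iT := iTs (index_enum 'I_d).
apply: (@le_trans _ _ (\int[P]_x (d%:R ^+ q * T x)%:E)%E).
  apply: ge0_le_integral => //.
  - by move=> x _; rewrite lee_fin exprn_ge0.
  - by apply/measurable_EFinP/measurable_funX/measurable_fun_enorm; exact: measurable_gradient.
  - exact: measurable_int (integrable_realZ (d%:R ^+ q) iT).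
  - by move=> x _; rewrite lee_fin.
rewrite -EFin_Rintegral; last exact: integrable_realZ.
rewrite lee_fin RintegralZl// exprSr -mulrA ler_wpM2l ?exprn_ge0//.
have := hT (index_enum 'I_d).
by rewrite (_ : size (index_enum 'I_d) = d) // -[RHS]card_ord cardE enumT.
Qed.

End score_moments.

Section integral_sums.
Context {R : realType} {d} {S : measurableType d} (P : probability S R).

Lemma integrable_real_sum I (r : seq I) (F : I -> S -> R) :
  (forall i, P.-integrable setT (EFin \o F i)) ->
  P.-integrable setT (EFin \o (fun x => \sum_(i <- r) F i x)).
Proof.
move=> iF; elim: r => [|i r IH].
  rewrite (_ : (fun x => _) = (fun=> 0)); first exact: integrable_real_cst.
  by apply/funext => x; rewrite big_nil.
rewrite (_ : (fun x => _) = (fun x => F i x + \sum_(i <- r) F i x)).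
  exact: integrable_realD.
by apply/funext => x; rewrite big_cons.
Qed.

Lemma Rintegral_sum I (r : seq I) (F : I -> S -> R) :
  (forall i, P.-integrable setT (EFin \o F i)) ->
  \int[P]_x (\sum_(i <- r) F i x) = \sum_(i <- r) \int[P]_x F i x.
Proof.
move=> iF; elim: r => [|i r IH].
  by under eq_Rintegral do rewrite big_nil; rewrite Rintegral_cst1 big_nil.
under eq_Rintegral do rewrite big_cons.
by rewrite big_cons RintegralD// ?IH//; exact: integrable_real_sum.
Qed.

End integral_sums.

(** * The mean Hessian and its coercivity *)

Section mean_hessian.
Context {R : realType} {d : nat} (V : 'rV[R]_d -> R) (L M m : R).
Hypotheses (L0 : 0 < L) (M0 : 0 < M) (m0 : 0 < m).
Variable P : probability 'rV[R]_d R.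
Hypothesis PV : has_density P (fun x => expR (- V x)).
Hypothesis A1 : assumption1 V P L M m.

Local Notation DV := (gradient V).
Local Notation HV := (hessian V).

Let V_sc : strictly_convex V. Proof. by case: A1. Qed.
Let V_C2 : twice_continuously_differentiable V. Proof. by case: A1. Qed.
Let V_M : (ereal_sup [set (opnorm (hessian V x))%:E | x in [set: 'rV[R]_d]] <= M%:E)%E.
Proof. by case: A1. Qed.
Let V_L : (ereal_sup
         [set (opnorm (hessian V z.1 - hessian V z.2)
               / enorm (z.1 - z.2))%:E
         | z in [set z : 'rV[R]_d * 'rV[R]_d | z.1 != z.2]] <= L%:E)%E.
Proof. by case: A1. Qed.
Let V_I : loewner_le m%:M (fisher_information V P). Proof. by case: A1. Qed.

Definition mean_hessian : 'M[R]_d := \matrix_(i, j) \int[P]_x HV x i j.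

Lemma dot_mulmx_sum (w u : 'rV[R]_d) (A : 'M[R]_d) :
  dot w (u *m A) = \sum_j \sum_i w ord0 j * u ord0 i * A i j.
Proof.
rewrite dotE; apply: eq_bigr => j _; rewrite mxE mulr_sumr.
by apply: eq_bigr => i _; rewrite mulrA.
Qed.

Lemma hessian_entry_bound x i j : `|HV x i j| <= M.
Proof.
have -> : HV x i j = dot (delta_mx ord0 i *m HV x) (delta_mx ord0 j).
  by rewrite dot_deltar -rowE [RHS]mxE.
apply: (le_trans (normr_dot_le _ _)); rewrite enorm_delta mulr1.
by apply: (le_trans (hessian_bound V_M _ _)); rewrite enorm_delta mulr1.
Qed.

Lemma bounded_measurable_hessian i j : bounded_measurable (fun x => HV x i j).
Proof.
split; first exact: measurable_hessian.
by exists M => x; exact: hessian_entry_bound.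
Qed.

Lemma integrable_hessian_form w u :
  P.-integrable setT (EFin \o (fun x => dot w (u *m HV x))).
Proof.
rewrite (_ : (fun x => _) = (fun x => \sum_j \sum_i w ord0 j * u ord0 i * HV x i j)); last first.
  by apply/funext => x; rewrite dot_mulmx_sum.
do 2 apply: integrable_real_sum => ?.
exact/integrable_realZ/bounded_measurable_integrable/bounded_measurable_hessian.
Qed.

Lemma mean_hessian_dot w u : dot w (u *m mean_hessian) = \int[P]_x dot w (u *m HV x).
Proof.
under eq_Rintegral do rewrite dot_mulmx_sum.
have ih j i : P.-integrable setT (EFin \o (fun x => w ord0 j * u ord0 i * HV x i j)).
  exact/integrable_realZ/bounded_measurable_integrable/bounded_measurable_hessian.
rewrite Rintegral_sum => [|j]; last by apply: integrable_real_sum => i; exact: ih.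
rewrite dot_mulmx_sum; apply: eq_bigr => j _; rewrite Rintegral_sum => [|i]; last exact: ih.
apply: eq_bigr => i _; rewrite RintegralZl//; last first.
  exact/bounded_measurable_integrable/bounded_measurable_hessian.
by rewrite mxE.
Qed.

Lemma mean_hessian_bound u : enorm (u *m mean_hessian) <= M * enorm u.
Proof.
apply: enorm_le_dot => [|w w1]; first by rewrite mulr_ge0// ltW.
rewrite mean_hessian_dot -[leRHS](Rintegral_cst1 P); apply: le_Rintegral => //.
- exact: integrable_hessian_form.
- exact: integrable_real_cst.
- move=> x _; apply: (le_trans (dot_le _ _)); rewrite -[leRHS]mul1r.
  by apply: ler_pM => //; exact: hessian_bound.
Qed.

Lemma fisher_lower u : m * enorm u ^+ 2 <= \int[P]_x (`|dot u (DV x)| ^+ 2).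
Proof.
have := V_I u; rewrite mulmx_dot mulmxBr dotBl subr_ge0 mul_mx_scalar dotZl -sqr_enorm.
move=> /le_trans; apply; rewrite dotC dot_mulmx_sum.
have ic i j : P.-integrable setT (EFin \o (fun x => u ord0 j * u ord0 i * (DV x ord0 i * DV x ord0 j))).
  apply: integrable_realZ.
  have mc k : measurable_fun setT (fun x => DV x ord0 k).
    by apply: measurable_fun_coord; exact: measurable_gradient.
  pose e k : 'rV[R]_d := delta_mx ord0 k.
  apply: (@integrable_dominated _ _ _ _ _ (fun x => `|dot (e i) (DV x)| ^+ 2 + `|dot (e j) (DV x)| ^+ 2)).
  - exact: measurable_funM.
  - move=> x; rewrite !(dotC (e _)) !dot_deltar normrM.
    move: (`|DV x ord0 i|) (`|DV x ord0 j|) => a b.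
    by have := sqr_ge0 (a - b); have := sqr_ge0 (a + b); rewrite sqrrB sqrrD; lra.
  - by apply: integrable_realD; apply: (integrable_score_pow M0 V_C2 V_M PV).
rewrite [leRHS](_ : _ = \int[P]_x (\sum_j \sum_i u ord0 j * u ord0 i * (DV x ord0 i * DV x ord0 j))); last first.
  apply: eq_Rintegral => x _; rewrite real_normK ?num_real// dotE expr2 mulr_suml.
  apply: eq_bigr => j _; rewrite mulr_sumr; apply: eq_bigr => i _; ring.
rewrite Rintegral_sum => [|j]; last by apply: integrable_real_sum => i; exact: ic.
apply: ler_sum => j _; rewrite Rintegral_sum => [|i]; last exact: ic.
apply: ler_sum => i _; rewrite mxE unlock.
(* Integrability is known for the weighted product, and removing the weight requires it to be
   nonzero. *)
have [->|uji] := eqVneq (u ord0 j * u ord0 i) 0.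
  by under eq_Rintegral do rewrite mul0r; rewrite Rintegral_cst1 mul0r.
rewrite RintegralZl//.
have := integrable_realZ ((u ord0 j * u ord0 i)^-1) (ic i j).
by rewrite (_ : (fun x => _) = (fun x => DV x ord0 i * DV x ord0 j))//;
  apply/funext => x; rewrite mulKf.
Qed.

(** A shift of the argument becomes the likelihood ratio of the shifted and the original density. *)
Lemma ge0_integral_shift_density (g : 'rV[R]_d -> R) u :
  measurable_fun setT g -> (forall x, 0 <= g x) ->
  (\int[P]_x (g (x + u))%:E = \int[P]_x (g x * expR (V x - V (x - u)))%:E)%E.
Proof.
move=> mg g0.
have mp := measurable_density V_C2.
have me : measurable_fun [set: 'rV[R]_d] (fun x => g x * expR (V x - V (x - u))).
  apply: measurable_funM => //; apply: measurableT_comp => //; apply: measurable_funB.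
    exact: measurable_V.
  exact: (measurable_comp_shift (- u) (measurable_V V_C2)).
have p0 x : 0 <= expR (- V x) by exact: expR_ge0.
rewrite !(ge0_integral_density PV mp p0)//; last 4 first.
- exact/measurable_EFinP.
- by move=> x; rewrite lee_fin mulr_ge0 ?expR_ge0.
- by apply/measurable_EFinP; exact: (measurable_comp_shift u mg).
- by move=> x; rewrite lee_fin.
have := @integral_row_shift _ d u (fun x => (g x * expR (- V (x - u)))%:E).
under eq_integral do rewrite addrK.
under [X in _ = X]eq_integral => x _.
  have -> : (g x * expR (- V (x - u)) = g x * expR (V x - V (x - u)) * expR (- V x))%R.
    by rewrite -mulrA -expRD; congr (_ * expR _); rewrite addrAC subrr add0r.
  rewrite EFinM; over.
under eq_integral do rewrite EFinM.
apply.
- apply/measurable_EFinP; apply: measurable_funM => //.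
  exact: (measurable_comp_shift (- u) mp).
- by move=> x; rewrite lee_fin mulr_ge0 ?expR_ge0.
Qed.

(* Differentiate E<u, DV(xi + t u)> at t = 0 in two ways: inside the expectation
   it gives E HV, moving the shift onto the density it gives E DV (x) DV. *)
Lemma mean_hessian_coercive u : m * enorm u ^+ 2 <= dot (u *m mean_hessian) u.
Proof.
rewrite dotC; apply: (le_trans (fisher_lower u)).
set S := \int[P]_x _; set h := dot u _.
pose a x := dot u (DV x).
set N := enorm u.
pose b x := M * N ^+ 2 * `|a x| + `|a x| ^+ 3.
have ma : measurable_fun [set: 'rV[R]_d] a by exact: measurable_score.
have ian n : P.-integrable setT (EFin \o (fun x => `|a x| ^+ n)).
  exact: (integrable_score_pow M0 V_C2 V_M PV).
have iabs : P.-integrable setT (EFin \o (fun x => `|a x|)).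
  have := ian 1%N; rewrite (_ : (fun x => _) = (fun x => `|a x|))//.
have ib : P.-integrable setT (EFin \o b).
  by apply: integrable_realD => //; exact: integrable_realZ.
have mean0 : \int[P]_x a x = 0 by apply: (score_mean0 M0 V_C2 V_M PV).
have ia : P.-integrable setT (EFin \o a) by apply: (integrable_score M0 V_C2 V_M PV).
set K := \int[P]_x b x.
have N0 : 0 <= N by exact: enorm_ge0.
(* Dividing by [t] and letting it tend to 0 gives the claim, so only the first order in [t] has to
   be exact. *)
suff key t : 0 < t -> t * S <= t * h + t ^+ 2 * (L * N ^+ 3 + K).
  apply/ler_addgt0Pr => e e0.
  set D := `|L * N ^+ 3 + K| + 1.
  have D0 : 0 < D by rewrite ltr_wpDl.
  have t0 : 0 < e / D by rewrite divr_gt0.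
  have := key _ t0; rewrite expr2 -mulrA -mulrDr ler_pM2l// => /le_trans; apply.
  rewrite lerD2l mulrAC ler_pdivrMr// ler_pM2l//; apply: le_trans (ler_norm _) _.
  by rewrite lerDl.
move=> t0.
(* The change of density is stated for nonnegative functions, hence the split into positive and
   negative parts. *)
pose ap x := Num.max (a x) 0; pose an x := Num.max (- a x) 0.
have aE x : a x = ap x - an x.
  rewrite /ap /an; case: (leP 0 (a x)) => ax.
    by rewrite max_r ?subr0// oppr_le0.
  by rewrite max_l ?sub0r ?opprK// oppr_ge0 ltW.
have ap0 x : 0 <= ap x by rewrite le_max lexx orbT.
have an0 x : 0 <= an x by rewrite le_max lexx orbT.
have apa x : ap x <= `|a x| by rewrite ge_max ler_norm normr_ge0.
have ana x : an x <= `|a x| by rewrite ge_max -normrN ler_norm normr_ge0.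
have map : measurable_fun setT ap by exact: measurable_maxr.
have man : measurable_fun setT an by apply: measurable_maxr => //; exact: measurableT_comp.
pose y x := V x - V (x - t *: u).
have y_up x : y x <= t * a x.
  have := gradient_ineq M0 V_sc V_C2 V_M x (- (t *: u)); rewrite dotNl dotZl /y -/(a x).
  by move: (V x) (V _) (t * a x) => *; lra.
have y_lo x : t * a x - M * t ^+ 2 * N ^+ 2 <= y x.
  have := V_upper M0 V_C2 V_M x (- (t *: u)).
  rewrite dotNl dotZl enormN enormZ gtr0_norm// exprMn mulrA /y -/(a x) -/N.
  by move: (V x) (V _) (t * a x) (M * _ * _) => *; lra.
(* The positive part needs a lower bound of the likelihood ratio, given by [expR_ge1Dx]. The
   negative part needs an upper bound; it lives where [a x] is nonpositive, which is the range of
   [expR_le_quad]. *)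
pose lo x := ap x * (1 + t * a x - M * t ^+ 2 * N ^+ 2).
pose hi x := an x * (1 + t * a x + t ^+ 2 * a x ^+ 2).
have lo_le x : lo x <= ap x * expR (y x).
  rewrite ler_wpM2l//; apply: le_trans (expR_ge1Dx (y x)).
  by rewrite -addrA lerD2l; exact: y_lo.
have hi_ge x : an x * expR (y x) <= hi x.
  have [a0|a0] := leP 0 (a x).
    by rewrite /hi /an max_r ?oppr_le0// !mul0r.
  rewrite ler_wpM2l//; apply: (@le_trans _ _ (expR (t * a x))).
    by rewrite ler_expR.
  rewrite -exprMn; apply: expR_le_quad; rewrite mulr_ge0_le0 ?ltW//.
have ishift (g : 'rV[R]_d -> R) : measurable_fun setT g -> (forall x, 0 <= g x) ->
    (forall x, g x <= `|a x|) -> P.-integrable setT (EFin \o (fun x => g (x + t *: u))).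
  move=> mg g0 ga.
  apply: (@integrable_dominated _ _ _ _ _ (fun x => `|a x| + N * (M * (t * N)))).
  - exact: (measurable_comp_shift _ mg).
  - move=> x; rewrite ger0_norm//; apply: (le_trans (ga _)).
    rewrite -lerBlDl; apply: (le_trans (lerB_dist _ _)); rewrite /a -dotBr.
    apply: (le_trans (normr_dot_le _ _)); rewrite ler_wpM2l//.
    apply: (le_trans (gradient_lip M0 V_C2 V_M _ _)).
    by rewrite enormZ gtr0_norm.
  - by apply: integrable_realD => //; exact: integrable_real_cst.
have rs (g : 'rV[R]_d -> R) : measurable_fun setT g -> (forall x, 0 <= g x) ->
    (forall x, g x <= `|a x|) ->
    P.-integrable setT (EFin \o (fun x => g x * expR (y x))) /\
    \int[P]_x g (x + t *: u) = \int[P]_x (g x * expR (y x)).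
  move=> mg g0 ga; have ig := ishift _ mg g0 ga.
  have e := ge0_integral_shift_density (t *: u) mg g0.
  split; last by rewrite /Rintegral e.
  apply: (@ge0_integrable _ _ _ _ _ (\int[P]_x g (x + t *: u))).
  - apply: measurable_funM => //; apply: measurableT_comp => //; apply: measurable_funB.
      exact: measurable_V.
    exact: (measurable_comp_shift (- (t *: u)) (measurable_V V_C2)).
  - by move=> x; rewrite mulr_ge0 ?expR_ge0.
  - by rewrite EFin_Rintegral// e.
have [ipe ep] := rs _ map ap0 apa.
have [ine en] := rs _ man an0 ana.
have idom (g : 'rV[R]_d -> R) (c : R) : measurable_fun setT g ->
    (forall x, `|g x| <= c * (1 + `|a x| ^+ 3)) -> P.-integrable setT (EFin \o g).
  move=> mg gc; apply: (integrable_dominated mg gc); apply: integrable_realZ.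
  by apply: integrable_realD => //; exact: integrable_real_cst.
have p1 (z : R) : 0 <= z -> z <= 1 + z ^+ 3.
  move=> z0; have [z1|z1] := leP z 1; first by have := exprn_ge0 3 z0; lra.
  by have : z <= z ^+ 3 by [rewrite -[leLHS]expr1; apply: ler_weXn2l => //; exact: ltW]; lra.
have p2 (z : R) : 0 <= z -> z ^+ 2 <= 1 + z ^+ 3.
  move=> z0; have [z1|z1] := leP z 1; first by have := exprn_ge0 3 z0; have := exprn_ile1 2 z0 z1; lra.
  by have : z ^+ 2 <= z ^+ 3 by [apply: ler_weXn2l => //; exact: ltW]; lra.
set c := M * t ^+ 2 * N ^+ 2 in lo lo_le y_lo.
have c0 : 0 <= c by rewrite !mulr_ge0 ?sqr_ge0// ltW.
have ilo : P.-integrable setT (EFin \o lo).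
  apply: (idom _ (1 + t + c)).
    by apply: measurable_funM => //; apply: measurable_funB => //; apply: measurable_funD => //; exact: measurable_funM.
  move=> x; rewrite normrM (ger0_norm (ap0 x)).
  apply: (@le_trans _ _ (`|a x| * (1 + t * `|a x| + c))).
    apply: ler_pM => //; apply: (le_trans (ler_normB _ _)); rewrite (ger0_norm c0) lerD2r.
    by apply: (le_trans (ler_normD _ _)); rewrite normr1 normrM (gtr0_norm t0).
  have := p1 _ (normr_ge0 (a x)); have := p2 _ (normr_ge0 (a x)).
  set z := `|a x| => h2 h1.
  have -> : z * (1 + t * z + c) = z + t * z ^+ 2 + c * z by ring.
  rewrite !mulrDl mul1r; apply: lerD; last by rewrite ler_wpM2l.
  by apply: lerD => //; rewrite ler_wpM2l// ltW.
have ihi : P.-integrable setT (EFin \o hi).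
  apply: (idom _ (1 + t + t ^+ 2)).
    apply: measurable_funM => //; apply: measurable_funD; first by apply: measurable_funD => //; exact: measurable_funM.
    by apply: measurable_funM => //; exact: measurable_funX.
  move=> x; rewrite normrM (ger0_norm (an0 x)).
  apply: (@le_trans _ _ (`|a x| * (1 + t * `|a x| + t ^+ 2 * `|a x| ^+ 2))).
    apply: ler_pM => //; apply: (le_trans (ler_normD _ _)).
    rewrite normrM !normrX (gtr0_norm t0) lerD2r.
    by apply: (le_trans (ler_normD _ _)); rewrite normr1 normrM (gtr0_norm t0).
  have := p1 _ (normr_ge0 (a x)); have := p2 _ (normr_ge0 (a x)).
  set z := `|a x| => h2 h1.
  have -> : z * (1 + t * z + t ^+ 2 * z ^+ 2) = z + t * z ^+ 2 + t ^+ 2 * z ^+ 3 by ring.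
  rewrite !mulrDl mul1r; apply: lerD; last by rewrite ler_wpM2l ?sqr_ge0// lerDr.
  by apply: lerD => //; rewrite ler_wpM2l// ltW.
have low : t * S - t ^+ 2 * K <= \int[P]_x ap (x + t *: u) - \int[P]_x an (x + t *: u).
  have h1 : \int[P]_x lo x <= \int[P]_x ap (x + t *: u) by rewrite ep; exact: le_Rintegral.
  have h2 : \int[P]_x an (x + t *: u) <= \int[P]_x hi x by rewrite en; exact: le_Rintegral.
  have h3 : \int[P]_x (a x + t * `|a x| ^+ 2 + (- t ^+ 2) * b x) <= \int[P]_x (lo x - hi x).
    apply: le_Rintegral => //.
    - apply: integrable_realD; last exact: integrable_realZ.
      by apply: integrable_realD => //; exact: integrable_realZ.
    - have := integrable_realD ilo (integrable_realZ (-1) ihi).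
      by rewrite (_ : (fun x => _) = (fun x => lo x - hi x))//; apply/funext => x; rewrite mulN1r.
    - move=> x _; rewrite real_normK ?num_real//.
      have e1 : lo x - hi x = a x + t * a x ^+ 2 - (c * ap x + t ^+ 2 * (an x * a x ^+ 2)).
        by rewrite /lo /hi {1 3}aE; have := aE x; move: (ap x) (an x) (a x) => p' n' a' ->; ring.
      rewrite e1 mulNr lerD2l lerN2 /b mulrDr; apply: lerD.
        have -> : t ^+ 2 * (M * N ^+ 2 * `|a x|) = c * `|a x| by rewrite /c; ring.
        by rewrite ler_wpM2l.
      rewrite ler_wpM2l ?sqr_ge0// -(real_normK (num_real (a x))) [leRHS]exprS.
      by rewrite ler_wpM2r// exprn_ge0.
  rewrite RintegralB// in h3; rewrite RintegralD// in h3; last 2 first.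
  - by apply: integrable_realD => //; exact: integrable_realZ.
  - exact: integrable_realZ.
  rewrite RintegralD// in h3; last exact: integrable_realZ.
  rewrite RintegralZl// in h3; rewrite RintegralZl// mean0 add0r mulNr in h3.
  by move: h1 h2 h3; rewrite -/S -/K; move: (\int[P]_x lo x) (\int[P]_x hi x) => *; lra.
have up : \int[P]_x ap (x + t *: u) - \int[P]_x an (x + t *: u) <= t * h + t ^+ 2 * (L * N ^+ 3).
  rewrite -RintegralB//; [|exact: ishift..].
  have ih := integrable_hessian_form u u.
  have -> : t * h + t ^+ 2 * (L * N ^+ 3) =
      \int[P]_x (a x + t * dot u (u *m HV x) + t ^+ 2 * (L * N ^+ 3)).
    rewrite RintegralD//; last 2 first.
    - by apply: integrable_realD => //; exact: integrable_realZ.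
    - exact: integrable_real_cst.
    rewrite RintegralD//; last exact: integrable_realZ.
    by rewrite RintegralZl// Rintegral_cst1 mean0 add0r /h mean_hessian_dot.
  apply: le_Rintegral => //.
  - have := integrable_realD (ishift _ map ap0 apa) (integrable_realZ (-1) (ishift _ man an0 ana)).
    by rewrite (_ : (fun x => _) = (fun x => ap (x + t *: u) - an (x + t *: u)))//; apply/funext => x; rewrite mulN1r.
  - apply: integrable_realD; last exact: integrable_real_cst.
    by apply: integrable_realD => //; exact: integrable_realZ.
  - move=> x _; rewrite -aE.
    have := gradient_taylor L0 V_C2 V_L x (t *: u).
    rewrite enormZ gtr0_norm// -scalemxAl => h1.
    have dot3 (w p q r : 'rV[R]_d) (t' : R) : dot w (p - q - t' *: r) = dot w p - dot w q - t' * dot w r.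
      by rewrite dotBr dotBr dotZr.
    have eN : N * (L * (t * N) ^+ 2) = t ^+ 2 * (L * N ^+ 3) by ring.
    have hh : dot u (DV (x + t *: u) - DV x - t *: (u *m HV x)) <= N * (L * (t * N) ^+ 2).
      by apply: (le_trans (dot_le _ _)); rewrite ler_wpM2l.
    rewrite eN dot3 in hh.
    have aux (p q r s : R) : p - q - r <= s -> p <= q + r + s.
      by rewrite !lerBlDl addrA.
    exact: aux hh.
have aux (p q r s t1 : R) : p - q <= r -> r <= s + t1 -> p <= s + (t1 + q).
  by move=> h1 h2; have := le_trans h1 h2; rewrite lerBlDr addrA.
by rewrite [t ^+ 2 * (_ + K)]mulrDr; exact: aux low up.
Qed.

End mean_hessian.

(** * Moments of the empirical score and Hessian *)

Section sample_moments.
Context {R : realType}.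

Definition score_mean {d n} (V : 'rV[R]_d -> R) (x : 'I_n -> 'rV[R]_d) : 'rV[R]_d :=
  n%:R^-1 *: \sum_(j < n) gradient V (x j).

Definition hessian_dev {d n} (V : 'rV[R]_d -> R) (P : probability 'rV[R]_d R)
    (x : 'I_n -> 'rV[R]_d) : 'M[R]_d :=
  n%:R^-1 *: \sum_(j < n) (hessian V (x j) - mean_hessian V P).

(** [b] is a squared scale, of order [d] in both uses, so the mean of [n] observations has squared
    scale [b / n]. *)
Lemma rosenthal_mean (p : nat) : exists2 K : R, 0 <= K &
  forall dT (T : measurableType dT) n (P : probability T R) (Q : probability (n.-tuple T) R),
  (0 < n)%N -> iid_law P Q -> forall N (Y : T -> 'rV[R]_N) (b : R),
  measurable_fun [set: T] Y -> 0 <= b ->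
  (forall u, \int[P]_y dot u (Y y) = 0) ->
  (forall q, (q <= p)%N -> (\int[P]_y (enorm (Y y) ^+ (2 * q))%:E <= (b ^+ q)%:E)%E) ->
  (\int[Q]_x (enorm (n%:R^-1 *: \sum_(j < n) Y (tnth x j)) ^+ (2 * p))%:E
    <= (K * (b / n%:R) ^+ p)%:E)%E.
Proof.
have [K K0 hK] := @rosenthal R p; exists K => // dT T n P Q n0 QP N Y b mY b0 Y0 YB.
have nn : 0 < n%:R :> R by rewrite ltr0n.
have sq q : Num.sqrt b ^+ (2 * q) = b ^+ q by rewrite exprM sqr_sqrtr.
have := hK _ _ _ _ _ QP _ _ (Num.sqrt b) mY (sqrtr_ge0 _) Y0 _ (index_enum 'I_n) (index_enum_uniq _).
move=> /(_ _)/wrap[q qp|]; first by rewrite sq; exact: YB.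
have -> : size (index_enum 'I_n) = n by rewrite -[RHS]card_ord cardE enumT.
rewrite sq => h.
under eq_integral => x _.
  rewrite enormZ ger0_norm ?invr_ge0// exprMn EFinM; over.
have c0 : 0 <= n%:R^-1 ^+ (2 * p) :> R by rewrite exprn_ge0// invr_ge0.
rewrite ge0_integralZl_EFin//.
- apply: (le_trans (lee_wpmul2l _ h)); first by rewrite lee_fin.
  rewrite -EFinM lee_fin le_eqVlt; apply/orP; left; apply/eqP.
  rewrite exprMn exprM expr2 exprMn.
  have : n%:R^-1 ^+ p * n%:R ^+ p = 1 :> R by rewrite -exprMn mulVf ?expr1n// gt_eqF.
  move: (n%:R^-1 ^+ p) (n%:R ^+ p) (b ^+ p) => u v w uv.
  have -> : u * u * (K * v * w) = (u * v) * (K * w * u) by ring.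
  by rewrite uv; ring.
- by move=> x _; rewrite lee_fin exprn_ge0.
- apply/measurable_EFinP/measurable_funX/measurable_fun_enorm/measurable_fun_row_sum => j.
  exact: (measurableT_comp mY (measurable_tnth j)).
Qed.

Lemma score_mean_moment (L M m : R) (p : nat) : 0 < L -> 0 < M -> exists2 C : R, 0 <= C &
  forall d n (V : 'rV[R]_d -> R) (P : probability 'rV[R]_d R) (Q : probability (n.-tuple 'rV[R]_d) R),
  has_density P (fun x => expR (- V x)) -> assumption1 V P L M m ->
  (0 < n)%N -> iid_law P Q ->
  (\int[Q]_x (enorm (score_mean V (tnth x)) ^+ (2 * p))%:E <= (C * (d%:R / n%:R) ^+ p)%:E)%E.
Proof.
move=> L0 M0; have [K K0 hK] := rosenthal_mean p.
(* Dominating the factorials of all lower orders and being at least 1, this single constant serves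
   for every moment up to [2 * p]. *)
pose c := (2 * p)`!%:R * (2 * expR M) : R.
have e1 : 1 <= 2 * expR M :> R by have := expR_ge1Dx M; have := M0; lra.
have c1 : 1 <= c.
  by rewrite -[leLHS]mul1r ler_pM// ler1n fact_gt0.
have c0 : 0 <= c by apply: le_trans c1.
exists (K * c ^+ p) => [|d n V P Q PV A1 n0 QP]; first by rewrite mulr_ge0// exprn_ge0.
have [V_sc V_C2 V_M V_L V_I] := A1.
have := hK _ _ n P Q n0 QP d (gradient V) (c * d%:R) (measurable_gradient V_C2) (mulr_ge0 c0 (ler0n _ _))
  (score_mean0 M0 V_C2 V_M PV).
move=> /(_ _)/wrap[q qp|]; last by rewrite -[c * _ / _]mulrA exprMn mulrA.
case: q qp => [_|q qp].
  under eq_integral do rewrite muln0 expr0.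
  by rewrite integral_cst// [X in (_ * X)%E]probability_setT mul1e expr0.
apply: (le_trans (score_norm_moment M0 V_C2 V_M PV q.+1)).
rewrite lee_fin exprMn mulrC ler_wpM2r ?exprn_ge0//.
apply: (@le_trans _ _ c); last by rewrite exprS ler_peMr// exprn_ege1.
rewrite /c ler_wpM2r; first by [].
  by apply: le_trans e1.
by rewrite ler_nat; apply: leq_fact; rewrite leq_mul2l qp orbT.
Qed.

(** The centred Hessian is read as a vector with [d * d] entries, whose squared norm is at most
    [d * (2 * M) ^+ 2]. It is essential that the moment inequality does not see the number of
    entries. *)
Lemma hessian_dev_moment (L M m : R) (p : nat) : 0 < L -> 0 < M -> exists2 C : R, 0 <= C &
  forall d n (V : 'rV[R]_d -> R) (P : probability 'rV[R]_d R) (Q : probability (n.-tuple 'rV[R]_d) R),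
  has_density P (fun x => expR (- V x)) -> assumption1 V P L M m ->
  (0 < n)%N -> iid_law P Q ->
  (\int[Q]_x (fnorm (hessian_dev V P (tnth x)) ^+ (2 * p))%:E <= (C * (d%:R / n%:R) ^+ p)%:E)%E.
Proof.
move=> L0 M0; have [K K0 hK] := rosenthal_mean p.
exists (K * (4 * M ^+ 2) ^+ p) => [|d n V P Q PV A1 n0 QP].
  by rewrite mulr_ge0// exprn_ge0// mulr_ge0// sqr_ge0.
have [V_sc V_C2 V_M V_L V_I] := A1.
pose Y x := mxvec (hessian V x - mean_hessian V P).
have Yent x i j : Y x ord0 (mxvec_index i j) = hessian V x i j - mean_hessian V P i j.
  by rewrite /Y mxvecE mxE [X in _ + X]mxE.
have bm i j : bounded_measurable (fun x => hessian V x i j - mean_hessian V P i j).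
  apply: bounded_measurableB; last exact: bounded_measurable_cst.
  exact: (bounded_measurable_hessian A1).
have mY : measurable_fun setT Y.
  apply: measurable_fun_row => k; case/mxvec_indexP: k => i j.
  rewrite (_ : _ \o _ = fun x => hessian V x i j - mean_hessian V P i j).
    by have [] := bm i j.
  by apply/funext => x; rewrite /= /row_coord Yent.
have b0 : 0 <= d%:R * (2 * M) ^+ 2 :> R by rewrite mulr_ge0// sqr_ge0.
have Y0 u : \int[P]_y dot u (Y y) = 0.
  under eq_Rintegral do rewrite dotE.
  have ic k : P.-integrable setT (EFin \o (fun x => u ord0 k * Y x ord0 k)).
    apply: integrable_realZ; case/mxvec_indexP: k => i j.
    rewrite (_ : (fun x => _) = fun x => hessian V x i j - mean_hessian V P i j).
      exact: bounded_measurable_integrable.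
    by apply/funext => x; rewrite Yent.
  rewrite Rintegral_sum//; apply: big1 => k _.
  case/mxvec_indexP: k => i j; under eq_Rintegral do rewrite Yent.
  rewrite RintegralZl//; last exact: bounded_measurable_integrable.
  have ih := bounded_measurable_integrable P (bounded_measurable_hessian A1 i j).
  rewrite RintegralB//; last exact: integrable_real_cst.
  by rewrite Rintegral_cst1 [X in _ - X]mxE subrr mulr0.
have YB x : enorm (Y x) ^+ 2 <= d%:R * (2 * M) ^+ 2.
  apply: (@fnorm_le_opnorm _ _ (hessian V x - mean_hessian V P)); first by rewrite mulr_ge0// ltW.
  move=> u; rewrite mulmxBr; apply: (le_trans (ler_enormB _ _)).
  rewrite mulr2n mulrDl mul1r mulrDl; apply: lerD; first exact: hessian_bound.
  exact: (mean_hessian_bound M0 A1).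
have := hK _ _ n P Q n0 QP _ Y _ mY b0 Y0.
move=> /(_ _)/wrap[q qp|].
  apply: (@le_trans _ _ (\int[P]_y ((d%:R * (2 * M) ^+ 2) ^+ q)%:E)%E).
    apply: ge0_le_integral => //.
    - by move=> y _; rewrite lee_fin exprn_ge0.
    - by apply/measurable_EFinP/measurable_funX/measurable_fun_enorm.
    - by move=> y _; rewrite lee_fin exprM lerXn2r ?nnegrE ?exprn_ge0.
  by rewrite integral_cst// [X in (_ * X)%E]probability_setT mule1.
rewrite (_ : K * (d%:R * (2 * M) ^+ 2 / n%:R) ^+ p = K * (4 * M ^+ 2) ^+ p * (d%:R / n%:R) ^+ p); last first.
  by rewrite -[RHS]mulrA -exprMn; congr (_ * _ ^+ _); ring.
apply: le_trans; rewrite le_eqVlt; apply/orP; left; apply/eqP; apply: eq_integral => x _.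
by rewrite fnormE /hessian_dev linearZ linear_sum.
Qed.

End sample_moments.

(** * Deterministic analysis of good samples *)

Section good_samples.
Context {R : realType} {d : nat} (V : 'rV[R]_d -> R) (L M m : R).
Hypotheses (L0 : 0 < L) (M0 : 0 < M) (m0 : 0 < m).
Variable P : probability 'rV[R]_d R.
Hypothesis PV : has_density P (fun x => expR (- V x)).
Hypothesis A1 : assumption1 V P L M m.
Hypothesis V_nrec : forall u,
  (forall x t, 0 <= t -> V (x + t *: u) <= V x) -> u = 0.

Local Notation DV := (gradient V).
Local Notation HV := (hessian V).
Local Notation H := (mean_hessian V P).

Let V_sc : strictly_convex V. Proof. by case: A1. Qed.
Let V_C2 : twice_continuously_differentiable V. Proof. by case: A1. Qed.
Let V_M : (ereal_sup [set (opnorm (hessian V x))%:E | x in [set: 'rV[R]_d]] <= M%:E)%E.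
Proof. by case: A1. Qed.
Let V_L : (ereal_sup
         [set (opnorm (hessian V z.1 - hessian V z.2)
               / enorm (z.1 - z.2))%:E
         | z in [set z : 'rV[R]_d * 'rV[R]_d | z.1 != z.2]] <= L%:E)%E.
Proof. by case: A1. Qed.

(* On the ball of radius rad the empirical Hessian moves by at most m / 16. *)
Definition rad : R := m / (16 * L).

Lemma rad_gt0 : 0 < rad. Proof. by rewrite divr_gt0// mulr_gt0. Qed.

Lemma L_rad : L * rad = m / 16.
Proof. by rewrite /rad; field; rewrite gt_eqF. Qed.

Context {n : nat}.
Hypothesis n0 : (0 < n)%N.
Implicit Types x : 'I_n -> 'rV[R]_d.

Let nn : 0 < n%:R :> R. Proof. by rewrite ltr0n. Qed.
Let ni0 : 0 <= (n%:R : R)^-1. Proof. by rewrite invr_ge0. Qed.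

(** Since the parameter enters as [x j - t], [hessian_at] is minus the derivative of [score_at] in
    [t], up to transposition. *)
Definition score_at x t : 'rV[R]_d := n%:R^-1 *: \sum_(j < n) DV (x j - t).
Definition hessian_at x t : 'M[R]_d := n%:R^-1 *: \sum_(j < n) HV (x j - t).

(** The Hessian threshold leaves [m - m / 8 - m / 16], more than [3 / 4 * m], of the curvature on
    the ball of radius [rad]. The score threshold is half of what would let the estimator reach that
    radius. *)
Definition good x : Prop :=
  enorm (score_mean V x) <= m * rad / 4 /\ fnorm (hessian_dev V P x) <= m / 8.

Lemma enorm_mean_le (F : 'I_n -> 'rV[R]_d) (c : R) : (forall j, enorm (F j) <= c) ->
  enorm (n%:R^-1 *: \sum_(j < n) F j) <= c.
Proof.
move=> Fc; rewrite enormZ ger0_norm// -[leRHS](mean_cst n0) ler_wpM2l//.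
by apply: (le_trans (enorm_sum _ _ _)); exact: ler_sum.
Qed.

Lemma mean_at0 (T : zmodType) (U : lmodType R) (F : T -> U) (x : 'I_n -> T) :
  n%:R^-1 *: \sum_(j < n) F (x j - 0) = n%:R^-1 *: \sum_(j < n) F (x j).
Proof. by under eq_bigr do rewrite subr0. Qed.

Lemma score_at0 x : score_at x 0 = score_mean V x.
Proof. exact: mean_at0. Qed.

Lemma score_at_mle x : score_at x (mle V x) = 0.
Proof. by rewrite /score_at (mle_score M0 V_sc V_C2 V_M V_nrec n0) scaler0. Qed.

Lemma mean_subr (U : lmodType R) (F : 'I_n -> U) (u : U) :
  n%:R^-1 *: \sum_(j < n) (F j - u) = n%:R^-1 *: \sum_(j < n) F j - u.
Proof.
rewrite sumrB scalerBr sumr_const card_ord -[u *+ n]scaler_nat scalerA.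
by rewrite mulVf ?gt_eqF// scale1r.
Qed.

Lemma hessian_at0 x : hessian_at x 0 = H + hessian_dev V P x.
Proof.
rewrite /hessian_dev mean_subr addrC subrK; exact: mean_at0.
Qed.

Lemma mulmx_mean (u : 'rV[R]_d) (F : 'I_n -> 'M[R]_d) :
  u *m (n%:R^-1 *: \sum_(j < n) F j) = n%:R^-1 *: \sum_(j < n) u *m F j.
Proof. by rewrite -scalemxAr mulmx_sumr. Qed.

Lemma score_at_taylor x t h :
  enorm (score_at x (t + h) - score_at x t + h *m hessian_at x t) <= L * enorm h ^+ 2.
Proof.
rewrite /score_at /hessian_at mulmx_mean -scalerBr -scalerDr -sumrB -big_split /=.
apply: enorm_mean_le => j; have := gradient_taylor L0 V_C2 V_L (x j - t) (- h).
by rewrite enormN mulNmx opprK opprD addrA.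
Qed.

Lemma hessian_at_lip x t u :
  enorm (u *m (hessian_at x t - hessian_at x 0)) <= L * enorm t * enorm u.
Proof.
rewrite /hessian_at -scalerBr -sumrB mulmx_mean; apply: enorm_mean_le => j.
apply: (le_trans (hessian_lip V_L _ _ _)).
by rewrite subr0 [x j - t]addrC addrK enormN.
Qed.

Lemma hessian_at_coercive x t u : fnorm (hessian_dev V P x) <= m / 8 -> enorm t <= rad ->
  3 / 4 * m * enorm u ^+ 2 <= dot (u *m hessian_at x t) u.
Proof.
move=> xW tr.
have e : u *m hessian_at x t = u *m H + u *m hessian_dev V P x + u *m (hessian_at x t - hessian_at x 0).
  by rewrite mulmxBr hessian_at0 mulmxDr addrC subrK.
rewrite e !dotDl.
have h1 := mean_hessian_coercive L0 M0 PV A1 u.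
have h2 : `|dot (u *m hessian_dev V P x) u| <= m / 8 * enorm u ^+ 2.
  apply: (le_trans (normr_dot_le _ _)); rewrite expr2 mulrA ler_wpM2r//.
  by apply: (le_trans (enorm_mulmx_fnorm _ _)); rewrite mulrC ler_wpM2r.
have h3 : `|dot (u *m (hessian_at x t - hessian_at x 0)) u| <= m / 16 * enorm u ^+ 2.
  apply: (le_trans (normr_dot_le _ _)); rewrite expr2 mulrA ler_wpM2r//.
  apply: (le_trans (hessian_at_lip _ _ _)); rewrite ler_wpM2r// -L_rad.
  by rewrite ler_wpM2l// ltW.
move: h1 h2 h3; rewrite !ler_norml => h1 /andP[h2 _] /andP[h3 _].
have t0 : 0 <= m * enorm u ^+ 2 by rewrite mulr_ge0 ?sqr_ge0// ltW.
have aux (a b c s : R) : s <= a -> - (s / 8) <= b -> - (s / 16) <= c -> 0 <= s -> 3 / 4 * s <= a + b + c.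
  by move=> *; lra.
rewrite -mulrA; rewrite [m / 8 * _]mulrAC in h2; rewrite [m / 16 * _]mulrAC in h3.
exact: aux h1 h2 h3 t0.
Qed.

Lemma score_at_dot x t : fnorm (hessian_dev V P x) <= m / 8 -> enorm t <= rad ->
  dot (score_at x t) t <= enorm (score_mean V x) * enorm t - m / 2 * enorm t ^+ 2.
Proof.
have aux (a b c e s : R) : a - b + c <= s / 16 -> 3 / 4 * s <= c -> b <= e -> 0 <= s -> a <= e - s / 2.
  by move=> *; lra.
move=> xW tr.
have h := score_at_taylor x 0 t; rewrite add0r score_at0 in h.
have h1 : dot (score_at x t - score_mean V x + t *m hessian_at x 0) t <= m / 16 * enorm t ^+ 2.
  apply: (le_trans (dot_le _ _)).
  apply: (@le_trans _ _ (L * enorm t ^+ 2 * enorm t)); first by rewrite ler_wpM2r.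
  rewrite [leLHS]mulrAC ler_wpM2r ?sqr_ge0// -L_rad.
  by rewrite ler_wpM2l// ltW.
rewrite dotDl dotBl in h1.
have r0 : enorm (0 : 'rV[R]_d) <= rad by rewrite enorm0 ltW// rad_gt0.
have h2 := hessian_at_coercive t xW r0.
have h3 := dot_le (score_mean V x) t.
have t0 : 0 <= m * enorm t ^+ 2 by rewrite mulr_ge0 ?sqr_ge0// ltW.
rewrite [m / 2 * _]mulrAC; rewrite [m / 16 * _]mulrAC in h1; rewrite -mulrA in h2.
exact: aux h1 h2 h3 t0.
Qed.

(** Otherwise the segment from 0 to the estimator meets the sphere of radius [rad] at some [t].
    Convexity of the loss makes the score at [t] pair nonnegatively with [t], whereas [score_at_dot]
    makes this pairing negative on the sphere. *)
Lemma mle_small x : good x -> enorm (mle V x) <= rad.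
Proof.
move=> [xS xW]; rewrite leNgt; apply/negP; set Z := mle V x => rZ.
have Z0 : 0 < enorm Z by apply: lt_trans rZ; exact: rad_gt0.
pose t := (rad / enorm Z) *: Z.
have nt : enorm t = rad.
  rewrite enormZ (gtr0_norm (divr_gt0 rad_gt0 Z0)) divfK//.
  by rewrite gt_eqF.
pose c := enorm Z / rad - 1.
have c0 : 0 < c by rewrite subr_gt0 ltr_pdivlMr ?rad_gt0// mul1r.
have tZ : t + c *: t = Z.
  rewrite -{1}[t]scale1r -scalerDl /c addrC subrK /t scalerA mulrA divfK ?gt_eqF ?rad_gt0// mulfV ?scale1r//.
  by rewrite gt_eqF.
have := loss_grad_ineq M0 V_sc V_C2 V_M n0 x t (c *: t); rewrite tZ.
move=> /le_trans /(_ (mle_min M0 V_sc V_C2 V_M V_nrec n0 x t)).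
rewrite -/(score_at x t) dotZl lerBlDr lerDl pmulr_rge0// => h.
have tr : enorm t <= rad by rewrite nt.
have := score_at_dot xW tr; rewrite (dotC _ t) => /(le_trans h).
rewrite nt expr2 mulrA -mulrBl pmulr_lge0 ?rad_gt0// subr_ge0.
have := rad_gt0; have mr : 0 < m * rad by rewrite mulr_gt0// rad_gt0.
by move: xS mr; rewrite [m / 2 * _]mulrAC; move: (m * rad) => q *; lra.
Qed.

Lemma mle_score_bound x : good x -> m / 2 * enorm (mle V x) <= enorm (score_mean V x).
Proof.
move=> gx; have Zr := mle_small gx; have [xS xW] := gx.
have := score_at_dot xW Zr; rewrite score_at_mle dot0l.
have [->|Z0] := eqVneq (mle V x) 0; first by rewrite enorm0 !mulr0.
have nZ : 0 < enorm (mle V x) by rewrite enorm_gt0.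
by rewrite expr2 mulrA -mulrBl pmulr_lge0// subr_ge0.
Qed.

(** Expand the vanishing score at the estimator around 0 and replace the empirical Hessian by its
    mean. Both remainders, the Taylor term and the product of the estimator with [hessian_dev], are
    quadratic because [mle_score_bound] makes the estimator of the order of the score. *)
Lemma mle_linear x w : good x ->
  `|dot w (mle V x *m H) - dot w (score_mean V x)| <=
    enorm w * ((2 / m + 4 * L / m ^+ 2) * (enorm (score_mean V x) ^+ 2 + fnorm (hessian_dev V P x) ^+ 2)).
Proof.
move=> gx; have hZ := mle_score_bound gx; set Z := mle V x in hZ *.
set s := enorm (score_mean V x) in hZ *; set f := fnorm _.
have s0 : 0 <= s by exact: enorm_ge0.
have f0 : 0 <= f by exact: enorm_ge0.
have h := score_at_taylor x 0 Z; rewrite add0r score_at0 score_at_mle in h.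
have e : Z *m H - score_mean V x =
    (0 - score_mean V x + Z *m hessian_at x 0) - Z *m hessian_dev V P x.
  by rewrite hessian_at0 mulmxDr sub0r addrA addrK addrC.
rewrite -dotBr e; apply: (le_trans (normr_dot_le _ _)); rewrite ler_wpM2l//.
apply: (le_trans (ler_enormB _ _)).
have hZ' : enorm Z <= 2 / m * s.
  by rewrite mulrAC ler_pdivlMr// mulrC [2 * s]mulrC -ler_pdivrMr// mulrAC.
have h2 := enorm_mulmx_fnorm Z (hessian_dev V P x); rewrite -/f in h2.
apply: (le_trans (lerD h h2)).
have h3 : L * enorm Z ^+ 2 <= L * ((2 / m * s) ^+ 2).
  by rewrite ler_wpM2l ?(ltW L0)// lerXn2r ?nnegrE// mulr_ge0// divr_ge0// ltW.
have h4 : enorm Z * f <= 2 / m * s * f by rewrite ler_wpM2r.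
apply: (le_trans (lerD h3 h4)).
have -> : L * (2 / m * s) ^+ 2 = 4 * L / m ^+ 2 * s ^+ 2.
  by field; rewrite gt_eqF.
have i2 : 0 <= 2 / m by rewrite divr_ge0// ltW.
have i4 : 0 <= 4 * L / m ^+ 2 by rewrite divr_ge0 ?sqr_ge0// mulr_ge0// ltW.
have h5 : s * f <= s ^+ 2 + f ^+ 2.
  have := sqr_ge0 (s - f); have := sqr_ge0 (s + f); rewrite sqrrB sqrrD; lra.
rewrite [_ * (s ^+ 2 + _)]mulrDl [leLHS]addrC; apply: lerD.
  by rewrite -mulrA ler_wpM2l.
by rewrite ler_wpM2l// lerDl sqr_ge0.
Qed.

Section leave_one_out.
Variables (x x' : 'I_n -> 'rV[R]_d) (i : 'I_n).
Hypothesis xx' : forall j, j != i -> x' j = x j.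
Hypothesis xi0 : DV (x' i) = 0.
Hypotheses (gx : good x) (gx' : good x').

Local Notation Z := (mle V x).
Local Notation Z' := (mle V x').
Local Notation v := (DV (x i)).

Let Zr : enorm Z <= rad := mle_small gx.
Let Zr' : enorm Z' <= rad := mle_small gx'.

(** The score of [x] vanishes at its own estimator, so for [x'] only the exchanged term survives. *)
Lemma score_at_swap : score_at x' Z = n%:R^-1 *: (DV (x' i - Z) - DV (x i - Z)).
Proof.
rewrite -[LHS]subr0 -(score_at_mle x) /score_at -scalerBr -sumrB; congr (_ *: _).
by rewrite (bigD1 i)//= big1 ?addr0// => j ji; rewrite xx' ?subrr.
Qed.

(** Both scores are moved from [Z] back to 0, at cost [M * rad] each; there the replacing point has
    zero score. *)
Lemma score_swap_approx w :
  dot w (- score_at x' Z) <= n%:R^-1 * dot w v + n%:R^-1 * (2 * M * rad) * enorm w /\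
  n%:R^-1 * dot w v - n%:R^-1 * (2 * M * rad) * enorm w <= dot w (- score_at x' Z).
Proof.
have e : - score_at x' Z = n%:R^-1 *: (v + ((DV (x i - Z) - v) - (DV (x' i - Z) - DV (x' i)))).
  have aux (k : R) (a b c : 'rV[R]_d) :
      - (k *: (a - b)) = k *: (c + ((b - c) - (a - 0))).
    by rewrite subr0 -scalerN opprB addrA [c + _]addrC subrK.
  by rewrite score_at_swap xi0; exact: aux.
rewrite e dotZr dotDr mulrDr -/v.
have l1 j (y : 'I_n -> 'rV[R]_d) : enorm (DV (y j - Z) - DV (y j)) <= M * rad.
  apply: (le_trans (gradient_lip M0 V_C2 V_M _ _)); rewrite enormN.
  by rewrite ler_wpM2l// ltW.
have l2 : `|dot w ((DV (x i - Z) - v) - (DV (x' i - Z) - DV (x' i)))| <= (2 * M * rad) * enorm w.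
  apply: (le_trans (normr_dot_le _ _)); rewrite mulrC ler_wpM2r//.
  apply: (le_trans (ler_enormB _ _)).
  by rewrite -mulrA mulr2n mulrDl mul1r; apply: lerD; exact: l1.
have : `|n%:R^-1 * dot w ((DV (x i - Z) - v) - (DV (x' i - Z) - DV (x' i)))| <=
    n%:R^-1 * (2 * M * rad) * enorm w.
  by rewrite normrM ger0_norm// -mulrA ler_wpM2l.
rewrite ler_norml => /andP[a1 a2]; split; first by rewrite lerD2l.
by rewrite lerD2l.
Qed.

Lemma hessian_increment :
  enorm ((Z - Z') *m hessian_at x' Z' + score_at x' Z) <= L * enorm (Z - Z') ^+ 2.
Proof.
have := score_at_taylor x' Z' (Z - Z').
by rewrite [Z' + _]addrC subrK score_at_mle subr0 addrC.
Qed.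

(** The Hessian of [x'] at its estimator is coercive, and the two estimators are at most [2 * rad]
    apart, so the Taylor remainder is absorbed by the curvature. *)
Lemma mle_leave_one_out : m / 2 * enorm (Z - Z') <= n%:R^-1 * (enorm v + 2 * M * rad).
Proof.
set h := Z - Z'.
have [->|h0] := eqVneq h 0.
  rewrite enorm0 mulr0; apply: mulr_ge0 => //; apply: addr_ge0 => //.
  by rewrite mulr_ge0 ?(ltW rad_gt0)// mulr_ge0// ltW.
have nh : 0 < enorm h by rewrite enorm_gt0.
have [_ xW] := gx'.
have c := hessian_at_coercive h xW Zr'.
have hr : enorm h <= 2 * rad.
  by apply: (le_trans (ler_enormB _ _)); rewrite mulr2n mulrDl mul1r; exact: lerD.
have h1 := hessian_increment; rewrite -/h in h1.
have h2 : `|dot (h *m hessian_at x' Z' + score_at x' Z) h| <= m / 8 * enorm h ^+ 2.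
  apply: (le_trans (normr_dot_le _ _)).
  apply: (@le_trans _ _ (L * enorm h ^+ 2 * enorm h)); first by rewrite ler_wpM2r.
  rewrite [leLHS]mulrAC ler_wpM2r ?sqr_ge0//.
  apply: (@le_trans _ _ (L * (2 * rad))); first by rewrite ler_wpM2l// ltW.
  by rewrite mulrCA L_rad; lra.
have [h3 _] := score_swap_approx h.
rewrite dotDl ler_norml in h2; move/andP: h2 => [_ h2].
rewrite dotNr (dotC h) in h3.
have h4 : n%:R^-1 * dot h v <= n%:R^-1 * (enorm v * enorm h).
  by rewrite ler_wpM2l// mulrC; exact: dot_le.
rewrite -(ler_pM2r nh) -[leLHS]mulrA -expr2.
have -> : n%:R^-1 * (enorm v + 2 * M * rad) * enorm h =
    n%:R^-1 * (enorm v * enorm h) + n%:R^-1 * (2 * M * rad) * enorm h by ring.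
have t0 : 0 <= m * enorm h ^+ 2 by rewrite mulr_ge0 ?sqr_ge0// ltW.
have aux (a b c1 c2 c3 s : R) : 3 / 4 * s <= a -> a + b <= s / 8 -> - b <= c1 + c2 -> c1 <= c3 ->
    0 <= s -> s / 2 <= c3 + c2 by move=> *; lra.
rewrite [m / 2 * _]mulrAC; rewrite [m / 8 * _]mulrAC in h2; rewrite -mulrA in c.
exact: aux c h2 h3 h4 t0.
Qed.

(** The test vector [w] is dual to the Hessian of [x'] at its estimator, hence determined without
    observation [i]. Tested on it, the increment sees the score [v] in one direction only; the full
    norm of [v] enters just through the squared displacement. *)
Lemma mle_leave_one_out_dot (g w : 'rV[R]_d) :
  (forall h, dot w (h *m hessian_at x' Z') = dot g h) ->
  `|dot g (Z - Z')| <= n%:R^-1 * `|dot w v|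
     + enorm w * (n%:R^-1 * (2 * M * rad) + L * enorm (Z - Z') ^+ 2).
Proof.
move=> wg; set h := Z - Z'; rewrite -wg.
have h1 : `|dot w (h *m hessian_at x' Z' + score_at x' Z)| <= enorm w * (L * enorm h ^+ 2).
  apply: (le_trans (normr_dot_le _ _)); rewrite ler_wpM2l//; exact: hessian_increment.
have [h2 h3] := score_swap_approx w.
rewrite dotDr in h1; rewrite dotNr in h2 h3; rewrite mulrDr addrA.
have h4 : `|n%:R^-1 * dot w v| <= n%:R^-1 * `|dot w v| by rewrite normrM ger0_norm.
rewrite [enorm w * (_^-1 * _)]mulrC.
move: h1 h4; rewrite !ler_norml => /andP[a1 a2] /andP[b1 b2].
have aux (a b c1 c2 e f : R) : - e <= a + b -> a + b <= e -> - b <= c1 + c2 ->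
    c1 - c2 <= - b -> - f <= c1 -> c1 <= f -> - (f + c2 + e) <= a <= f + c2 + e.
  by move=> *; apply/andP; split; lra.
exact: aux a1 a2 h2 h3 b1 b2.
Qed.

End leave_one_out.

End good_samples.

(** * Absence of directions of recession *)

Section no_recession.
Context {R : realType} {d : nat} (V : 'rV[R]_d -> R) (L M m : R)
  (P : probability 'rV[R]_d R).
Hypothesis PV : has_density P (fun x => expR (- V x)).
Hypothesis A1 : assumption1 V P L M m.

(* Along a direction of recession u <> 0, strict convexity makes x |-> V (x + u) - V x
   negative, although e^{-V(x)} and e^{-V(x+u)} have the same integral. *)
Lemma V_no_recession u : (forall x t, 0 <= t -> V (x + t *: u) <= V x) -> u = 0.
Proof.
have [V_sc V_C2 _ _ _] := A1; move=> hu; apply/eqP/negP => /negP u0.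
have lt x : V (x + u) < V x.
  have xu : x + u != x by rewrite -subr_eq0 addrC addKr.
  have h2 : 0 < (2^-1 : R) < 1 by rewrite invr_gt0 ltr0n invf_lt1 ?ltr1n ?ltr0n.
  have := V_sc _ _ _ xu h2.
  have -> : (2^-1 : R) *: (x + u) + (1 - 2^-1) *: x = x + 2^-1 *: u.
    by rewrite scalerDr addrAC -scalerDl [2^-1 + (1 - _)]addrC subrK scale1r.
  have := hu (x + 2^-1 *: u) (2^-1 : R); rewrite -addrA -scalerDl.
  rewrite (_ : 2^-1 + 2^-1 = 1); last by field.
  rewrite scale1r invr_ge0 ler0n => /(_ isT) h h3.
  have aux (a b c : R) : b <= c -> c < 2^-1 * b + (1 - 2^-1) * a -> b < a.
    by move=> *; lra.
  exact: aux h h3.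
pose g x := expR (V x - V (x + u)) - 1.
have g0 x : 0 < g x by rewrite subr_gt0 -{1}expR0 ltr_expR subr_gt0.
have mV := measurable_V V_C2.
have me : measurable_fun [set: 'rV[R]_d] (fun x => expR (V x - V (x + u))).
  apply: measurableT_comp => //; apply: measurable_funB => //.
  exact: (measurable_comp_shift _ mV).
have mg : measurable_fun [set: 'rV[R]_d] g by apply: measurable_funB.
have := ge0_integral_shift_density PV A1 (g := fun=> 1) (- u) (measurable_cst _) (fun=> ler01).
under [X in _ = X -> _]eq_integral do rewrite mul1r opprK.
rewrite integral_cst// [X in (_ * X)%E]probability_setT mule1 => e1.
have ie : P.-integrable setT (EFin \o (fun x => expR (V x - V (x + u)))).
  by apply: (@ge0_integrable _ _ _ _ _ 1) => //; rewrite -e1.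
have : (\int[P]_x `|(g x)%:E| = 0)%E.
  under eq_integral do rewrite gee0_abs ?lee_fin ?(ltW (g0 _))//.
  rewrite -EFin_Rintegral; last by rewrite /g; apply: integrable_realD => //; exact: integrable_real_cst.
  rewrite /g RintegralB//; last exact: integrable_real_cst.
  by rewrite Rintegral_cst1 /Rintegral -e1 /= subrr.
move=> /(ae_eq_integral_abs P measurableT).
move=> /(_ _)/wrap[|[A [mA PA AT]]]; first exact/measurable_EFinP.
suff AT' : A = setT by move: PA; rewrite AT' => /eqP; rewrite [X in X == _]probability_setT gt_eqF.
apply/seteqP; split => // x _; apply: AT => /= /(_ I) [] /eqP.
by rewrite gt_eqF.
Qed.

End no_recession.

(** * The law of the observation errors *)

Section location_law.
Context {R : realType} {d : nat} (V : 'rV[R]_d -> R) (P : probability 'rV[R]_d R).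
Hypothesis PV : has_density P (fun x => expR (- V x)).
Hypothesis V_C2 : twice_continuously_differentiable V.
Context {disp : measure_display} {Omega : measurableType disp} {n : nat}.
Variables (PP : 'rV[R]_d -> probability Omega R) (X : 'I_n -> Omega -> 'rV[R]_d).
Hypothesis LS : location_sample V PP X.

Definition errors theta w : n.-tuple 'rV[R]_d := [tuple X j w - theta | j < n].

Lemma tnth_errors theta w j : tnth (errors theta w) j = X j w - theta.
Proof. by rewrite tnth_mktuple. Qed.

Lemma measurable_errors theta : measurable_fun [set: Omega] (errors theta).
Proof.
apply/measurable_fun_tnthP => j.
rewrite (_ : _ \o _ = fun w => X j w - theta); last by apply/funext => w /=; rewrite tnth_errors.
exact: (measurableT_comp (measurable_row_shift (- theta)) (LS.1 j)).
Qed.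

Lemma error_law theta j A : measurable A -> PP theta [set w | A (X j w - theta)] = P A.
Proof.
move=> mA; rewrite PV// [RHS]integral_mkcond.
have mB : measurable ((fun x => x - theta) @^-1` A).
  by rewrite -[X in measurable X]setTI; exact: measurable_row_shift.
have := (LS.2 theta).2 j _ mB; rewrite {1}/pushforward => ->; rewrite [LHS]integral_mkcond.
pose g := (fun x => (expR (- V x))%:E) \_ A.
have mp : measurable_fun setT (EFin \o (fun x => expR (- V x))).
  by apply/measurable_EFinP; exact: measurable_density.
have mg : measurable_fun setT g.
  by apply/(measurable_restrict _ _ _).1 => //; exact: measurable_funTS.
have g0 x : (0 <= g x)%E by rewrite /g /patch; case: ifP => // _; rewrite lee_fin expR_ge0.
have e := integral_row_shift (- theta) mg g0.
apply: etrans e.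
apply: eq_integral => x _; rewrite /patch.
suff -> : (x \in (fun x => x - theta) @^-1` A) = (x - theta \in A) by [].
by apply/idP/idP; rewrite !inE.
Qed.

Lemma errors_box theta A : (forall i, measurable (A i)) ->
  PP theta (errors theta @^-1` tuple_box A) = (\prod_(i < n) P (A i))%E.
Proof.
move=> mA.
have mB j : measurable ((fun x => x - theta) @^-1` A j).
  by rewrite -[X in measurable X]setTI; exact: measurable_row_shift.
have := (LS.2 theta).1 _ mB.
rewrite [in X in _ = X -> _](eq_bigr (fun i => P (A i))); last by move=> i _; exact: error_law.
move=> <-; congr (PP theta _); apply/seteqP; split => w /= h i.
  by move=> _; have := h i; rewrite tnth_errors.
by rewrite tnth_errors; exact: (h i I).
Qed.

(** The box probabilities of the errors do not involve [theta], so a single [Q], taken at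
    [theta = 0], describes them all; from here on the parameter only shifts the argument of the
    functional. *)
Lemma sample_law : exists Q : probability (n.-tuple 'rV[R]_d) R, iid_law P Q /\
  forall theta (f : n.-tuple 'rV[R]_d -> \bar R), measurable_fun setT f -> (forall x, (0 <= f x)%E) ->
  (\int[PP theta]_w f (errors theta w) = \int[Q]_x f x)%E.
Proof.
have mE theta := isMeasurableFun.Build _ _ _ _ _ (measurable_errors theta).
pose Y theta : {mfun Omega >-> n.-tuple 'rV[R]_d} := HB.pack (errors theta) (mE theta).
pose Q theta : probability _ R := distribution (PP theta) (Y theta).
exists (Q 0); split => [A mA|theta f mf f0]; first exact: errors_box.
have h A : measurable A -> A `<=` setT -> Q 0 A = Q theta A.
  move=> mA _; apply: (tuple_measure_unique _ _ mA).
    by move=> B mB; rewrite [LHS]errors_box// [RHS]errors_box.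
  by rewrite [X in (X < _)%E]probability_setT ltry.
rewrite (eq_measure_integral (Q theta) h).
have := @ge0_integral_pushforward _ _ _ _ R _ (measurable_errors theta) (PP theta) setT f
  measurableT mf (fun x _ => f0 x).
by rewrite preimage_setT => <-.
Qed.

End location_law.

Lemma measurable_mle_tuple {R : realType} {d n : nat} (V : 'rV[R]_d -> R) (L M m : R)
    (P : probability 'rV[R]_d R) :
  0 < M -> has_density P (fun x => expR (- V x)) -> assumption1 V P L M m -> (0 < n)%N ->
  measurable_fun [set: n.-tuple 'rV[R]_d] (fun x => mle V (tnth x)).
Proof.
move=> M0 PV A1 n0; have [V_sc V_C2 V_M _ _] := A1.
apply: measurable_fun_row => i.
apply: (@measurable_continuous_sample _ _ _ n d (fun j x => tnth x j) (fun x => mle V x ord0 i)).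
  by move=> j; exact: measurable_tnth.
move=> x e e0; have [t t0 ht] := mle_continuous M0 V_sc V_C2 V_M (V_no_recession PV A1) n0 x e0.
exists t => // y hy; apply: le_trans (ht _ hy).
by apply: le_trans (coord_enorm _ i); rewrite [X in _ <= `|X|]mxE [X in _ <= `|_ + X|]mxE.
Qed.

(** * Calculus of bounds on expectations *)

Section mean_le.
Context {R : realType} {dS} {S : measurableType dS} (Q : probability S R).
Implicit Types (f g : S -> R) (B c : R).

(** Measurability and sign travel with the bound, so that bounds can be added and scaled without
    separate integrability proofs. *)
Definition mean_le f B : Prop :=
  [/\ measurable_fun [set: S] f, forall x, 0 <= f x & (\int[Q]_x (f x)%:E <= B%:E)%E].

Lemma mean_le_integrable f B : mean_le f B -> Q.-integrable setT (EFin \o f).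
Proof. by move=> [mf f0 fB]; exact: (ge0_integrable mf f0 fB). Qed.

Lemma mean_le_Rintegral f B : mean_le f B -> \int[Q]_x f x <= B.
Proof. by move=> fB; rewrite -lee_fin EFin_Rintegral; [case: fB|exact: mean_le_integrable fB]. Qed.

Lemma mean_le_ge0 f B : mean_le f B -> 0 <= B.
Proof.
move=> [_ f0 fB]; rewrite -lee_fin; apply: le_trans fB.
by apply: integral_ge0 => x _; rewrite lee_fin.
Qed.

Lemma mean_le_weak f B B' : B <= B' -> mean_le f B -> mean_le f B'.
Proof. by move=> BB' [mf f0 fB]; split=> //; apply: (le_trans fB); rewrite lee_fin. Qed.

Lemma mean_leS f g B : measurable_fun [set: S] f -> (forall x, 0 <= f x) -> (forall x, f x <= g x) ->
  mean_le g B -> mean_le f B.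
Proof.
move=> mf f0 fg [mg g0 gB]; split=> //; apply: le_trans gB; apply: ge0_le_integral => //.
- by move=> x _; rewrite lee_fin.
- exact/measurable_EFinP.
- exact/measurable_EFinP.
- by move=> x _; rewrite lee_fin.
Qed.

Lemma mean_leD f g B B' : mean_le f B -> mean_le g B' -> mean_le (fun x => f x + g x) (B + B').
Proof.
move=> [mf f0 fB] [mg g0 gB]; split; [exact: measurable_funD|by move=> x; rewrite addr_ge0|].
under eq_integral do rewrite EFinD.
rewrite ge0_integralD ?EFinD ?leeD//.
- by move=> x _; rewrite lee_fin.
- exact/measurable_EFinP.
- by move=> x _; rewrite lee_fin.
- exact/measurable_EFinP.
Qed.

Lemma mean_leZ c f B : 0 <= c -> mean_le f B -> mean_le (fun x => c * f x) (c * B).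
Proof.
move=> c0 [mf f0 fB]; split; [exact: measurable_funM|by move=> x; rewrite mulr_ge0|].
under eq_integral do rewrite EFinM.
rewrite ge0_integralZl_EFin// ?EFinM ?lee_wpmul2l ?lee_fin//.
- by move=> x _; rewrite lee_fin.
- exact/measurable_EFinP.
Qed.

Lemma mean_le_cst c : 0 <= c -> mean_le (fun=> c) c.
Proof.
move=> c0; split=> //.
by rewrite integral_cst// [X in (_ * X)%E]probability_setT mule1.
Qed.

Lemma mean_le_normr f g B : measurable_fun [set: S] g -> (forall x, `|g x| <= f x) ->
  mean_le f B -> `|\int[Q]_x g x| <= B.
Proof.
move=> mg gf fB; have ig := integrable_dominated mg gf (mean_le_integrable fB).
apply: le_trans (le_normr_Rintegral _ ig) _ => //; apply: mean_le_Rintegral.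
by apply: mean_leS gf fB => //; exact: measurableT_comp.
Qed.

End mean_le.

Section powers.
Context {R : realType}.

(** Fractional moments from the second one: after division by the expected scale [D], a power with
    exponent between 0 and 2 is at most 1 plus the square. *)
Lemma powR_le_sqr (t D a : R) : 0 <= t -> 0 < D -> 0 <= a <= 2 ->
  t `^ a <= D `^ a * (1 + t ^+ 2 / D ^+ 2).
Proof.
move=> t0 D0 /andP[a0 a2].
have e : t `^ a = D `^ a * (t / D) `^ a.
  by rewrite -powRM ?(ltW D0) ?divr_ge0 ?(ltW D0)// mulrC divfK ?gt_eqF.
rewrite e ler_wpM2l ?powR_ge0// -expr_div_n.
have r0 : 0 <= t / D by rewrite divr_ge0// ltW.
have [r1|r1] := leP (t / D) 1.
  apply: (@le_trans _ _ 1); last by rewrite lerDl sqr_ge0.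
  have h1 : 1 `^ a = 1 :> R by rewrite powR1.
  by rewrite -[leRHS]h1; apply: ge0_ler_powR => //; rewrite nnegrE.
apply: (@le_trans _ _ ((t / D) ^+ 2)); last by rewrite lerDr.
by rewrite -powR_mulrn//; apply: ler_powR => //; rewrite ltW.
Qed.

Lemma exprD_le (a b : R) q : 0 <= a -> 0 <= b -> (a + b) ^+ q <= 2 ^+ q * (a ^+ q + b ^+ q).
Proof.
move=> a0 b0; case: q => [|q]; first by rewrite !expr0; lra.
have := @sum_pow_le R bool q (fun i => if i then a else b).
rewrite !big_bool card_bool => /(_ _)/wrap[[]//|h]; apply: (le_trans h).
by rewrite ler_wpM2r ?addr_ge0 ?exprn_ge0// exprS ler_peMl ?exprn_ge0// ler1n.
Qed.

End powers.

(** * The deviation of a sample and its moments *)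

Section deviations.
Context {R : realType}.
Variables (L M m : R).
Hypotheses (L0 : 0 < L) (M0 : 0 < M) (m0 : 0 < m).

Definition regular_sample {d n} (V : 'rV[R]_d -> R) (P : probability 'rV[R]_d R)
    (Q : probability (n.-tuple 'rV[R]_d) R) : Prop :=
  [/\ has_density P (fun x => expR (- V x)), assumption1 V P L M m,
      (0 < d)%N, (d <= n)%N & iid_law P Q].

(* Normalised so that dev <= 1 makes a sample good. *)
Definition dev {d n} (V : 'rV[R]_d -> R) (P : probability 'rV[R]_d R) (x : n.-tuple 'rV[R]_d) : R :=
  (m * rad L m / 4)^-1 * enorm (score_mean V (tnth x)) + (m / 8)^-1 * fnorm (hessian_dev V P (tnth x)).

Let k1 : R := (m * rad L m / 4)^-1.
Let k2 : R := (m / 8)^-1.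
Let mr0 : 0 < m * rad L m / 4.
Proof. by rewrite divr_gt0// mulr_gt0// rad_gt0. Qed.
Let m80 : 0 < m / 8. Proof. by rewrite divr_gt0. Qed.
Let k10 : 0 < k1. Proof. by rewrite invr_gt0. Qed.
Let k20 : 0 < k2. Proof. by rewrite invr_gt0. Qed.

Section one_sample.
Context {d n : nat} (V : 'rV[R]_d -> R) (P : probability 'rV[R]_d R)
  (Q : probability (n.-tuple 'rV[R]_d) R).
Hypothesis RS : regular_sample V P Q.
Local Notation DV := (gradient V).
Local Notation S x := (score_mean V (tnth x)).
Local Notation W x := (hessian_dev V P (tnth x)).
Local Notation Z x := (mle V (tnth x)).

Let PV : has_density P (fun x => expR (- V x)). Proof. by case: RS. Qed.
Let A1 : assumption1 V P L M m. Proof. by case: RS. Qed.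
Let d0 : (0 < d)%N. Proof. by case: RS. Qed.
Let dn : (d <= n)%N. Proof. by case: RS. Qed.
Let n0 : (0 < n)%N. Proof. exact: leq_trans d0 dn. Qed.
Let V_C2 : twice_continuously_differentiable V. Proof. by case: A1. Qed.
Let V_sc : strictly_convex V. Proof. by case: A1. Qed.
Let V_M : (ereal_sup [set (opnorm (hessian V x))%:E | x in [set: 'rV[R]_d]] <= M%:E)%E.
Proof. by case: A1. Qed.

Lemma fnorm_ge0 d' e (A : 'M[R]_(d', e)) : 0 <= fnorm A.
Proof. by rewrite fnormE. Qed.

Lemma dev_ge0 (x : n.-tuple 'rV[R]_d) : 0 <= dev V P x.
Proof. by rewrite addr_ge0// mulr_ge0 ?fnorm_ge0// ltW. Qed.

Lemma measurable_score_mean : measurable_fun [set: n.-tuple 'rV[R]_d] (fun x => S x).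
Proof.
apply: measurable_fun_rowZ; apply: measurable_fun_row_sum => j.
exact: (measurableT_comp (measurable_gradient V_C2) (measurable_tnth j)).
Qed.

Lemma measurable_dev : measurable_fun [set: n.-tuple 'rV[R]_d] (dev V P).
Proof.
apply: measurable_funD; apply: measurable_funM => //.
  by apply: measurable_fun_enorm; exact: measurable_score_mean.
have rowE' (A : 'M[R]_d) i k : row i A ord0 k = A i k by rewrite mxE.
pose F (x : n.-tuple 'rV[R]_d) := \sum_(i < d) \sum_(k < d) (hessian_dev V P (tnth x) i k) ^+ 2.
rewrite (_ : (fun x => _) = fun x : n.-tuple 'rV[R]_d => Num.sqrt (F x)); last first.
  apply/funext => x; rewrite -[LHS]ger0_norm ?fnorm_ge0// -sqrtr_sqr fnorm_sum; congr Num.sqrt.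
  by apply: eq_bigr => i _; rewrite sqr_enorm; apply: eq_bigr => k _; rewrite rowE'.
apply: (@measurableT_comp _ _ _ _ _ _ (@Num.sqrt R)); first by apply: continuous_measurable_fun; exact: sqrt_continuous.
apply: measurable_sum => i; apply: measurable_sum => k; apply: measurable_funX.
rewrite (_ : (fun x => _) = fun x : n.-tuple 'rV[R]_d => n%:R^-1 * \sum_(j < n) (hessian V (tnth x j) i k - mean_hessian V P i k)).
  apply: measurable_funM => //; apply: measurable_sum => j; apply: measurable_funB => //.
  exact: (measurableT_comp (measurable_hessian V_C2 i k) (measurable_tnth j)).
apply/funext => x; rewrite mxE; congr (_ * _); rewrite summxE; apply: eq_bigr => j _.
by rewrite [LHS]mxE [X in _ + X]mxE.
Qed.

Lemma measurable_mle : measurable_fun [set: n.-tuple 'rV[R]_d] (fun x => Z x).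
Proof. exact: measurable_mle_tuple M0 PV A1 n0. Qed.

Lemma dev_good (x : n.-tuple 'rV[R]_d) : dev V P x <= 1 -> good V L m P (tnth x).
Proof.
move=> x1; have a0 : 0 <= k1 * enorm (S x) by rewrite mulr_ge0// ltW.
have b0 : 0 <= k2 * fnorm (W x) by rewrite mulr_ge0 ?fnorm_ge0// ltW.
split.
  rewrite -[leRHS]mulr1 -ler_pdivrMl// -/k1; apply: le_trans x1.
  by rewrite /dev -/k1 lerDl.
rewrite -[leRHS]mulr1 -ler_pdivrMl// -/k2; apply: le_trans x1.
by rewrite /dev -/k2 lerDr.
Qed.

Lemma score_mean_dev (x : n.-tuple 'rV[R]_d) : enorm (S x) <= m * rad L m / 4 * dev V P x.
Proof.
rewrite -ler_pdivrMl// -/k1 /dev -/k1 lerDl.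
by rewrite mulr_ge0 ?fnorm_ge0// ltW.
Qed.

Lemma hessian_dev_dev (x : n.-tuple 'rV[R]_d) : fnorm (W x) <= m / 8 * dev V P x.
Proof.
rewrite -ler_pdivrMl// -/k2 /dev -/k2 lerDr.
by rewrite mulr_ge0// ltW.
Qed.

Lemma mle_dev (x : n.-tuple 'rV[R]_d) : dev V P x <= 1 -> enorm (Z x) <= rad L m / 2 * dev V P x.
Proof.
move=> x1.
have h := mle_score_bound L0 M0 m0 PV A1 (V_no_recession PV A1) n0 (dev_good x1).
have h1 := le_trans h (score_mean_dev x).
have m20 : 0 < m / 2 by rewrite divr_gt0.
rewrite -(ler_pM2l m20); apply: le_trans h1 _.
by rewrite le_eqVlt; apply/orP; left; apply/eqP; field.
Qed.

Lemma mle_linear_dev (x : n.-tuple 'rV[R]_d) w : dev V P x <= 1 ->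
  `|dot w (Z x *m mean_hessian V P) - dot w (S x)| <=
    enorm w * ((2 / m + 4 * L / m ^+ 2) * ((m * rad L m / 4) ^+ 2 + (m / 8) ^+ 2)) * dev V P x ^+ 2.
Proof.
move=> x1.
have h := mle_linear L0 M0 m0 PV A1 (V_no_recession PV A1) n0 w (dev_good x1).
apply: (le_trans h); rewrite -[leRHS]mulrA ler_wpM2l// -[leRHS]mulrA ler_wpM2l//.
  by rewrite addr_ge0// divr_ge0 ?sqr_ge0 ?mulr_ge0// ltW.
rewrite mulrDl -!exprMn; apply: lerD; rewrite lerXn2r ?nnegrE ?fnorm_ge0//.
- by rewrite mulr_ge0 ?dev_ge0// ltW.
- exact: score_mean_dev.
- by rewrite mulr_ge0 ?dev_ge0// ltW.
- exact: hessian_dev_dev.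
Qed.

End one_sample.

Lemma dev_moment (p : nat) : exists2 C : R, 0 <= C &
  forall d n (V : 'rV[R]_d -> R) (P : probability 'rV[R]_d R) (Q : probability (n.-tuple 'rV[R]_d) R),
  regular_sample V P Q -> mean_le Q (fun x => dev V P x ^+ (2 * p)) (C * (d%:R / n%:R) ^+ p).
Proof.
have [C1 C10 h1] := score_mean_moment m p L0 M0.
have [C2 C20 h2] := hessian_dev_moment m p L0 M0.
exists (2 ^+ (2 * p) * (k1 ^+ (2 * p) * C1 + k2 ^+ (2 * p) * C2)).
  by rewrite mulr_ge0 ?exprn_ge0// addr_ge0// mulr_ge0// exprn_ge0// ltW.
move=> d n V P Q RS; have [PV A1 d0 dn QP] := RS; have n0 := leq_trans d0 dn.
have md := measurable_dev RS.
pose f (x : n.-tuple 'rV[R]_d) := 2 ^+ (2 * p) * (k1 ^+ (2 * p) * enorm (score_mean V (tnth x)) ^+ (2 * p)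
  + k2 ^+ (2 * p) * fnorm (hessian_dev V P (tnth x)) ^+ (2 * p)).
have V_C2 : twice_continuously_differentiable V by case: A1.
apply: (@mean_leS _ _ _ _ _ f).
- exact: measurable_funX.
- by move=> x; rewrite exprn_ge0// dev_ge0.
- move=> x; rewrite /f -!exprMn; apply: exprD_le; rewrite mulr_ge0 ?fnorm_ge0// ltW//.
rewrite -mulrA; apply: mean_leZ; first by rewrite exprn_ge0.
rewrite mulrDl -!mulrA; apply: mean_leD; (apply: mean_leZ; first by rewrite exprn_ge0// ltW); split.
- by apply: measurable_funX; apply: measurable_fun_enorm; exact: (measurable_score_mean RS).
- by move=> x; rewrite exprn_ge0.
- exact: (h1 _ _ V P Q).
(* Solving the definition of [dev] for the Frobenius term reduces its measurability to that of
   [dev]. *)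
- rewrite (_ : (fun x => _) = fun x : n.-tuple 'rV[R]_d =>
    ((dev V P x - k1 * enorm (score_mean V (tnth x))) / k2) ^+ (2 * p)); last first.
    apply/funext => x; rewrite /dev -/k1 -/k2 addrAC subrr add0r mulrAC mulfV ?mul1r//.
    by rewrite gt_eqF.
  apply: measurable_funX; apply: measurable_funM => //; apply: measurable_funB => //.
  apply: measurable_funM => //; apply: measurable_fun_enorm; exact: (measurable_score_mean RS).
- by move=> x; rewrite exprn_ge0// fnorm_ge0.
- exact: (h2 _ _ V P Q).
Qed.

End deviations.

(** * The cutoff function *)

Section cutoff.
Context {R : realType}.

Definition cutoff (t : R) : R := Num.min 1 (Num.max 0 (2 - 2 * t)).

Lemma cutoff_ge0 t : 0 <= cutoff t.
Proof. by rewrite /cutoff le_min ler01 le_max lexx. Qed.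

Lemma cutoff_le1 t : cutoff t <= 1.
Proof. by rewrite /cutoff ge_min lexx. Qed.

Lemma cutoff_eq1 t : t <= 2^-1 -> cutoff t = 1.
Proof. by move=> t2; rewrite /cutoff; apply/min_idPl; rewrite le_max; apply/orP; right; lra. Qed.

Lemma cutoff_eq0 t : 1 <= t -> cutoff t = 0.
Proof.
move=> t1; rewrite /cutoff (max_idPl _); last by lra.
by apply/min_idPr; rewrite ler01.
Qed.

Lemma cutoff_lip s t : `|cutoff s - cutoff t| <= 2 * `|s - t|.
Proof.
wlog st : s t / s <= t.
  move=> H; have /orP[|] := le_total s t; first exact: H.
  by move=> ts; rewrite distrC [`|s - t|]distrC; exact: H.
have [a b] : s - t <= 0 /\ 0 <= t - s by split; lra.
rewrite [`|s - t|]distrC (ger0_norm b).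
rewrite /cutoff /Num.min /Num.max; do !case: ifPn; rewrite -?leNgt => *; rewrite ler_norml; apply/andP; split; lra.
Qed.

Lemma measurable_cutoff : measurable_fun [set: R] cutoff.
Proof.
apply: measurable_minr => //; apply: measurable_maxr => //.
by apply: measurable_funB => //; exact: measurable_funM.
Qed.

Lemma weighted_dist (k1 k2 i K v D a b c e : R) : 0 <= k1 -> 0 <= k2 -> 0 <= i -> 0 <= K ->
  0 <= v -> 0 <= D -> `|a - b| <= i * v -> `|c - e| <= i * (D * K) ->
  `|k1 * a + k2 * c - (k1 * b + k2 * e)| <= (k1 + k2 * K) * (i * (v + D)).
Proof.
move=> k10 k20 i0 K0 v0 D0 hS hW.
have -> : k1 * a + k2 * c - (k1 * b + k2 * e) = k1 * (a - b) + k2 * (c - e) by ring.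
apply: (le_trans (ler_normD _ _)); rewrite !normrM (ger0_norm k10) (ger0_norm k20).
have h1 := ler_wpM2l k10 hS; have h2 := ler_wpM2l k20 hW.
apply: (le_trans (lerD h1 h2)).
have -> : (k1 + k2 * K) * (i * (v + D)) =
  k1 * (i * v) + k2 * (i * (D * K)) + (i * (k1 * D + k2 * K * v)) by ring.
by rewrite lerDl mulr_ge0// addr_ge0// !mulr_ge0.
Qed.

Lemma ler_exprn (a b : R) q : 0 <= a -> a <= b -> a ^+ q <= b ^+ q.
Proof. by move=> a0 ab; rewrite lerXn2r ?nnegrE//; exact: le_trans ab. Qed.

Lemma ler_dist_swap (a b c : R) : `|a - b| <= c -> b <= a + c.
Proof. by rewrite ler_norml => /andP[h _]; lra. Qed.

Lemma measurable_cutoff_comp dS (S : measurableType dS) (f : S -> R) :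
  measurable_fun [set: S] f -> measurable_fun [set: S] (fun x => cutoff (f x)).
Proof. by move=> mf; exact: (measurableT_comp measurable_cutoff mf). Qed.

Lemma measurable_cutoff_diff dS (S : measurableType dS) (f g : S -> R) :
  measurable_fun [set: S] f -> measurable_fun [set: S] g ->
  measurable_fun [set: S] (fun x => (cutoff (f x) - cutoff (g x)) ^+ 2).
Proof.
by move=> mf mg; apply: measurable_funX; apply: measurable_funB; exact: measurable_cutoff_comp.
Qed.

(** The cutoff is constant below 1/2, so the difference vanishes unless [2 * a] or [2 * b] exceeds
    1, and then the bracket is at least 1. The rarity of that event is thus kept together with the
    Lipschitz gain [u ^+ 2]. *)
Lemma cutoff_diff (a b u : R) p : 0 <= a -> 0 <= b -> `|a - b| <= u ->
  (cutoff a - cutoff b) ^+ 2 <= 4 * (u ^+ 2 * ((2 * a) ^+ (2 * p) + (2 * b) ^+ (2 * p))).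
Proof.
move=> a0 b0 abu.
have u0 : 0 <= u by apply: le_trans abu.
have T0 : 0 <= (2 * a) ^+ (2 * p) + (2 * b) ^+ (2 * p) by rewrite addr_ge0// exprn_ge0// mulr_ge0.
suff [e|T1] : cutoff a = cutoff b \/ 1 <= (2 * a) ^+ (2 * p) + (2 * b) ^+ (2 * p).
  by rewrite e subrr expr0n/= !mulr_ge0// exprn_ge0.
  apply: (@le_trans _ _ ((2 * u) ^+ 2)).
    rewrite -real_normK ?num_real// lerXn2r ?nnegrE ?mulr_ge0//.
    by apply: (le_trans (cutoff_lip _ _)); rewrite ler_wpM2l.
  by rewrite exprMn -natrX ler_wpM2l// ler_peMr// sqr_ge0.
have [a2|a2] := leP a 2^-1; last first.
  right; rewrite -[leLHS]addr0; apply: lerD; last by rewrite exprn_ge0// mulr_ge0.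
  by apply: exprn_ege1; lra.
have [b2|b2] := leP b 2^-1; last first.
  right; rewrite -[leLHS]add0r; apply: lerD; first by rewrite exprn_ge0// mulr_ge0.
  by apply: exprn_ege1; lra.
by left; rewrite !cutoff_eq1.
Qed.

Lemma young_product (u T k : R) : 0 < k -> u ^+ 2 * T <= k * u ^+ 4 + k^-1 * T ^+ 2.
Proof.
move=> k0.
have h : 0 <= (k * u ^+ 2 - T) ^+ 2 / k by rewrite divr_ge0 ?sqr_ge0// ltW.
have e : (k * u ^+ 2 - T) ^+ 2 / k = k * u ^+ 4 + k^-1 * T ^+ 2 - 2 * (u ^+ 2 * T).
  by field; rewrite gt_eqF.
have h1 : 0 <= k * u ^+ 4 + k^-1 * T ^+ 2.
  by rewrite addr_ge0// mulr_ge0 ?invr_ge0 ?sqr_ge0 ?(ltW k0)// (exprM _ 2 2) sqr_ge0.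
by rewrite e in h; lra.
Qed.

Lemma cutoff_young (a b u k : R) p : 0 < k -> 0 <= a -> 0 <= b -> `|a - b| <= u ->
  (cutoff a - cutoff b) ^+ 2 <= 4 * (k * u ^+ 4 + k^-1 * (2 ^+ 2 *
    (2 ^+ (2 * (2 * p)) * a ^+ (2 * (2 * p)) + 2 ^+ (2 * (2 * p)) * b ^+ (2 * (2 * p))))).
Proof.
move=> k0 a0 b0 abu; apply: le_trans (cutoff_diff p a0 b0 abu) _.
rewrite ler_wpM2l//; apply: le_trans (young_product _ _ k0) _; rewrite lerD2l.
rewrite ler_wpM2l ?invr_ge0 ?(ltW k0)//.
have P0 (c : R) : 0 <= c -> 0 <= (2 * c) ^+ (2 * p) by move=> c0; rewrite exprn_ge0// mulr_ge0.
apply: le_trans (exprD_le 2 (P0 _ a0) (P0 _ b0)) _; rewrite ler_wpM2l ?exprn_ge0//.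
by rewrite -!exprM [(2 * p * 2)%N]mulnC !exprMn.
Qed.

End cutoff.

(** * Effect of one observation on the deviation *)

Section deviations.
Context {R : realType}.
Variables (L M m : R).
Hypotheses (L0 : 0 < L) (M0 : 0 < M) (m0 : 0 < m).

Section one_sample.
Context {d n : nat} (V : 'rV[R]_d -> R) (P : probability 'rV[R]_d R)
  (Q : probability (n.-tuple 'rV[R]_d) R).
Hypothesis RS : regular_sample L M m V P Q.
Local Notation DV := (gradient V).
Local Notation S x := (score_mean V (tnth x)).
Local Notation W x := (hessian_dev V P (tnth x)).
Local Notation tau := (dev L m V P).

Let A1 : assumption1 V P L M m. Proof. by case: RS. Qed.
Let V_C2 : twice_continuously_differentiable V. Proof. by case: A1. Qed.
Let V_M : (ereal_sup [set (opnorm (hessian V x))%:E | x in [set: 'rV[R]_d]] <= M%:E)%E.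
Proof. by case: A1. Qed.
Let n0 : (0 < n)%N. Proof. by case: RS => _ _ d0 /(leq_trans d0). Qed.
Let ni0 : 0 <= (n%:R : R)^-1. Proof. by rewrite invr_ge0. Qed.

Lemma ge0_marginal i (h : 'rV[R]_d -> R) : measurable_fun [set: 'rV[R]_d] h -> (forall y, 0 <= h y) ->
  (\int[Q]_x (h (tnth x i))%:E = \int[P]_y (h y)%:E)%E.
Proof.
have [_ _ _ _ QP] := RS; move=> mh h0.
rewrite (ge0_resample QP i); last 2 first.
- by apply/measurable_EFinP; exact: (measurableT_comp mh (measurable_tnth i)).
- by move=> x; rewrite lee_fin.
under eq_integral do under eq_integral do rewrite tnth_upd eqxx.
by rewrite integral_cst// [X in (_ * X)%E]probability_setT mule1.
Qed.

Lemma marginal i (h : 'rV[R]_d -> R) B : mean_le P h B -> mean_le Q (fun x => h (tnth x i)) B.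
Proof.
move=> [mh h0 hB]; split=> //; last by rewrite ge0_marginal.
exact: (measurableT_comp mh (measurable_tnth i)).
Qed.

Lemma integral_marginal i (h : 'rV[R]_d -> R) : measurable_fun [set: 'rV[R]_d] h ->
  P.-integrable setT (EFin \o h) ->
  Q.-integrable setT (EFin \o (fun x => h (tnth x i))) /\
  \int[Q]_x h (tnth x i) = \int[P]_y h y.
Proof.
move=> mh ih.
have mQ : measurable_fun [set: n.-tuple 'rV[R]_d] (fun x => h (tnth x i)).
  exact: (measurableT_comp mh (measurable_tnth i)).
have part (g : 'rV[R]_d -> R) : measurable_fun setT g -> (forall y, 0 <= g y) -> (forall y, g y <= `|h y|) ->
  [/\ P.-integrable setT (EFin \o g), Q.-integrable setT (EFin \o (fun x => g (tnth x i))) &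
     \int[Q]_x g (tnth x i) = \int[P]_y g y].
  move=> mg g0 gh.
  have iP : P.-integrable setT (EFin \o g).
    apply: (integrable_dominated (h := fun y => `|h y|)) => // [y|]; first by rewrite ger0_norm.
    by have := integrable_abse ih; apply: eq_integrable.
  have e := ge0_marginal i mg g0.
  have iQ : Q.-integrable setT (EFin \o (fun x => g (tnth x i))).
    apply: (@ge0_integrable _ _ _ _ _ (\int[P]_y g y)) => //.
      exact: (measurableT_comp mg (measurable_tnth i)).
    by rewrite e EFin_Rintegral.
  by split => //; apply: EFin_inj; rewrite !EFin_Rintegral.
pose hp y := Num.max (h y) 0; pose hn y := Num.max (- h y) 0.
have mhp : measurable_fun setT hp by apply: measurable_maxr.
have mhn : measurable_fun setT hn.
  by apply: measurable_maxr => //; exact: measurableT_comp.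
have [||p1 p2 p3] := part hp mhp.
- by move=> y; rewrite le_max lexx orbT.
- by move=> y; rewrite ge_max ler_norm normr_ge0.
have [||q1 q2 q3] := part hn mhn.
- by move=> y; rewrite le_max lexx orbT.
- by move=> y; rewrite ge_max -normrN ler_norm normr_ge0.
have eh y : h y = hp y - hn y.
  rewrite /hp /hn; have [h0|h0] := leP 0 (h y).
    by rewrite (max_idPr _) ?oppr_le0// subr0.
  by rewrite (max_idPl _) ?oppr_ge0 ?(ltW h0)// sub0r opprK.
have e1 : (fun x => h (tnth x i)) = fun x => hp (tnth x i) - hn (tnth x i) by apply/funext => x; exact: eh.
have e2 : h = fun y => hp y - hn y by apply/funext => x; exact: eh.
split.
  rewrite e1; have := integrableB measurableT p2 q2; apply: eq_integrable => //.
rewrite e1 [in RHS]e2 RintegralB// p3 q3 RintegralB//.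
Qed.

Lemma sum_upd (U : zmodType) (F : 'rV[R]_d -> U) i z (x : n.-tuple 'rV[R]_d) :
  \sum_(j < n) F (tnth x j) - \sum_(j < n) F (tnth (upd i z x) j) = F (tnth x i) - F z.
Proof.
rewrite -sumrB (bigD1 i)//= tnth_upd eqxx big1 ?addr0// => j ji.
by rewrite tnth_upd (negPf ji) subrr.
Qed.

Lemma fnorm_dist e f (A B : 'M[R]_(e, f)) : `|fnorm A - fnorm B| <= fnorm (A - B).
Proof. by rewrite !fnormE linearB; exact: dist_enorm. Qed.

Lemma fnormZ e f c (A : 'M[R]_(e, f)) : fnorm (c *: A) = `|c| * fnorm A.
Proof. by rewrite !fnormE linearZ enormZ. Qed.

Lemma hessian_fnorm_dist y z : fnorm (hessian V y - hessian V z) <= Num.sqrt d%:R * (2 * M).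
Proof.
have c0 : 0 <= Num.sqrt d%:R * (2 * M) by rewrite mulr_ge0 ?sqrtr_ge0// mulr_ge0// ltW.
rewrite -(@ler_pXn2r _ 2)// ?nnegrE ?fnorm_ge0//.
rewrite [leRHS]exprMn [X in _ <= X * _]sqr_sqrtr//.
apply: (@fnorm_le_opnorm _ _ (hessian V y - hessian V z)); first by rewrite mulr_ge0// ltW.
move=> u; rewrite mulmxBr; apply: (le_trans (ler_enormB _ _)).
by rewrite mulr2n mulrDl mul1r mulrDl; apply: lerD; exact: hessian_bound.
Qed.

Definition dev_cst : R := (m * rad L m / 4)^-1 + (m / 8)^-1 * (2 * M).

(** The critical point has no score, so the score sum changes by the score of observation [i] alone;
    the Hessian sum changes by at most [2 * M * sqrt d] in Frobenius norm. *)
Lemma dev_upd i z (x : n.-tuple 'rV[R]_d) : DV z = 0 ->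
  `|tau x - tau (upd i z x)| <= dev_cst * (n%:R^-1 * (enorm (DV (tnth x i)) + Num.sqrt d%:R)).
Proof.
move=> z0; set v := enorm _; set D := Num.sqrt _.
have v0 : 0 <= v by exact: enorm_ge0.
have D0 : 0 <= D by exact: sqrtr_ge0.
have hS : `|enorm (S x) - enorm (S (upd i z x))| <= n%:R^-1 * v.
  apply: (le_trans (dist_enorm _ _)); rewrite -scalerBr sum_upd z0 subr0 enormZ.
  by rewrite ger0_norm.
have eW : W x - W (upd i z x) = n%:R^-1 *: (hessian V (tnth x i) - hessian V z).
  have aux (U : lmodType R) (a b c h : U) (k : R) : a - b = c - h -> k *: a - k *: b = k *: (c - h).
    by move=> ab; rewrite -scalerBr ab.
  rewrite /hessian_dev; apply: aux.
  rewrite (sum_upd (fun y => hessian V y - mean_hessian V P)).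
  have aux2 (U : zmodType) (a b c : U) : a - c - (b - c) = a - b by rewrite opprB addrA subrK.
  exact: aux2.
have hW : `|fnorm (W x) - fnorm (W (upd i z x))| <= n%:R^-1 * (D * (2 * M)).
  apply: (le_trans (fnorm_dist _ _)); rewrite eW fnormZ ger0_norm//.
  by rewrite ler_wpM2l// hessian_fnorm_dist.
have k10 : 0 <= (m * rad L m / 4)^-1 by rewrite invr_ge0 divr_ge0// mulr_ge0 ?ltW// rad_gt0.
have k20 : 0 <= (m / 8)^-1 by rewrite invr_ge0 divr_ge0// ltW.
rewrite /dev /dev_cst; apply: weighted_dist => //.
by rewrite mulr_ge0// ltW.
Qed.

End one_sample.

Lemma dev_cst_ge0 : 0 <= dev_cst.
Proof.
rewrite /dev_cst addr_ge0// ?invr_ge0 ?mulr_ge0 ?invr_ge0 ?divr_ge0 ?mulr_ge0 ?ltW// rad_gt0.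
Qed.

Lemma regular_ratio {d n} {V : 'rV[R]_d -> R} {P Q} : @regular_sample R L M m d n V P Q ->
  0 < (d%:R / n%:R : R) <= 1.
Proof.
move=> [_ _ d0 dn _]; have n0 := leq_trans d0 dn.
by rewrite divr_gt0 ?ltr0n//= ler_pdivrMr ?ltr0n// mul1r ler_nat.
Qed.

Lemma dev_powR : exists2 C : R, 0 <= C &
  forall d n (V : 'rV[R]_d -> R) (P : probability 'rV[R]_d R) (Q : probability (n.-tuple 'rV[R]_d) R),
  regular_sample L M m V P Q -> forall a, 0 <= a <= 2 ->
  mean_le Q (fun x => dev L m V P x `^ a) (C * Num.sqrt (d%:R / n%:R) `^ a).
Proof.
have [C C0 h] := dev_moment L0 M0 m0 1; exists (1 + C) => [|d n V P Q RS a a02]; first by rewrite addr_ge0.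
have /andP[q0 _] := regular_ratio RS; set q := d%:R / n%:R in q0 *.
set D := Num.sqrt q; have D0 : 0 < D by rewrite sqrtr_gt0.
have DD : D ^+ 2 = q by rewrite sqr_sqrtr// ltW.
apply: (@mean_leS _ _ _ _ _ (fun x => D `^ a * (1 + q^-1 * dev L m V P x ^+ (2 * 1)))).
- apply: (@measurableT_comp _ _ _ _ _ _ (fun t : R => t `^ a)).
    exact: measurable_powR.
  exact: (measurable_dev RS).
- by move=> x; exact: powR_ge0.
- move=> x; rewrite muln1 -DD [_^-1 * _]mulrC; apply: powR_le_sqr => //; exact: dev_ge0.
rewrite mulrC; apply: mean_leZ; first exact: powR_ge0.
apply: mean_leD; first exact: mean_le_cst.
have -> : C = q^-1 * (C * q ^+ 1) by rewrite expr1 mulrCA mulVf ?mulr1// gt_eqF.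
by apply: mean_leZ; [rewrite invr_ge0 ltW|exact: (h _ _ _ _ _ RS)].
Qed.

(** Two offsets [c] matter: [sqrt d], from the Hessian part of [dev_upd], and 1, from the
    displacement of the estimator. *)
Lemma score_increment_moment (p : nat) : exists2 C : R, 0 <= C &
  forall d n (V : 'rV[R]_d -> R) (P : probability 'rV[R]_d R) (Q : probability (n.-tuple 'rV[R]_d) R),
  regular_sample L M m V P Q -> forall c, 0 <= c <= Num.sqrt d%:R ->
  mean_le P (fun y => (enorm (gradient V y) + c) ^+ (2 * p)) (C * d%:R ^+ p).
Proof.
exists (2 ^+ (2 * p) * ((2 * p)`!%:R * (2 * expR M) + 1)) => [|d n V P Q RS c /andP[c0 cd]].
  by rewrite mulr_ge0 ?exprn_ge0// addr_ge0// !mulr_ge0// expR_ge0.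
have [PV A1 d0 dn QP] := RS; have [V_sc V_C2 V_M V_L V_I] := A1.
have mD : measurable_fun [set: 'rV[R]_d] (fun y => enorm (gradient V y)).
  by apply: measurable_fun_enorm; exact: measurable_gradient.
apply: (@mean_leS _ _ _ _ _ (fun y => 2 ^+ (2 * p) * (enorm (gradient V y) ^+ (2 * p) + d%:R ^+ p))).
- by apply: measurable_funX; apply: measurable_funD.
- by move=> x; rewrite exprn_ge0// addr_ge0.
- move=> y; apply: (le_trans (exprD_le _ _ _)) => //; rewrite ler_wpM2l ?exprn_ge0// lerD2l.
  by rewrite -[d%:R]sqr_sqrtr// -exprM lerXn2r// nnegrE sqrtr_ge0.
rewrite -mulrA mulrDl mul1r; apply: mean_leZ; first by rewrite exprn_ge0.
apply: mean_leD; last by apply: mean_le_cst; rewrite exprn_ge0.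
split; [exact: measurable_funX|by move=> x; rewrite exprn_ge0|].
by rewrite mulrC; exact: (score_norm_moment M0 V_C2 V_M PV p).
Qed.

Lemma dev_upd_moment (p : nat) : exists2 C : R, 0 <= C &
  forall d n (V : 'rV[R]_d -> R) (P : probability 'rV[R]_d R) (Q : probability (n.-tuple 'rV[R]_d) R),
  regular_sample L M m V P Q -> forall i z, gradient V z = 0 ->
  mean_le Q (fun x => dev L m V P (upd i z x) ^+ (2 * p)) (C * (d%:R / n%:R) ^+ p).
Proof.
have [C C0 h] := dev_moment L0 M0 m0 p.
have [K K0 hK] := score_increment_moment p.
exists (2 ^+ (2 * p) * (C + dev_cst ^+ (2 * p) * K)) => [|d n V P Q RS i z z0].
  by rewrite mulr_ge0 ?exprn_ge0// addr_ge0// mulr_ge0// exprn_ge0// dev_cst_ge0.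
have [PV A1 d0 dn QP] := RS; have n0 : (0 < n)%N by exact: leq_trans d0 dn.
have mT := measurable_dev RS.
set D := Num.sqrt (d%:R : R).
pose f (x : n.-tuple 'rV[R]_d) := 2 ^+ (2 * p) * (dev L m V P x ^+ (2 * p) +
  dev_cst ^+ (2 * p) * (n%:R^-1 ^+ (2 * p) * (enorm (gradient V (tnth x i)) + D) ^+ (2 * p))).
have u0 (x : n.-tuple 'rV[R]_d) : 0 <= dev_cst * (n%:R^-1 * (enorm (gradient V (tnth x i)) + D)).
  by rewrite mulr_ge0 ?dev_cst_ge0// mulr_ge0 ?invr_ge0// addr_ge0 ?sqrtr_ge0.
apply: (@mean_leS _ _ _ _ _ f).
- apply: measurable_funX; exact: (measurableT_comp mT (measurable_updr i z)).
- by move=> x; rewrite exprn_ge0// dev_ge0.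
- move=> x; rewrite /f -!exprMn; apply: le_trans (exprD_le _ _ _) => //; last exact: dev_ge0.
  have g0 := dev_ge0 L0 m0 V P (upd i z x); have g1 := dev_ge0 L0 m0 V P x.
  have h1 := ler_dist_swap (dev_upd RS i x z0).
  exact: ler_exprn g0 h1.
rewrite -mulrA; apply: mean_leZ; first by rewrite exprn_ge0.
rewrite mulrDl; apply: mean_leD; first exact: (h _ _ _ _ _ RS).
rewrite -mulrA; apply: mean_leZ; first by rewrite exprn_ge0// dev_cst_ge0.
apply: (@mean_le_weak _ _ _ _ _ (n%:R^-1 ^+ (2 * p) * (K * d%:R ^+ p))).
  rewrite mulrCA ler_wpM2l// expr_div_n mulrC ler_wpM2l ?exprn_ge0// -exprVn exprM.
  rewrite lerXn2r ?nnegrE ?sqr_ge0 ?invr_ge0// expr2 ler_piMr ?invr_ge0// invf_le1 ?ltr0n//.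
  by rewrite ler1n.
apply: mean_leZ; first by rewrite exprn_ge0// invr_ge0.
apply: (marginal RS i (h := fun y => (enorm (gradient V y) + D) ^+ (2 * p))).
by apply: (hK _ _ _ _ _ RS); rewrite sqrtr_ge0 lexx.
Qed.

(** Summed over the [n] observations this gives [(d / n) ^+ p.+1]: the Lipschitz gain is of order
    [d / n ^ 2], and the chance of leaving the flat part of the cutoff is of order
    [(d / n) ^+ p]. *)
Lemma cutoff_increment (p : nat) : exists2 C : R, 0 <= C &
  forall d n (V : 'rV[R]_d -> R) (P : probability 'rV[R]_d R) (Q : probability (n.-tuple 'rV[R]_d) R),
  regular_sample L M m V P Q -> forall i z, gradient V z = 0 ->
  mean_le Q (fun x => (cutoff (dev L m V P x) - cutoff (dev L m V P (upd i z x))) ^+ 2)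
    (C * ((d%:R / n%:R) ^+ p.+1 / n%:R)).
Proof.
have [C1 C10 h1] := dev_moment L0 M0 m0 (2 * p).
have [C2 C20 h2] := dev_upd_moment (2 * p).
have [K K0 hK] := score_increment_moment 2.
pose a : R := 2 ^+ (2 * (2 * p)).
have a0 : 0 <= a by rewrite exprn_ge0.
exists (4 * (dev_cst ^+ 4 * K + 2 ^+ 2 * (a * C1 + a * C2))) => [|d n V P Q RS i z z0].
  by rewrite mulr_ge0// addr_ge0// ?mulr_ge0// ?exprn_ge0 ?dev_cst_ge0// addr_ge0// mulr_ge0.
have [PV A1 d0 dn QP] := RS; have n0 : (0 < n)%N by exact: leq_trans d0 dn.
have nn : 0 < n%:R :> R by rewrite ltr0n.
have dd : 0 < d%:R :> R by rewrite ltr0n.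
have mT := measurable_dev RS.
have mT' : measurable_fun setT (fun x => dev L m V P (upd i z x)) by exact: (measurableT_comp mT (measurable_updr i z)).
set D := Num.sqrt (d%:R : R); set q : R := d%:R / n%:R.
have q0 : 0 < q by rewrite divr_gt0.
(* This weight in Young's inequality balances [u ^+ 4], of order [d ^ 2 / n ^ 4], against the
   squared tail, of order [q ^+ (2 * p)]. *)
pose k : R := q ^+ p * (n%:R ^+ 2 / d%:R).
have k0 : 0 < k by rewrite mulr_gt0 ?exprn_gt0// divr_gt0 ?exprn_gt0.
pose u (x : n.-tuple 'rV[R]_d) := dev_cst * (n%:R^-1 * (enorm (gradient V (tnth x i)) + D)).
pose A (x : n.-tuple 'rV[R]_d) := dev L m V P x.
pose A' (x : n.-tuple 'rV[R]_d) := dev L m V P (upd i z x).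
pose f x := 4 * (k * u x ^+ 4 + k^-1 * (2 ^+ 2 * (a * A x ^+ (2 * (2 * p)) + a * A' x ^+ (2 * (2 * p))))).
apply: (@mean_leS _ _ _ _ _ f).
- exact: measurable_cutoff_diff mT mT'.
- by move=> x; exact: sqr_ge0.
- move=> x; have Ax : 0 <= A x by exact: dev_ge0.
  have Ax' : 0 <= A' x by exact: dev_ge0.
  exact: cutoff_young k0 Ax Ax' (dev_upd RS i x z0).
have -> : 4 * (dev_cst ^+ 4 * K + 2 ^+ 2 * (a * C1 + a * C2)) * (q ^+ p.+1 / n%:R) =
  4 * (k * (dev_cst ^+ 4 * (n%:R^-1 ^+ 4 * (K * d%:R ^+ 2))) +
   k^-1 * (2 ^+ 2 * (a * (C1 * q ^+ (2 * p)) + a * (C2 * q ^+ (2 * p))))).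
  have e1 : k * (n%:R^-1 ^+ 4 * d%:R ^+ 2) = q ^+ p.+1 / n%:R.
    by rewrite /k [q ^+ p.+1]exprS; move: (q ^+ p) => w; rewrite /q; field; rewrite !gt_eqF.
  have e2 : k^-1 * q ^+ (2 * p) = q ^+ p.+1 / n%:R.
    have w0 : 0 < q ^+ p by rewrite exprn_gt0.
    rewrite /k mulnC exprM [q ^+ p.+1]exprS; move: (q ^+ p) w0 => w w0; rewrite /q; field.
    by rewrite !gt_eqF.
  have -> : k * (dev_cst ^+ 4 * (n%:R^-1 ^+ 4 * (K * d%:R ^+ 2))) = dev_cst ^+ 4 * K * (k * (n%:R^-1 ^+ 4 * d%:R ^+ 2)) by ring.
  rewrite e1; have -> : k^-1 * (2 ^+ 2 * (a * (C1 * q ^+ (2 * p)) + a * (C2 * q ^+ (2 * p)))) =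
    2 ^+ 2 * (a * C1 + a * C2) * (k^-1 * q ^+ (2 * p)) by ring.
  by rewrite e2; ring.
apply: mean_leZ => //; apply: mean_leD; apply: mean_leZ; rewrite ?invr_ge0 ?(ltW k0)//.
  rewrite (_ : (fun x => _) = fun x : n.-tuple 'rV[R]_d => dev_cst ^+ 4 * (n%:R^-1 ^+ 4 *
    (enorm (gradient V (tnth x i)) + D) ^+ 4)); last by apply/funext => x; rewrite /u !exprMn.
  apply: mean_leZ; first by rewrite exprn_ge0// dev_cst_ge0.
  apply: mean_leZ; first by rewrite exprn_ge0// invr_ge0 ltW.
  apply: (marginal RS i (h := fun y => (enorm (gradient V y) + D) ^+ 4)).
  by apply: (hK _ _ _ _ _ RS); rewrite sqrtr_ge0 lexx.
apply: mean_leZ; first by rewrite exprn_ge0.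
apply: mean_leD; apply: mean_leZ => //; first exact: (h1 _ _ _ _ _ RS).
exact: (h2 _ _ _ _ _ RS).
Qed.

End deviations.

(** * Derivatives recognised from Taylor bounds *)

Section real_taylor.
Context {R : realType}.

(** Uniform Taylor bounds survive integration, so this criterion is how differentiation under the
    integral is obtained later. *)
Lemma is_derive_of_taylor (phi : R -> R) (t c K rho : R) : 0 <= K -> 0 < rho ->
  (forall h, `|phi (t + h) - phi t - h * c| <= K * (`|h| * `|h| `^ rho)) ->
  is_derive t (1 : R) phi c.
Proof.
move=> K0 r0 hphi.
have cv : (fun h => h^-1 *: ((phi \o shift t) (h *: (1 : R)) - phi t)) @ 0^' --> c.
  apply/(@cvgrPdist_le _ _ _ (0^')) => e e0.
  have K1 : 0 < K + 1 by rewrite ltr_wpDl.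
  pose r := (e / (K + 1)) `^ rho^-1.
  have rr : 0 < r by rewrite powR_gt0// divr_gt0.
  near=> h.
  have h0 : h != 0 by near: h; exact: nbhs_dnbhs_neq.
  have hr : `|h| <= r.
    near: h; apply: dnbhs0_le => //.
  have nh : 0 < `|h| by rewrite normr_gt0.
  rewrite distrC.
  have -> : h^-1 *: ((phi \o shift t) (h *: (1 : R)) - phi t) - c = h^-1 * (phi (t + h) - phi t - h * c).
    rewrite /= -[_ *: (phi _ - _)]/(_ * (_ - _)) -[h *: 1]/(h * 1) mulr1 [h + t]addrC.
    by rewrite [RHS]mulrBr [h^-1 * (h * c)]mulKf.
  rewrite normrM normfV mulrC ler_pdivrMr//; apply: le_trans (hphi h) _.
  rewrite [`|h| * _]mulrC mulrA ler_wpM2r//.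
  have hp : `|h| `^ rho <= e / (K + 1).
    have -> : e / (K + 1) = r `^ rho.
      by rewrite /r -powRrM mulVf ?gt_eqF// powRr1// divr_ge0 ?ltW.
    by apply: ge0_ler_powR; rewrite ?nnegrE// ltW.
  apply: (@le_trans _ _ ((K + 1) * (`|h| `^ rho))).
    by rewrite ler_wpM2r ?powR_ge0// lerDl.
  by rewrite mulrC -ler_pdivlMr.
by split; [apply/cvg_ex; exists c|exact: cvg_lim cv].
Unshelve. all: by end_near.
Qed.

Lemma taylor_of_is_derive (phi dphi : R -> R) (K rho : R) : 0 <= K -> 0 < rho ->
  (forall t, is_derive t (1 : R) phi (dphi t)) ->
  (forall t, `|dphi t - dphi 0| <= K * `|t| `^ rho) ->
  forall t, 0 <= t -> `|phi t - phi 0 - t * dphi 0| <= K * (t * t `^ rho).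
Proof.
move=> K0 r0 dph hd t t0.
pose g s := phi s - s * dphi 0.
have dg s : is_derive s (1 : R) g (dphi s - dphi 0).
  have := is_deriveB (dph s) (is_deriveM (is_derive_id s (1 : R)) (is_derive_cst (dphi 0) s (1 : R))).
  by rewrite scaler0 add0r -[_ *: 1]/(_ * 1) mulr1.
have := derive_bound t0 dg (B := K * t `^ rho).
rewrite /g mul0r subr0 => /(_ _)/wrap[s /andP[s0 st]|h].
  apply: le_trans (hd s) _; rewrite (ger0_norm s0) ler_wpM2l//.
  by apply: ge0_ler_powR => //; rewrite ?nnegrE// ltW.
by rewrite addrAC; apply: le_trans h _; rewrite mulrAC mulrA.
Qed.

End real_taylor.

(** * Jets of Hoelder functions *)

Section jets.
Context {R : realType} {d : nat}.
Implicit Types (G : seq 'rV[R]_d -> 'rV[R]_d -> R) (vs : seq 'rV[R]_d) (A rho : R).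

Definition unit_seq vs := all (fun v => enorm v <= 1) vs.

(* G vs x stands for the derivative of G [::] at x along the directions vs. *)
Definition jet (l : nat) rho A G : Prop :=
  [/\ forall vs x, unit_seq vs -> (size vs <= l)%N -> `|G vs x| <= A,
      forall vs x y, unit_seq vs -> size vs = l -> `|G vs x - G vs y| <= A * enorm (x - y) `^ rho,
      forall vs u x (t : R), unit_seq (u :: vs) -> (size vs < l)%N ->
        is_derive t (1 : R) (fun s : R => G vs (x + s *: u)) (G (u :: vs) (x + t *: u)) &
      forall x v, (0 < l)%N -> G [:: v] x = \sum_i v ord0 i * G [:: delta_mx ord0 i] x].

Section one_jet.
Variables (l : nat) (rho A : R) (G : seq 'rV[R]_d -> 'rV[R]_d -> R).
Hypotheses (rho0 : 0 < rho) (rho1 : rho <= 1) (A0 : 0 <= A) (jG : jet l rho A G).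

Lemma row_direction (x y : 'rV[R]_d) : exists u, enorm u <= 1 /\ y = x + enorm (y - x) *: u.
Proof.
have [->|xy] := eqVneq y x; first by exists 0; rewrite enorm0 ler01 subrr enorm0 scale0r addr0.
have n0 : 0 < enorm (y - x) by rewrite enorm_gt0 subr_eq0.
exists ((enorm (y - x))^-1 *: (y - x)); rewrite enormZ ger0_norm ?invr_ge0//.
rewrite mulVf ?gt_eqF// lexx scalerA mulfV ?gt_eqF// scale1r.
by split => //; rewrite addrC subrK.
Qed.

Lemma jet_lip vs x y : unit_seq vs -> (size vs < l)%N -> `|G vs x - G vs y| <= A * enorm (x - y).
Proof.
have [h1 _ h3 _] := jG => uvs sl.
have [u [u1 e]] := row_direction y x.
have us : unit_seq (u :: vs) by rewrite /unit_seq /= u1.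
have := derive_bound (enorm_ge0 (x - y)) (fun t => h3 vs u y t us sl) (fun t _ => h1 (u :: vs) _ us sl).
by rewrite scale0r addr0 -e.
Qed.

Lemma min_powR (a : R) : 0 <= a -> Num.min 2 a <= 2 * a `^ rho.
Proof.
move=> a0; have [a1|a1] := leP 1 a.
  apply: (@le_trans _ _ 2); first by rewrite ge_min lexx.
  rewrite -[leLHS]mulr1 ler_wpM2l//; have e1 : 1 `^ rho = 1 :> R by rewrite powR1.
  by rewrite -{1}e1; apply: ge0_ler_powR; rewrite ?nnegrE// ltW.
apply: (@le_trans _ _ a); first by rewrite ge_min lexx orbT.
have [->|an0] := eqVneq a 0; first by rewrite mulr_ge0// powR_ge0.
have ap : 0 < a by rewrite lt_neqAle eq_sym an0.
apply: (@le_trans _ _ (a `^ rho)); last by rewrite ler_peMl ?powR_ge0// ler1n.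
rewrite -{1}(powRr1 a0); apply: ger_powR => //; by rewrite ap ltW.
Qed.

(** Below the top order, interpolate through [min_powR] between the bound [2 * A] and the Lipschitz
    bound, so that all orders share one modulus. *)
Lemma jet_hoelder vs x y : unit_seq vs -> (size vs <= l)%N ->
  `|G vs x - G vs y| <= 2 * A * enorm (x - y) `^ rho.
Proof.
have [h1 h2 _ _] := jG => uvs; rewrite leq_eqVlt => /predU1P[sl|sl].
  apply: le_trans (h2 _ _ _ uvs sl) _; rewrite ler_wpM2r ?powR_ge0//.
  by rewrite ler_peMl// ler1n.
rewrite mulrAC mulrC; apply: (@le_trans _ _ (A * Num.min 2 (enorm (x - y)))).
  rewrite minr_pMr// le_min jet_lip// andbT; apply: le_trans (ler_normB _ _) _.
  by rewrite mulr2n mulrDr mulr1 lerD// h1// ltnW.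
by rewrite ler_wpM2l// min_powR.
Qed.

Lemma jet_continuous vs : unit_seq vs -> (size vs <= l)%N -> continuous (G vs).
Proof.
move=> uvs sl x; apply/(@cvgrPdist_le _ _ _ (nbhs x)) => e e0.
have K1 : 0 < 2 * A + 1 by rewrite ltr_wpDl// mulr_ge0.
pose r := (e / (2 * A + 1)) `^ rho^-1.
have rr : 0 < r by rewrite powR_gt0// divr_gt0.
have := near_enorm x rr; apply: filterS => y xy.
apply: le_trans (jet_hoelder x y uvs sl) _.
have hp : enorm (x - y) `^ rho <= e / (2 * A + 1).
  have -> : e / (2 * A + 1) = r `^ rho.
    by rewrite /r -powRrM mulVf ?gt_eqF// powRr1// divr_ge0 ?ltW.
  by apply: ge0_ler_powR; rewrite ?nnegrE// ltW.
apply: (@le_trans _ _ ((2 * A + 1) * (enorm (x - y) `^ rho))).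
  by rewrite ler_wpM2r ?powR_ge0// lerDl.
by rewrite mulrC -ler_pdivlMr.
Qed.

Lemma jet_taylor_ge0 vs u x (t : R) : unit_seq (u :: vs) -> (size vs < l)%N -> 0 <= t ->
  `|G vs (x + t *: u) - G vs x - t * G (u :: vs) x| <= 2 * A * (t * t `^ rho).
Proof.
have [_ _ h3 _] := jG => us sl t0; have A20 : 0 <= 2 * A by rewrite mulr_ge0.
have := taylor_of_is_derive A20 rho0 (fun s => h3 vs u x s us sl).
rewrite !scale0r !addr0 => h; apply: h => // s.
apply: le_trans (jet_hoelder _ _ us sl) _; rewrite [X in enorm (X - _)]addrC addrK enormZ.
rewrite ler_wpM2l//; apply: ge0_ler_powR; rewrite ?nnegrE ?mulr_ge0 ?(ltW rho0)//.
by case/andP: us => u1 _; rewrite ler_piMr.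
Qed.

(** A jet carries linearity in the direction at order one only; oddness at higher orders is
    recovered by reversing the line. *)
Lemma jet_opp vs v x : unit_seq (v :: vs) -> (size vs < l)%N -> G (- v :: vs) x = - G (v :: vs) x.
Proof.
have [_ _ h3 _] := jG => us sl.
have us' : unit_seq (- v :: vs) by move: us; rewrite /unit_seq /= enormN.
have d1 := h3 vs (- v) x 0 us' sl; have d2 := h3 vs v x (- 0) us sl.
have dn : is_derive (0 : R) (1 : R) (fun s : R => - s) (-1).
  exact: is_deriveNid.
have := @is_derive1_comp R (fun s : R => G vs (x + s *: v)) (fun s : R => - s) 0 _ _ d2 dn.
rewrite (_ : _ \o _ = fun s : R => G vs (x + s *: - v)); last first.
  by apply/funext => s /=; rewrite scalerN scaleNr.
move=> d3; have := @derive_val _ _ _ _ _ _ _ d1; rewrite (@derive_val _ _ _ _ _ _ _ d3).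
by rewrite oppr0 !scale0r !addr0 => <-; rewrite mulrN1.
Qed.

Lemma jet_taylor vs u x (t : R) : unit_seq (u :: vs) -> (size vs < l)%N ->
  `|G vs (x + t *: u) - G vs x - t * G (u :: vs) x| <= 2 * A * (`|t| * `|t| `^ rho).
Proof.
move=> us sl; have [t0|t0] := leP 0 t; first by rewrite (ger0_norm t0); exact: jet_taylor_ge0.
rewrite (ltr0_norm t0).
have us' : unit_seq (- u :: vs) by move: us; rewrite /unit_seq /= enormN.
have t1 : 0 <= - t by rewrite oppr_ge0 ltW.
by have := jet_taylor_ge0 x us' sl t1; rewrite jet_opp// scalerN scaleNr opprK mulrNN.
Qed.

End one_jet.

(** Dropping the top order turns its bound into a Lipschitz bound one order below, so the exponent
    becomes 1. *)
Lemma jet_lower l rho A G : 0 < rho <= 1 -> 0 <= A -> jet l.+1 rho A G -> jet l 1 A G.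
Proof.
move=> /andP[r0 r1] A0 jG; have [h1 h2 h3 h4] := jG; split.
- by move=> vs x uvs sl; apply: h1 => //; exact: leqW.
- by move=> vs x y uvs sl; rewrite powRr1//; apply: (jet_lip jG) => //; rewrite sl.
- by move=> vs u x t us sl; apply: h3 => //; exact: ltnW.
- by move=> x v _; exact: h4.
Qed.

Lemma jet_comb l rho A B a G H : `|a| <= 1 -> jet l rho A G -> jet l rho B H ->
  jet l rho (A + B) (fun vs x => a * G vs x + H vs x).
Proof.
move=> a1 [g1 g2 g3 g4] [h1 h2 h3 h4].
have sc (x y c : R) : `|x| <= c -> `|a * x| <= c.
  by move=> xc; rewrite normrM; apply: le_trans xc; rewrite ler_piMl.
split.
- move=> vs x uvs sl; apply: le_trans (ler_normD _ _) _; apply: lerD; last exact: h1.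
  by apply: sc => //; exact: g1.
- move=> vs x y uvs sl.
  have -> : a * G vs x + H vs x - (a * G vs y + H vs y) = a * (G vs x - G vs y) + (H vs x - H vs y) by ring.
  apply: le_trans (ler_normD _ _) _; rewrite mulrDl; apply: lerD; last exact: h2.
  by apply: sc => //; exact: g2.
- move=> vs u x t us sl.
  have := is_deriveD (is_deriveZ a (g3 vs u x t us sl)) (h3 vs u x t us sl).
  exact.
- move=> x v l0; rewrite g4// h4// mulr_sumr -big_split /=; apply: eq_bigr => i _; ring.
Qed.

End jets.

Section jet_gradient.
Context {R : realType} {d : nat}.
Variables (rho A : R) (F : seq 'rV[R]_d -> 'rV[R]_d -> R).
Hypotheses (rho0 : 0 < rho) (rho1 : rho <= 1) (A0 : 0 <= A) (jF : jet 1 rho A F).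

Definition jet_grad (x : 'rV[R]_d) : 'rV[R]_d := \row_i F [:: delta_mx ord0 i] x.

Lemma jet_gradE x v : F [:: v] x = dot (jet_grad x) v.
Proof.
have [_ _ _ h4] := jF; rewrite h4// dotE; apply: eq_bigr => i _.
by rewrite mulrC [X in _ = X * _]mxE.
Qed.

Lemma enorm_jet_grad x : enorm (jet_grad x) <= A.
Proof.
have [h1 _ _ _] := jF; apply: enorm_le_dot => // u u1.
rewrite dotC -jet_gradE; apply: le_trans (ler_norm _) _; apply: h1 => //.
by rewrite /unit_seq /= u1.
Qed.

Lemma jet_grad_taylor x z :
  `|F [::] (x + z) - F [::] x - dot (jet_grad x) z| <= 2 * A * (enorm z * enorm z `^ rho).
Proof.
have [u [u1 e]] := row_direction 0 z; rewrite subr0 add0r in e.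
have us : unit_seq [:: u] by rewrite /unit_seq /= u1.
have := jet_taylor rho0 rho1 A0 jF x (enorm z) us (isT : (size (@nil 'rV[R]_d) < 1)%N).
by rewrite jet_gradE -dotZr -e (ger0_norm (enorm_ge0 z)).
Qed.

End jet_gradient.

Section hoelder_jet.
Context {R : realType} {d : nat}.

Lemma hoelder_ball_jet l rho (f : 'rV[R]_d -> R) : 0 < rho ->
  hoelder_ball l rho f -> jet l rho 1 (iter_diff f).
Proof.
move=> rho0 [df]; rewrite /hoelder_norm ge_max => /andP[h1 h2].
have unit_tnth (vs : seq 'rV[R]_d) : unit_seq vs -> forall i, enorm (tnth (in_tuple vs) i) <= 1.
  by move=> /allP uvs i; apply: uvs; exact: mem_tnth.
split.
- move=> vs x uvs sl; rewrite -lee_fin; apply: le_trans h1.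
  have sl' : (size vs < l.+1)%N by rewrite ltnS.
  have hb := @le_bigmax _ _ _ 0%E (fun j : 'I_l.+1 =>
    ereal_sup [set formnorm (@deriv_form R d f j x) | x in [set: 'rV[R]_d]]) (Ordinal sl').
  apply: le_trans hb; apply: (@le_trans _ _ (formnorm (@deriv_form R d f (size vs) x))).
    apply: ereal_sup_ubound => /=; exists (in_tuple vs) => //=; exact: unit_tnth.
  by apply: ereal_sup_ubound; exists x.
- move=> vs x y uvs sl; rewrite mul1r.
  have [->|xy] := eqVneq x y.
    by rewrite subrr normr0 powR_ge0.
  have p0 : 0 < enorm (x - y) `^ rho by rewrite powR_gt0// enorm_gt0 subr_eq0.
  rewrite -[leRHS]mul1r -ler_pdivrMr// -lee_fin; apply: le_trans h2.
  apply: (@le_trans _ _ (formnorm (fun vs => (@deriv_form R d f l x vs - @deriv_form R d f l y vs)%R)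
             * ((enorm (x - y) `^ rho)^-1)%:E)%E); last first.
    by apply: ereal_sup_ubound; exists (x, y).
  rewrite EFinM lee_wpmul2r//; first by rewrite lee_fin invr_ge0 ltW.
  subst l; apply: ereal_sup_ubound => /=; exists (in_tuple vs) => //=; exact: unit_tnth.
- by move=> vs u x t us sl; apply: is_derive_line; exact: df.
- move=> x v _; rewrite /= {1}(row_sum_delta v) linear_sum; apply: eq_bigr => i _.
  by rewrite linearZ.
Qed.

End hoelder_jet.

(** * The bias operator on jets and its Neumann series *)

Section averaging.
Context {R : realType} {d : nat} {dS} {S : measurableType dS} (Q : probability S R).
Variable Z : S -> 'rV[R]_d.
Hypothesis mZ : measurable_fun [set: S] Z.
Implicit Types (G : seq 'rV[R]_d -> 'rV[R]_d -> R).

(** The bias operator applied to all derivatives at once; commuting with differentiation, it maps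
    jets to jets. With the error law and [vs = [::]] it is [B_op]. *)
Definition avg G vs x : R := \int[Q]_w G vs (x + Z w) - G vs x.

Section one_jet.
Variables (l : nat) (rho A : R) (G : seq 'rV[R]_d -> 'rV[R]_d -> R).
Hypotheses (rho0 : 0 < rho) (rho1 : rho <= 1) (A0 : 0 <= A) (jG : jet l rho A G).

Lemma jet_measurable vs x : unit_seq vs -> (size vs <= l)%N ->
  bounded_measurable (fun w => G vs (x + Z w)).
Proof.
have [h1 _ _ _] := jG => uvs sl; split; last by exists A => w; exact: h1.
apply: measurableT_comp.
  by apply: measurable_enorm_continuous; exact: jet_continuous jG _ uvs sl.
by apply: measurable_fun_rowD => //; exact: measurable_cst.
Qed.

Lemma jet_integrable vs x : unit_seq vs -> (size vs <= l)%N ->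
  Q.-integrable setT (EFin \o (fun w => G vs (x + Z w))).
Proof. by move=> uvs sl; exact/bounded_measurable_integrable/jet_measurable. Qed.

(** The Taylor remainder [D] is bounded uniformly in the base point, so its average obeys the same
    bound; subtracting its value at 0 gives the remainder of [avg]. *)
Lemma avg_derive vs u x (t : R) : unit_seq (u :: vs) -> (size vs < l)%N ->
  is_derive t (1 : R) (fun s : R => avg G vs (x + s *: u)) (avg G (u :: vs) (x + t *: u)).
Proof.
move=> us sl; have uvs : unit_seq vs by case/andP: us.
have K0 : 0 <= 4 * A by rewrite mulr_ge0.
apply: (is_derive_of_taylor K0 rho0) => h; set y := x + t *: u.
have -> : x + (t + h) *: u = y + h *: u by rewrite scalerDl addrA.
have slw := ltnW sl.
pose D w := G vs (y + w + h *: u) - G vs (y + w) - h * G (u :: vs) (y + w).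
have hD w : `|D w| <= 2 * A * (`|h| * `|h| `^ rho) by exact: (jet_taylor rho0 rho1 A0 jG).
have D00 : D 0 = G vs (y + h *: u) - G vs y - h * G (u :: vs) y by rewrite /D !addr0.
have b1 : bounded_measurable (fun w => G vs (y + Z w + h *: u)).
  rewrite (_ : (fun w => _) = fun w => G vs (y + h *: u + Z w)); first exact: jet_measurable.
  by apply/funext => w; rewrite addrAC.
have b2 : bounded_measurable (fun w => G vs (y + Z w)) by exact: jet_measurable.
have b3 : bounded_measurable (fun w => h * G (u :: vs) (y + Z w)).
  by apply: bounded_measurableM; [exact: bounded_measurable_cst|exact: jet_measurable].
have eD : \int[Q]_w D (Z w) = \int[Q]_w G vs (y + h *: u + Z w) - \int[Q]_w G vs (y + Z w)
    - h * \int[Q]_w G (u :: vs) (y + Z w).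
  rewrite /D RintegralB//; last 2 first.
  - by apply: bounded_measurable_integrable; exact: bounded_measurableB.
  - exact: bounded_measurable_integrable.
  rewrite RintegralB//; try exact: bounded_measurable_integrable.
  rewrite RintegralZl//; last by apply: jet_integrable.
  by congr (_ - _ - _); apply: eq_Rintegral => w _; rewrite addrAC.
have hI : `|\int[Q]_w D (Z w)| <= 2 * A * (`|h| * `|h| `^ rho).
  apply: (mean_le_normr (f := fun=> 2 * A * (`|h| * `|h| `^ rho))) => //.
    by have [] : bounded_measurable (fun w => D (Z w)) by do 2?apply: bounded_measurableB.
  by apply: mean_le_cst; rewrite mulr_ge0 ?mulr_ge0 ?powR_ge0.
have -> : avg G vs (y + h *: u) - avg G vs y - h * avg G (u :: vs) y = \int[Q]_w D (Z w) - D 0.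
  rewrite eD D00 /avg.
  have aux (a b c a' b' c' : R) : a - a' - (b - b') - h * (c - c') = a - b - h * c - (a' - b' - h * c').
    by ring.
  exact: aux.
apply: le_trans (ler_normB _ _) _; apply: le_trans (lerD hI (hD 0)) _.
by rewrite -mulrDl; apply: ler_wpM2r; [rewrite mulr_ge0 ?powR_ge0|lra].
Qed.

Lemma avg_linear x v : (0 < l)%N -> avg G [:: v] x = \sum_i v ord0 i * avg G [:: delta_mx ord0 i] x.
Proof.
have [_ _ _ h4] := jG => l0; rewrite /avg h4//.
under eq_Rintegral do rewrite h4//.
have ii i : Q.-integrable setT (EFin \o (fun w => G [:: delta_mx ord0 i] (x + Z w))).
  by apply: jet_integrable => //; rewrite /unit_seq /= enorm_delta lexx.
rewrite Rintegral_sum; last by move=> i; exact: integrable_realZ.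
rewrite -sumrB; apply: eq_bigr => i _.
by rewrite RintegralZl// mulrBr.
Qed.

Lemma jet_avg : jet l rho (2 * A) (avg G).
Proof.
have [h1 h2 _ _] := jG.
have dbl (a b c : R) : `|a| <= c -> `|b| <= c -> `|a - b| <= 2 * c.
  by move=> ac bc; apply: le_trans (ler_normB _ _) _; rewrite mulr2n mulrDl mul1r lerD.
split; [|move=> vs x y uvs sl|exact: avg_derive|exact: avg_linear].
  move=> vs x uvs sl; apply: dbl; last exact: h1.
  apply: (mean_le_normr (f := fun=> A)); last exact: mean_le_cst.
    by have [] := jet_measurable x uvs sl.
  by move=> w; exact: h1.
have sl' : (size vs <= l)%N by rewrite sl.
have -> : avg G vs x - avg G vs y = (\int[Q]_w (G vs (x + Z w) - G vs (y + Z w))) - (G vs x - G vs y).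
  rewrite RintegralB//; [by rewrite /avg; ring|exact: jet_integrable|exact: jet_integrable].
rewrite -mulrA; apply: dbl; last exact: h2.
apply: (mean_le_normr (f := fun=> A * enorm (x - y) `^ rho)); last first.
- by apply: mean_le_cst; rewrite mulr_ge0 ?powR_ge0.
- move=> w; apply: le_trans (h2 _ _ _ uvs sl) _.
  by rewrite opprD addrACA subrr addr0.
- by have [] := bounded_measurableB (jet_measurable x uvs sl') (jet_measurable y uvs sl').
Qed.

End one_jet.

(** An increment along [Z] is at most [enorm Z] times a bound of the next derivative, and at most a
    constant in any case; hence the price [Num.min 1 (enorm Z)], whose mean is finite whatever the
    law of [Z]. For the Hoelder modulus, the same is done with the difference of two parallel
    increments. *)
Lemma jet_avg_lower l rho A G b : 0 < rho <= 1 -> 0 <= A -> jet l.+1 rho A G ->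
  mean_le Q (fun w => Num.min 1 (enorm (Z w))) b -> jet l rho (4 * b * A) (avg G).
Proof.
move=> /andP[r0 r1] A0 jG hb; have [h1 h2 h3 h4] := jG.
have b0 := mean_le_ge0 hb.
split.
- move=> vs x uvs sl; have slw := leqW sl.
  have -> : avg G vs x = \int[Q]_w (G vs (x + Z w) - G vs x).
    rewrite RintegralB//; first by rewrite Rintegral_cst1.
      exact: (jet_integrable r0 r1 A0 jG).
    exact: integrable_real_cst.
  apply: (@mean_le_normr _ _ _ _ (fun w => 4 * A * Num.min 1 (enorm (Z w)))).
  + have [] : bounded_measurable (fun w => G vs (x + Z w) - G vs x) => //.
    apply: bounded_measurableB; last exact: bounded_measurable_cst.
    exact: (jet_measurable r0 r1 A0 jG).
  + move=> w; have [Z1|Z1] := leP 1 (enorm (Z w)).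
      rewrite mulr1; apply: le_trans (ler_normB _ _) _.
      by apply: le_trans (lerD (h1 _ _ uvs slw) (h1 _ _ uvs slw)) _; lra.
    apply: le_trans (jet_lip jG _ _ uvs _) _ => //.
    by rewrite addrAC subrr add0r; apply: ler_wpM2r => //; lra.
  + by rewrite mulrAC; apply: mean_leZ => //; rewrite mulr_ge0.
- move=> vs x y uvs sl; have slw : (size vs <= l.+1)%N by rewrite sl.
  have sl' : (size vs < l.+1)%N by rewrite sl.
  set E := enorm (x - y) `^ rho; have E0 : 0 <= E by exact: powR_ge0.
  pose D w := G vs (x + w) - G vs (y + w) - (G vs x - G vs y).
  have bD : bounded_measurable (fun w => D (Z w)).
    apply: bounded_measurableB; last exact: bounded_measurable_cst.
    by apply: bounded_measurableB; exact: (jet_measurable r0 r1 A0 jG).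
  have -> : avg G vs x - avg G vs y = \int[Q]_w D (Z w).
    have ij z := jet_integrable r0 r1 A0 jG z uvs slw.
    rewrite /D RintegralB//; last exact: integrable_real_cst.
      by rewrite RintegralB// Rintegral_cst1 /avg; ring.
    have := bounded_measurableB (jet_measurable r0 r1 A0 jG x uvs slw) (jet_measurable r0 r1 A0 jG y uvs slw).
    exact: bounded_measurable_integrable.
  apply: (@mean_le_normr _ _ _ _ (fun w => 4 * A * E * Num.min 1 (enorm (Z w)))).
  + by have [] := bD.
  + move=> w; have [Z1|Z1] := leP 1 (enorm (Z w)).
      rewrite mulr1; apply: le_trans (ler_normB _ _) _.
      have e1 := jet_hoelder r0 r1 A0 jG (x + Z w) (y + Z w) uvs slw.
      rewrite opprD addrACA subrr addr0 in e1.
      apply: le_trans (lerD e1 (jet_hoelder r0 r1 A0 jG x y uvs slw)) _.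
      by rewrite -mulrDl -/E; apply: ler_wpM2r => //; lra.
    have [u [u1 e]] := row_direction 0 (Z w); rewrite subr0 add0r in e.
    have us : unit_seq (u :: vs) by rewrite /unit_seq /= u1.
    have dd t : is_derive t (1 : R) (fun s : R => G vs (x + s *: u) - G vs (y + s *: u))
        (G (u :: vs) (x + t *: u) - G (u :: vs) (y + t *: u)).
      exact: is_deriveB (h3 vs u x t us sl') (h3 vs u y t us sl').
    have := derive_bound (enorm_ge0 (Z w)) dd (B := A * E).
    move=> /(_ _)/wrap[t _|].
      have := h2 (u :: vs) (x + t *: u) (y + t *: u) us.
      by rewrite opprD addrACA subrr addr0 /= sl; exact.
    rewrite !scale0r !addr0 -e -/(D (Z w)) => h; apply: le_trans h _.
    by rewrite -!mulrA [leRHS]mulrA; apply: ler_wpM2r; [rewrite mulr_ge0|lra].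
  + by rewrite (_ : 4 * b * A * E = 4 * A * E * b); [apply: mean_leZ => //; rewrite !mulr_ge0|ring].
- by move=> vs u x t us sl; exact: (avg_derive r0 r1 A0 jG x t us (ltnW sl)).
- by move=> x v _; exact: (avg_linear r0 r1 A0 jG x v).
Qed.

Lemma jet_iter_avg l rho A G j : 0 < rho <= 1 -> 0 <= A -> jet l rho A G ->
  jet l rho (2 ^+ j * A) (iter j avg G).
Proof.
move=> /andP[r0 r1] A0 jG; elim: j => [|j IH]; first by rewrite expr0 mul1r.
by rewrite exprS -mulrA /=; apply: jet_avg => //; rewrite mulr_ge0// exprn_ge0.
Qed.

Lemma jet_iter_avg_lower l rho A G j b : 0 < rho <= 1 -> 0 <= A -> jet (j + l) rho A G ->
  mean_le Q (fun w => Num.min 1 (enorm (Z w))) b ->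
  jet l rho ((4 * b) ^+ j * A) (iter j avg G).
Proof.
move=> r01 A0 jG hb; elim: j l jG => [|j IH] l jG; first by rewrite expr0 mul1r.
rewrite exprS -mulrA /=; apply: jet_avg_lower => //.
  by rewrite mulr_ge0// exprn_ge0// mulr_ge0//; exact: mean_le_ge0 hb.
by apply: IH; rewrite addnS -addSn.
Qed.

(** A truncated Neumann series: averaging is the identity plus [avg], and this approximates its
    inverse. *)
Definition reduced k G vs x : R := \sum_(j < k.+1) (-1) ^+ j * iter j avg G vs x.

Lemma reducedS k G : reduced k.+1 G =
  (fun vs x => (-1) ^+ k.+1 * iter k.+1 avg G vs x + reduced k G vs x).
Proof. by apply/funext => vs; apply/funext => x; rewrite /reduced big_ord_recr addrC. Qed.

Lemma reduced0 G : reduced 0 G = G.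
Proof.
by apply/funext => vs; apply/funext => x; rewrite /reduced big_ord1 expr0 mul1r.
Qed.

Lemma jet_reduced l rho A G k : 0 < rho <= 1 -> 0 <= A -> jet l rho A G ->
  jet l rho (2 ^+ k.+1 * A) (reduced k G).
Proof.
move=> r01 A0 jG; have h1 B B' H : B <= B' -> jet l rho B H -> jet l rho B' H.
  move=> BB' [g1 g2 g3 g4]; split => // [vs x uvs sl|vs x y uvs sl].
    by apply: le_trans BB'; exact: g1.
  by apply: le_trans (g2 _ _ _ uvs sl) _; rewrite ler_wpM2r ?powR_ge0.
elim: k => [|k IH]; first by rewrite reduced0 expr1; apply: h1 jG; lra.
rewrite reducedS exprS mulr2n mulrDl mulrDl mul1r; apply: jet_comb => //.
  by rewrite normrX normrN1 expr1n.
exact: jet_iter_avg.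
Qed.

(** The alternating series telescopes and leaves the single iterate of order [k.+1] as the exact
    bias. *)
Lemma reduced_bias l rho A G k x : 0 < rho <= 1 -> 0 <= A -> jet l rho A G ->
  \int[Q]_w reduced k G [::] (x + Z w) - G [::] x = (-1) ^+ k * iter k.+1 avg G [::] x.
Proof.
move=> r01 A0 jG; have [r0 r1] := andP r01; elim: k => [|k IH]; first by rewrite reduced0 expr0 mul1r.
have B0 j : 0 <= 2 ^+ j * A by rewrite mulr_ge0// exprn_ge0.
have ji := jet_integrable r0 r1 (B0 k.+1) (jet_iter_avg k.+1 r01 A0 jG) x (isT : unit_seq [::]) isT.
have jr := jet_integrable r0 r1 (B0 k.+1) (jet_reduced k r01 A0 jG) x (isT : unit_seq [::]) isT.
rewrite reducedS RintegralD//; last exact: integrable_realZ.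
rewrite RintegralZl// -addrA IH.
have -> : iter k.+2 avg G [::] x =
  \int[Q]_w iter k.+1 avg G [::] (x + Z w) - iter k.+1 avg G [::] x by [].
by rewrite exprS; move: (iter k.+1 avg G [::] x) (\int[Q]_w _) => a b; ring.
Qed.

End averaging.

(** * First-order expansion and bias of the estimator *)

Section expansion.
Context {R : realType}.
Variables (L M m : R).
Hypotheses (L0 : 0 < L) (M0 : 0 < M) (m0 : 0 < m).

Local Notation r := (rad L m / 2).
Let r0 : 0 < r. Proof. by rewrite divr_gt0// rad_gt0. Qed.

Definition rate d n : R := Num.sqrt (d%:R / n%:R).

Lemma powR_scale (c t a : R) : 0 <= c -> 0 <= t -> 0 <= a <= 1 -> (c * t) `^ a <= (1 + c) * t `^ a.
Proof.
move=> c0 t0 /andP[a0 a1]; rewrite powRM// ler_wpM2r ?powR_ge0//.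
have c1 : 1 <= 1 + c by rewrite lerDl.
apply: le_trans (ler1_powR c1 a1).
by apply: ge0_ler_powR; rewrite ?nnegrE ?addr_ge0// lerDr.
Qed.

Section one_sample.
Context {d n : nat} (V : 'rV[R]_d -> R) (P : probability 'rV[R]_d R)
  (Q : probability (n.-tuple 'rV[R]_d) R).
Hypothesis RS : regular_sample L M m V P Q.
Local Notation S x := (score_mean V (tnth x)).
Local Notation Z x := (mle V (tnth x)).
Local Notation tau := (dev L m V P).
Local Notation H := (mean_hessian V P).

Lemma min_mle_dev (x : n.-tuple 'rV[R]_d) : Num.min 1 (enorm (Z x)) <= (1 + r) * tau x.
Proof.
have t0 : 0 <= tau x by exact: dev_ge0.
have [t1|t1] := leP (tau x) 1.
  apply: le_trans (_ : enorm (Z x) <= _); first by rewrite ge_min lexx orbT.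
  apply: le_trans (mle_dev L0 M0 m0 RS t1) _; rewrite ler_wpM2r//; lra.
apply: (@le_trans _ _ 1); first by rewrite ge_min lexx.
have := ltW r0; have := ltW t1; nra.
Qed.

Lemma score_mean_mean0 w : Q.-integrable setT (EFin \o (fun x => dot w (S x))) /\
  \int[Q]_x dot w (S x) = 0.
Proof.
have [PV A1 d0 dn QP] := RS; have [_ V_C2 V_M _ _] := A1.
have h i := integral_marginal RS i (measurable_score V_C2 w) (integrable_score M0 V_C2 V_M PV w).
have e (x : n.-tuple 'rV[R]_d) : dot w (S x) = \sum_(j < n) n%:R^-1 * dot w (gradient V (tnth x j)).
  by rewrite dotZr dot_sumr mulr_sumr.
have ii i : Q.-integrable setT (EFin \o (fun x : n.-tuple 'rV[R]_d => n%:R^-1 * dot w (gradient V (tnth x i)))).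
  by apply: integrable_realZ; have [] := h i.
rewrite (_ : (fun x => dot w (S x)) = (fun x : n.-tuple 'rV[R]_d => \sum_(j < n) n%:R^-1 * dot w (gradient V (tnth x j)))).
  split; first exact: integrable_real_sum.
  rewrite Rintegral_sum// big1// => i _; have [i1 i2] := h i.
  by rewrite RintegralZl// i2 (score_mean0 M0 V_C2 V_M PV) mulr0.
by apply/funext => x; exact: e.
Qed.

Definition quadratic_cst : R :=
  (2 / m + 4 * L / m ^+ 2) * ((m * rad L m / 4) ^+ 2 + (m / 8) ^+ 2).

Lemma quadratic_cst_ge0 : 0 <= quadratic_cst.
Proof.
have m' := ltW m0; have L' := ltW L0.
by apply: mulr_ge0; apply: addr_ge0; rewrite ?sqr_ge0// divr_ge0 ?sqr_ge0 ?mulr_ge0.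
Qed.

(** In order: the Taylor remainder, the error of the linearised estimator and, when [dev] exceeds 1,
    the crude bounds of the increment and of the linear term. *)
Definition expansion_cst : R := 2 * r * (1 + r) + quadratic_cst / m + 2 + rad L m / 4.

Lemma expansion_cst_ge0 : 0 <= expansion_cst.
Proof.
have rp := ltW (rad_gt0 L0 m0); have m' := ltW m0; have r' := ltW r0.
have a : 0 <= 2 * r * (1 + r) by rewrite mulr_ge0// ?addr_ge0// mulr_ge0.
have b : 0 <= quadratic_cst / m by rewrite divr_ge0 ?quadratic_cst_ge0.
by rewrite !addr_ge0 ?(divr_ge0 rp).
Qed.

(** [w] solves the adjoint equation for the mean Hessian and is the same for all samples, so the
    subtracted term has mean zero. The bound holds on bad samples too, so no truncation enters the
    bias. *)
Lemma jet_mle_expansion rho A F theta : 0 < rho <= 1 -> 0 <= A -> jet 1 rho A F ->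
  exists2 w, enorm w <= A / m & forall x : n.-tuple 'rV[R]_d,
  `|F [::] (theta + Z x) - F [::] theta - dot w (S x)| <=
     expansion_cst * A * (tau x `^ 2 + tau x `^ (1 + rho)).
Proof.
move=> /andP[rho0 rho1] A0 jF; have [h1 _ _ _] := jF.
have [PV A1 d0 dn QP] := RS.
set g := jet_grad F theta; have gA : enorm g <= A by exact: (enorm_jet_grad A0 jF theta).
have [w wH wg] := coercive_solve g m0 (mean_hessian_coercive L0 M0 PV A1).
have wA : enorm w <= A / m by rewrite ler_pdivlMr// mulrC; exact: le_trans gA.
exists w => // x; set t := tau x; have t0 : 0 <= t by exact: dev_ge0.
have t2 : t `^ 2 = t ^+ 2 by rewrite -powR_mulrn.
have tr : t `^ (1 + rho) = t * t `^ rho.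
  by rewrite powRD ?powRr1// gt_eqF// addr_gt0.
rewrite t2 tr; have tr0 : 0 <= t * t `^ rho by rewrite mulr_ge0 ?powR_ge0.
have rp : 0 < rad L m by rewrite rad_gt0.
have K0 := quadratic_cst_ge0; rewrite /expansion_cst.
have hlin := mle_linear_dev L0 M0 m0 RS (x := x) w; rewrite -/quadratic_cst in hlin.
set K := quadratic_cst in K0 hlin *.
have r' := ltW r0.
have Am : 0 <= A / m by rewrite divr_ge0// ltW.
have rr : 0 <= 2 * r * (1 + r) by rewrite mulr_ge0// ?addr_ge0// mulr_ge0.
have rt : 0 <= r * t by rewrite mulr_ge0.
have [t1|t1] := leP t 1.
  have hT := jet_grad_taylor rho0 rho1 A0 jF theta (Z x).
  have hZ := mle_dev L0 M0 m0 RS t1; rewrite -/t in hZ.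
  have b1 : 2 * A * (enorm (Z x) * enorm (Z x) `^ rho) <= A * (2 * r * (1 + r)) * (t * t `^ rho).
    have -> : A * (2 * r * (1 + r)) * (t * t `^ rho) = 2 * A * (r * t * ((1 + r) * t `^ rho)) by ring.
    apply: ler_wpM2l; first by rewrite mulr_ge0.
    apply: ler_pM => //; first exact: powR_ge0.
    apply: (@le_trans _ _ ((r * t) `^ rho)).
      by apply: ge0_ler_powR; rewrite ?nnegrE// ltW.
    by apply: powR_scale => //; rewrite ltW.
  have b2 : `|dot g (Z x) - dot w (S x)| <= A / m * K * t ^+ 2.
    rewrite -wH; apply: le_trans (hlin t1) _.
    by apply: ler_wpM2r; [exact: sqr_ge0|exact: ler_wpM2r].
  have -> : F [::] (theta + Z x) - F [::] theta - dot w (S x) =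
     (F [::] (theta + Z x) - F [::] theta - dot g (Z x)) + (dot g (Z x) - dot w (S x)).
    by rewrite addrA subrK.
  apply: le_trans (ler_normD _ _) _; apply: le_trans (lerD (le_trans hT b1) b2) _.
  have q0 : 0 <= t ^+ 2 by exact: sqr_ge0.
  move: tr0 q0 rr K0 Am A0 rp; move: (t * t `^ rho) (t ^+ 2) (2 * r * (1 + r)) => a b c.
  move=> a0 b0 c0 K0 Am A0 rp.
  have -> : (c + K / m + 2 + rad L m / 4) * A * (b + a) = A * c * a + A / m * K * b +
     (A * (K / m) * a + A * c * b + A * (2 + rad L m / 4) * (b + a)) by ring.
  have Km : 0 <= K / m by rewrite divr_ge0// ltW.
  have r4 : 0 <= rad L m / 4 by rewrite divr_ge0// ltW.
  rewrite lerDl; move: Km r4; move: (K / m) (rad L m / 4) => p q p0 q0.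
  by do !(apply: addr_ge0 || apply: mulr_ge0).
(* When [dev] exceeds 1, constant and linear bounds are already dominated by [t ^+ 2]. *)
have tt : t <= t ^+ 2 by rewrite expr2 ler_peMl// ltW.
have b1 : `|F [::] (theta + Z x) - F [::] theta| <= 2 * A * t ^+ 2.
  apply: (@le_trans _ _ (2 * A)).
    by apply: le_trans (ler_normB _ _) _; rewrite mulr2n mulrDl mul1r; apply: lerD; exact: h1.
  by rewrite ler_peMr ?mulr_ge0//; apply: le_trans tt; exact: ltW.
have b2 : `|dot w (S x)| <= A * (rad L m / 4) * t ^+ 2.
  apply: le_trans (normr_dot_le _ _) _.
  apply: (@le_trans _ _ (A / m * (m * rad L m / 4 * t))).
    by apply: ler_pM => //; exact: (score_mean_dev L0 m0 V P x).
  have -> : A / m * (m * rad L m / 4 * t) = A * (rad L m / 4) * t by field; rewrite gt_eqF.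
  by apply: ler_wpM2l => //; rewrite mulr_ge0// divr_ge0// ltW.
apply: le_trans (ler_normB _ _) _; apply: le_trans (lerD b1 b2) _.
have q0 : 0 <= t ^+ 2 by exact: sqr_ge0.
move: tr0 q0 rr K0 Am A0 rp; move: (t * t `^ rho) (t ^+ 2) (2 * r * (1 + r)) => a b c.
move=> a0 b0' c0 K0 Am A0 rp.
have -> : (c + K / m + 2 + rad L m / 4) * A * (b + a) = 2 * A * b + A * (rad L m / 4) * b +
   ((c + K / m) * A * (b + a) + (2 + rad L m / 4) * A * a) by ring.
have Km : 0 <= K / m by rewrite divr_ge0// ltW.
have r4 : 0 <= rad L m / 4 by rewrite divr_ge0// ltW.
rewrite lerDl; move: Km r4; move: (K / m) (rad L m / 4) => p q p0 q0.
  by do !(apply: addr_ge0 || apply: mulr_ge0).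
Qed.

Lemma hoelder_mle_error s (f : 'rV[R]_d -> R) theta (x : n.-tuple 'rV[R]_d) : 0 < s <= 1 ->
  jet 0 s 1 (iter_diff f) ->
  (f (theta + Z x) - f theta) ^+ 2 <= (2 + r) ^+ 2 * tau x `^ (2 * s).
Proof.
move=> /andP[s0 s1] [h1 h2 _ _].
have t0 : 0 <= tau x by exact: dev_ge0.
have e : tau x `^ (2 * s) = (tau x `^ s) ^+ 2.
  by rewrite mulrC powRrM powR_mulrn// powR_ge0.
rewrite e -exprMn -real_normK ?num_real//; apply: ler_exprn => //.
have [t1|t1] := leP (tau x) 1.
  have := h2 [::] (theta + Z x) theta isT erefl.
  rewrite mul1r [X in enorm (X - _)]addrC addrK => h; apply: le_trans h _.
  apply: (@le_trans _ _ ((r * tau x) `^ s)).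
    have rt : 0 <= r * tau x by rewrite mulr_ge0// ltW.
    have hZ := mle_dev L0 M0 m0 RS t1.
    by apply: ge0_ler_powR; rewrite ?nnegrE// ltW.
  apply: le_trans (powR_scale _ _ _) _; rewrite ?(ltW r0) ?(ltW s0)//.
  by rewrite ler_wpM2r ?powR_ge0// lerD2r ler1n.
apply: le_trans (ler_normB _ _) _.
apply: le_trans (lerD (h1 [::] _ isT isT) (h1 [::] _ isT isT)) _.
have p1 : 1 <= tau x `^ s.
  have e1 : 1 `^ s = 1 :> R by rewrite powR1.
  by rewrite -[leLHS]e1; apply: ge0_ler_powR; rewrite ?nnegrE// ltW.
have := ltW r0; move: p1; nra.
Qed.

End one_sample.

Lemma rate_gt0 {d n} {V : 'rV[R]_d -> R} {P} {Q : probability (n.-tuple 'rV[R]_d) R} :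
  regular_sample L M m V P Q -> 0 < rate d n <= 1.
Proof.
move=> /regular_ratio/andP[a b]; rewrite sqrtr_gt0 a /= -[leRHS]sqrtr1 ler_wsqrtr//.
Qed.

Lemma min_mle_mean : exists2 C : R, 0 <= C &
  forall d n (V : 'rV[R]_d -> R) (P : probability 'rV[R]_d R) (Q : probability (n.-tuple 'rV[R]_d) R),
  regular_sample L M m V P Q ->
  mean_le Q (fun x => Num.min 1 (enorm (mle V (tnth x)))) (C * rate d n).
Proof.
have [C C0 hC] := dev_powR L0 M0 m0; exists ((1 + r) * C) => [|d n V P Q RS].
  by rewrite mulr_ge0// addr_ge0// ltW.
have a1 : 0 <= (1 : R) <= 2 by rewrite ler01 ler1n.
apply: (@mean_leS _ _ _ _ _ (fun x => (1 + r) * dev L m V P x `^ 1)).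
- apply: measurable_minr => //; apply: measurable_fun_enorm; exact: (measurable_mle M0 RS).
- by move=> x; rewrite le_min ler01 enorm_ge0.
- by move=> x; rewrite powRr1 ?dev_ge0//; exact: min_mle_dev RS x.
rewrite -mulrA; apply: mean_leZ; first by rewrite addr_ge0// ltW.
have := hC _ _ _ _ _ RS 1 a1; rewrite -/(rate d n) [X in C * X]powRr1//; exact: sqrtr_ge0.
Qed.

(** The centred linear term can be subtracted under the integral. Of the two remaining powers, the
    square is the smaller one in mean since the rate is at most 1. *)
Lemma jet_bias : exists2 C : R, 0 <= C &
  forall d n (V : 'rV[R]_d -> R) (P : probability 'rV[R]_d R) (Q : probability (n.-tuple 'rV[R]_d) R),
  regular_sample L M m V P Q -> forall rho A F theta, 0 < rho <= 1 -> 0 <= A -> jet 1 rho A F ->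
  `|avg Q (fun x => mle V (tnth x)) F [::] theta| <= C * A * rate d n `^ (1 + rho).
Proof.
have [C C0 hC] := dev_powR L0 M0 m0; exists (expansion_cst * (2 * C)) => [|d n V P Q RS rho A F theta r01 A0 jF].
  by apply: mulr_ge0; [exact: expansion_cst_ge0|exact: mulr_ge0].
have [rho0 rho1] := andP r01.
have [w wA hw] := jet_mle_expansion RS theta r01 A0 jF.
have mZ := measurable_mle M0 RS.
have bm := jet_measurable mZ rho0 rho1 A0 jF theta (isT : unit_seq [::]) isT.
have [iS S0] := score_mean_mean0 RS w.
have [V_sc V_C2 _ _ _] : assumption1 V P L M m by case: RS.
have mS : measurable_fun setT (fun x : n.-tuple 'rV[R]_d => dot w (score_mean V (tnth x))).
  by apply: measurable_fun_dot; [exact: measurable_cst|exact: (measurable_score_mean RS)].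
have bmB := bounded_measurableB bm (bounded_measurable_cst (F [::] theta)).
have -> : avg Q (fun x => mle V (tnth x)) F [::] theta =
    \int[Q]_x (F [::] (theta + mle V (tnth x)) - F [::] theta - dot w (score_mean V (tnth x))).
  rewrite RintegralB//; last exact: bounded_measurable_integrable.
  rewrite RintegralB//; last 2 first.
  - exact: bounded_measurable_integrable.
  - exact: integrable_real_cst.
  by rewrite S0 subr0 Rintegral_cst1.
have /andP[D0 D1] := rate_gt0 RS.
have dd : rate d n `^ 2 <= rate d n `^ (1 + rho).
  by apply: ger_powR; [rewrite D0|rewrite -natr1 lerD2l].
have a2 : 0 <= (2 : R) <= 2 by rewrite ler0n lexx.
have ar : 0 <= 1 + rho <= 2 by rewrite addr_ge0 ?(ltW rho0)//= -natr1 lerD2l.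
apply: (mean_le_normr (f := fun x => expansion_cst * A * (dev L m V P x `^ 2 + dev L m V P x `^ (1 + rho)))).
- by apply: measurable_funB => //; case: bmB.
- exact: hw.
apply: (@mean_le_weak _ _ _ _ _ (expansion_cst * A * (C * rate d n `^ 2 + C * rate d n `^ (1 + rho)))).
  have -> : expansion_cst * (2 * C) * A * rate d n `^ (1 + rho) =
    expansion_cst * A * (C * rate d n `^ (1 + rho) + C * rate d n `^ (1 + rho)) by ring.
  apply: ler_wpM2l; first by rewrite mulr_ge0 ?expansion_cst_ge0.
  by rewrite lerD2r ler_wpM2l.
apply: mean_leZ; first by rewrite mulr_ge0 ?expansion_cst_ge0.
by apply: mean_leD; exact: (hC _ _ _ _ _ RS).
Qed.

(** [k] of the [k.+1] averages give up one derivative each for a factor [rate d n]; the function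
    left still has a Hoelder gradient, and [jet_bias] extracts the exponent [1 + rho] from the last
    average. *)
Lemma reduced_estimator_bias (k : nat) : exists2 C : R, 0 <= C &
  forall d n (V : 'rV[R]_d -> R) (P : probability 'rV[R]_d R) (Q : probability (n.-tuple 'rV[R]_d) R),
  regular_sample L M m V P Q -> forall rho G theta, 0 < rho <= 1 -> jet k.+1 rho 1 G ->
  `|\int[Q]_x reduced Q (fun x => mle V (tnth x)) k G [::] (theta + mle V (tnth x)) - G [::] theta|
     <= C * rate d n `^ (k.+1%:R + rho).
Proof.
have [C C0 hC] := jet_bias; have [B B0 hB] := min_mle_mean.
exists (C * (4 * B) ^+ k) => [|d n V P Q RS rho G theta r01 jG].
  by rewrite mulr_ge0// exprn_ge0// mulr_ge0.
have [rho0 rho1] := andP r01; have mZ := measurable_mle M0 RS.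
have /andP[D0 D1] := rate_gt0 RS.
rewrite (reduced_bias Q mZ k theta r01 ler01 jG) normrM normrX normrN1 expr1n mul1r.
have jG' : jet (k + 1) rho 1 G by rewrite addn1.
have jk := jet_iter_avg_lower mZ r01 ler01 jG' (hB _ _ _ _ _ RS).
rewrite iterS; apply: le_trans (hC _ _ _ _ _ RS rho _ _ theta r01 _ jk) _.
  by rewrite mulr1 exprn_ge0// !mulr_ge0// ltW.
have -> : rate d n `^ (k.+1%:R + rho) = rate d n ^+ k * rate d n `^ (1 + rho).
  by rewrite -powR_mulrn ?(ltW D0)// -powRD ?(gt_eqF D0) ?implybT// -natr1 addrA.
rewrite mulr1 !exprMn; move: (rate d n `^ _) (rate d n ^+ k) (4 ^+ k) (B ^+ k) => a b c e.
by rewrite le_eqVlt; apply/orP; left; apply/eqP; ring.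
Qed.

Lemma hoelder_estimator_error : exists2 C : R, 0 <= C &
  forall d n (V : 'rV[R]_d -> R) (P : probability 'rV[R]_d R) (Q : probability (n.-tuple 'rV[R]_d) R),
  regular_sample L M m V P Q -> forall s (f : 'rV[R]_d -> R) theta, 0 < s <= 1 ->
  jet 0 s 1 (iter_diff f) ->
  mean_le Q (fun x => (f (theta + mle V (tnth x)) - f theta) ^+ 2) (C * rate d n `^ (2 * s)).
Proof.
have [C C0 hC] := dev_powR L0 M0 m0; exists ((2 + r) ^+ 2 * C) => [|d n V P Q RS s f theta s01 jf].
  by rewrite mulr_ge0// sqr_ge0.
have [s0 s1] := andP s01; have mZ := measurable_mle M0 RS.
have [mf _] := jet_measurable mZ s0 s1 ler01 jf theta (isT : unit_seq [::]) isT.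
apply: (@mean_leS _ _ _ _ _ (fun x => (2 + r) ^+ 2 * dev L m V P x `^ (2 * s))).
- by apply: measurable_funX; apply: measurable_funB.
- by move=> x; exact: sqr_ge0.
- by move=> x; exact: hoelder_mle_error RS _ _ _ _ s01 jf.
rewrite -mulrA; apply: mean_leZ; first exact: sqr_ge0.
by apply: (hC _ _ _ _ _ RS); lra.
Qed.

End expansion.

(** * Increments of the truncated functional when one observation is replaced *)

Section variance.
Context {R : realType}.
Variables (L M m : R).
Hypotheses (L0 : 0 < L) (M0 : 0 < M) (m0 : 0 < m).

Local Notation r := (rad L m).
Let rp : 0 < r. Proof. exact: rad_gt0. Qed.

(** The inverse of the curvature [3 / 4 * m] available at a good sample; it bounds the dual vector
    by the gradient. *)
Definition grad_cst : R := 4 / (3 * m).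
Lemma grad_cst_ge0 : 0 <= grad_cst. Proof. by rewrite divr_ge0// mulr_ge0// ltW. Qed.
(** Chosen so that the displacement of the estimator is at most [shift_cst] times
    [(enorm v + 1) / n], with [v] the removed score. *)
Definition shift_cst : R := 2 / m * (1 + 2 * M * r).
Lemma shift_cst_ge0 : 0 <= shift_cst.
Proof.
rewrite mulr_ge0 ?divr_ge0 ?(ltW m0)// addr_ge0// mulr_ge0 ?(ltW rp)//.
by rewrite mulr_ge0// ltW.
Qed.

Local Notation kap := grad_cst.
Local Notation k1 := shift_cst.
Let kap0 := grad_cst_ge0.
Let k10 := shift_cst_ge0.

Lemma sqr4_le (a b c e : R) : (a + b + c + e) ^+ 2 <= 4 * (a ^+ 2 + b ^+ 2 + c ^+ 2 + e ^+ 2).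
Proof.
have := sqr_ge0 (a - b); have := sqr_ge0 (a - c); have := sqr_ge0 (a - e).
have := sqr_ge0 (b - c); have := sqr_ge0 (b - e); have := sqr_ge0 (c - e).
by rewrite !sqrrB; lra.
Qed.

Lemma sqr3_le (a b c : R) : (a + b + c) ^+ 2 <= 3 * (a ^+ 2 + b ^+ 2 + c ^+ 2).
Proof.
have := sqr_ge0 (a - b); have := sqr_ge0 (a - c); have := sqr_ge0 (b - c).
by rewrite !sqrrB; lra.
Qed.

(** The increment is its linear part, tested on the dual vector, plus the Taylor remainder of the
    functional. The four squares are the directional score, the cost of moving the scores to 0, the
    curvature of the empirical score, and that Taylor remainder. *)
Lemma increment_arith (rho A h v ni b a f1 f2 nw : R) : 0 < rho -> rho <= 1 -> 0 <= A ->
  0 <= h -> 0 <= v -> 0 <= ni -> 0 <= b -> 0 <= nw -> nw <= kap * A ->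
  m / 2 * h <= ni * (v + 2 * M * r) ->
  `|a| <= ni * b + nw * (ni * (2 * M * r) + L * h ^+ 2) ->
  `|f1 - f2 - a| <= 2 * A * (h * h `^ rho) ->
  (f1 - f2) ^+ 2 <= 4 * (ni ^+ 2 * b ^+ 2 + A ^+ 2 * (kap * (2 * M * r)) ^+ 2 * ni ^+ 2
     + A ^+ 2 * (kap * (L * k1 ^+ 2)) ^+ 2 * (ni * (v + 1)) ^+ 4
     + A ^+ 2 * (2 * k1 * (1 + k1)) ^+ 2 * ((ni * (v + 1)) ^+ 2) `^ (1 + rho)).
Proof.
move=> rho0 rho1 A0 h0 v0 ni0 b0 nw0 nwA hh ha hf.
set u := ni * (v + 1); have u0 : 0 <= u by rewrite mulr_ge0// addr_ge0.
have c0 : 0 <= 2 * M * r by rewrite mulr_ge0 ?(ltW rp)// mulr_ge0// ltW.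
have hu : h <= k1 * u.
  have m20 : 0 < m / 2 by rewrite divr_gt0.
  rewrite -(ler_pM2l m20); apply: le_trans hh _.
  have -> : m / 2 * (k1 * u) = ni * ((1 + 2 * M * r) * (v + 1)).
    by rewrite /shift_cst /u; field; rewrite gt_eqF.
  by apply: ler_wpM2l => //; move: c0; move: (2 * M * r) => c c0; nra.
have ku0 : 0 <= k1 * u by rewrite mulr_ge0.
have b2 : nw * (ni * (2 * M * r)) <= A * (kap * (2 * M * r)) * ni.
  have -> : A * (kap * (2 * M * r)) * ni = kap * A * (ni * (2 * M * r)) by ring.
  by apply: ler_wpM2r => //; exact: mulr_ge0.
have b3 : nw * (L * h ^+ 2) <= A * (kap * (L * k1 ^+ 2)) * u ^+ 2.
  have -> : A * (kap * (L * k1 ^+ 2)) * u ^+ 2 = kap * A * (L * (k1 * u) ^+ 2) by ring.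
  have L' := ltW L0; apply: ler_pM => //; first by rewrite mulr_ge0 ?sqr_ge0.
  by apply: ler_wpM2l => //; exact: ler_exprn.
have b4 : 2 * A * (h * h `^ rho) <= A * (2 * k1 * (1 + k1)) * (u * u `^ rho).
  have -> : A * (2 * k1 * (1 + k1)) * (u * u `^ rho) = 2 * A * (k1 * u * ((1 + k1) * u `^ rho)) by ring.
  apply: ler_wpM2l; first exact: mulr_ge0.
  apply: ler_pM => //; first exact: powR_ge0.
  apply: (@le_trans _ _ ((k1 * u) `^ rho)).
    by apply: ge0_ler_powR; rewrite ?nnegrE// ltW.
  by apply: powR_scale; rewrite ?(ltW rho0).
have ab : `|f1 - f2| <= ni * b + A * (kap * (2 * M * r)) * ni + A * (kap * (L * k1 ^+ 2)) * u ^+ 2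
    + A * (2 * k1 * (1 + k1)) * (u * u `^ rho).
  have -> : f1 - f2 = a + (f1 - f2 - a) by rewrite [RHS]addrC subrK.
  apply: le_trans (ler_normD _ _) _; rewrite mulrDr addrA in ha.
  by have := lerD ha hf; lra.
rewrite -real_normK ?num_real//; apply: le_trans (ler_exprn 2 (normr_ge0 _) ab) _.
apply: le_trans (sqr4_le _ _ _ _) _.
have eu : (u ^+ 2) `^ (1 + rho) = (u * u `^ rho) ^+ 2.
  rewrite powRD; last by rewrite gt_eqF// addr_gt0.
  have e2 : (u ^+ 2) `^ rho = (u `^ rho) ^+ 2.
    by rewrite -(powR_mulrn 2 u0) -(powR_mulrn 2 (powR_ge0 u rho)) powRAC.
  by rewrite powRr1 ?sqr_ge0// e2 [RHS]exprMn.
by rewrite eu le_eqVlt; apply/orP; left; apply/eqP; ring.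
Qed.

(** If one cutoff vanishes, the increment is a cutoff difference times a bounded value; otherwise
    [J] bounds the increment of the functional. *)
Lemma truncation_arith (A J c c' f1 f2 : R) : 0 <= J -> f1 ^+ 2 <= A ^+ 2 -> f2 ^+ 2 <= A ^+ 2 ->
  0 <= c -> c <= 1 -> c' = 0 \/ c = 0 \/ (f1 - f2) ^+ 2 <= J ->
  (c * f1 - c' * f2) ^+ 2 <= 2 * J + 2 * A ^+ 2 * (c - c') ^+ 2.
Proof.
move=> J0 f1A f2A c0 c1 h; have A20 := sqr_ge0 A.
case: h => [->|[->|hJ]].
- rewrite mul0r !subr0 exprMn; have := ler_wpM2l (sqr_ge0 c) f1A; have := sqr_ge0 c.
  by move: (c ^+ 2) (f1 ^+ 2) (A ^+ 2) A20 => a b e; nra.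
- rewrite mul0r !sub0r !sqrrN exprMn; have := ler_wpM2l (sqr_ge0 c') f2A; have := sqr_ge0 c'.
  by move: (c' ^+ 2) (f2 ^+ 2) (A ^+ 2) A20 => a b e; nra.
have e : c * f1 - c' * f2 = c * (f1 - f2) + (c - c') * f2 by ring.
have h2 : (c * (f1 - f2) + (c - c') * f2) ^+ 2 <= 2 * (c * (f1 - f2)) ^+ 2 + 2 * ((c - c') * f2) ^+ 2.
  have := sqr_ge0 (c * (f1 - f2) - (c - c') * f2); rewrite sqrrB sqrrD; lra.
rewrite e; apply: le_trans h2 _; rewrite -[2 * A ^+ 2 * _]mulrA; apply: lerD; rewrite ler_wpM2l//.
  by apply: le_trans hJ; rewrite exprMn ler_piMl ?sqr_ge0// exprn_ile1.
by rewrite exprMn mulrC ler_wpM2r ?sqr_ge0.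
Qed.

(** Bounds the squared increment by a function of the dual vector [w] and the removed observation
    [y] alone, so that it can be averaged in [y] with [w] frozen. The first term sees one direction
    of the score; the last two carry its full norm, with more powers of [1 / n]. *)
Definition incr {d} (V : 'rV[R]_d -> R) (n : nat) (rho A : R) (w y : 'rV[R]_d) : R :=
  let u := n%:R^-1 * (enorm (gradient V y) + 1) in
  4 * (n%:R^-1 ^+ 2 * `|dot w (gradient V y)| ^+ 2
     + A ^+ 2 * (kap * (2 * M * r)) ^+ 2 * n%:R^-1 ^+ 2
     + A ^+ 2 * (kap * (L * k1 ^+ 2)) ^+ 2 * u ^+ 4
     + A ^+ 2 * (2 * k1 * (1 + k1)) ^+ 2 * (u ^+ 2) `^ (1 + rho)).

(* The leave-one-out bound needs both samples to be good. Bounding the bad event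
   inside each of the n Efron-Stein terms would cost n P(dev > 1), which is too
   much when d is close to n; the cutoff only costs its own increments. *)
Definition truncated {d n} (V : 'rV[R]_d -> R) (P : probability 'rV[R]_d R)
    (F : seq 'rV[R]_d -> 'rV[R]_d -> R) theta (x : n.-tuple 'rV[R]_d) : R :=
  cutoff (dev L m V P x) * F [::] (theta + mle V (tnth x)).

Section one_sample.
Context {d n : nat} (V : 'rV[R]_d -> R) (P : probability 'rV[R]_d R)
  (Q : probability (n.-tuple 'rV[R]_d) R).
Hypothesis RS : regular_sample L M m V P Q.
Local Notation DV := (gradient V).
Local Notation Z x := (mle V (tnth x)).
Local Notation tau := (dev L m V P).
Variables (i : 'I_n) (z : 'rV[R]_d).
Hypothesis z0 : DV z = 0.
Variables (rho A : R) (F : seq 'rV[R]_d -> 'rV[R]_d -> R).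
Hypotheses (rho0 : 0 < rho) (rho1 : rho <= 1) (A0 : 0 <= A) (jF : jet 1 rho A F).
Variable theta : 'rV[R]_d.

Let PV : has_density P (fun x => expR (- V x)). Proof. by case: RS. Qed.
Let A1 : assumption1 V P L M m. Proof. by case: RS. Qed.
Let n0 : (0 < n)%N. Proof. by case: RS => _ _ d0 /(leq_trans d0). Qed.
Let ni0 : 0 <= (n%:R : R)^-1. Proof. by rewrite invr_ge0. Qed.

Local Notation x' x := (upd i z x).

Lemma dev_solve (x : n.-tuple 'rV[R]_d) : tau (x' x) <= 1 -> exists2 w, enorm w <= kap * A &
  forall h, dot w (h *m hessian_at V (tnth (x' x)) (Z (x' x))) = dot (jet_grad F (theta + Z (x' x))) h.
Proof.
move=> t1; have gd := dev_good L0 m0 t1; have [_ gW] := gd.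
have Zr := mle_small L0 M0 m0 PV A1 (V_no_recession PV A1) n0 gd.
have c0 : 0 < 3 / 4 * m by rewrite mulr_gt0.
have hc u := hessian_at_coercive L0 M0 m0 PV A1 n0 u gW Zr.
have [w wH wg] := coercive_solve (jet_grad F (theta + Z (x' x))) c0 hc.
exists w => //.
have gA := enorm_jet_grad A0 jF (theta + Z (x' x)).
have e : kap * A = A / (3 / 4 * m) by rewrite /grad_cst; field; rewrite gt_eqF.
by rewrite e ler_pdivlMr// mulrC; exact: le_trans wg gA.
Qed.

Lemma jet_increment (x : n.-tuple 'rV[R]_d) w : tau x <= 1 -> tau (x' x) <= 1 -> enorm w <= kap * A ->
  (forall h, dot w (h *m hessian_at V (tnth (x' x)) (Z (x' x))) = dot (jet_grad F (theta + Z (x' x))) h) ->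
  (F [::] (theta + Z x) - F [::] (theta + Z (x' x))) ^+ 2 <= incr V n rho A w (tnth x i).
Proof.
move=> t1 t1' wA wH.
have g1 := dev_good L0 m0 t1; have g2 := dev_good L0 m0 t1'.
have xx' j : j != i -> tnth (x' x) j = tnth x j by move=> /negPf ji; rewrite tnth_upd ji.
have xi0 : DV (tnth (x' x) i) = 0 by rewrite tnth_upd eqxx.
have nrec := V_no_recession PV A1.
have hh := mle_leave_one_out L0 M0 m0 PV A1 nrec n0 xx' xi0 g1 g2.
have hd := mle_leave_one_out_dot L0 M0 m0 PV A1 nrec n0 xx' xi0 g1 wH.
have hT := jet_grad_taylor rho0 rho1 A0 jF (theta + Z (x' x)) (Z x - Z (x' x)).
have e : theta + Z (x' x) + (Z x - Z (x' x)) = theta + Z x.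
  have aux (a b c : 'rV[R]_d) : a + b + (c - b) = a + c by rewrite -addrA [b + _]addrC subrK.
  exact: aux.
rewrite e in hT; rewrite /incr /=.
move: hh hd hT; set h := enorm (Z x - Z (x' x)); set v := enorm (DV (tnth x i)).
have h0 : 0 <= h by exact: enorm_ge0.
have v0 : 0 <= v by exact: enorm_ge0.
have w0 : 0 <= enorm w by exact: enorm_ge0.
move: (`|dot w _|) (normr_ge0 (dot w (DV (tnth x i)))) => b b0.
move: (dot _ (Z x - _)) (F [::] _) (F [::] _) (enorm w) w0 wA => a f1 f2 nw nw0 wA.
move: h v h0 v0 (n%:R^-1) ni0 => h v h0 v0 ni ni0' hh hd hT.
exact: increment_arith rho0 rho1 A0 h0 v0 ni0' b0 nw0 wA hh hd hT.
Qed.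


(** The properties of [w] are asked for only when the replaced sample has [dev <= 1]; otherwise its
    cutoff vanishes. *)
Lemma truncated_increment (x : n.-tuple 'rV[R]_d) w :
  (tau (x' x) <= 1 -> enorm w <= kap * A /\
   forall h, dot w (h *m hessian_at V (tnth (x' x)) (Z (x' x))) = dot (jet_grad F (theta + Z (x' x))) h) ->
  (truncated V P F theta x - truncated V P F theta (x' x)) ^+ 2 <=
    2 * incr V n rho A w (tnth x i) + 2 * A ^+ 2 * (cutoff (tau x) - cutoff (tau (x' x))) ^+ 2.
Proof.
have [h1 _ _ _] := jF; move=> hw.
have FA y : F [::] y ^+ 2 <= A ^+ 2.
  by rewrite -real_normK ?num_real//; apply: ler_exprn => //; exact: h1.
have i0 : 0 <= incr V n rho A w (tnth x i).
  by rewrite /incr /=; do !(assumption || apply: sqr_ge0 || apply: exprn_ge0 || apply: powR_ge0 || apply: addr_ge0 || apply: mulr_ge0).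
apply: truncation_arith => //.
- exact: cutoff_ge0.
- exact: cutoff_le1.
have [t1'|t1'] := leP (tau (x' x)) 1; last by left; exact: cutoff_eq0 (ltW t1').
have [t1|t1] := leP (tau x) 1; last by right; left; exact: cutoff_eq0 (ltW t1).
by have [wA wH] := hw t1'; right; right; exact: jet_increment t1 t1' wA wH.
Qed.

End one_sample.

Lemma score_square_mean {d n} {V : 'rV[R]_d -> R} {P} {Q : probability (n.-tuple 'rV[R]_d) R} :
  regular_sample L M m V P Q -> forall w,
  mean_le P (fun y => `|dot w (gradient V y)| ^+ 2) (4 * expR M * enorm w ^+ 2).
Proof.
move=> [PV A1 _ _ _] w; have [V_sc V_C2 V_M _ _] := A1.
have [u [u1 e]] := row_direction 0 w; rewrite subr0 add0r in e.
have h (y : 'rV[R]_d) : `|dot w (gradient V y)| ^+ 2 = enorm w ^+ 2 * `|dot u (gradient V y)| ^+ 2.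
  by rewrite {1}e dotZl normrM ger0_norm// exprMn.
rewrite (_ : (fun y => _) = fun y => enorm w ^+ 2 * `|dot u (gradient V y)| ^+ 2); last first.
  by apply/funext => y; exact: h.
rewrite mulrC; apply: mean_leZ; first exact: sqr_ge0.
split.
- by apply: measurable_funX; apply: measurableT_comp => //; exact: measurable_score.
- by move=> y; exact: sqr_ge0.
- have := score_moment M0 V_C2 V_M PV 2 u1.
  rewrite -lee_fin EFin_Rintegral; last exact: (integrable_score_pow M0 V_C2 V_M PV).
  by move=> h2; apply: le_trans h2 _; rewrite lee_fin mulrA -natrM.
Qed.

(** The directional term costs [enorm w ^+ 2] without a dimension. Each full square [u ^+ 2] costs
    [d / n ^ 2], and since this is at most 1 the fourth power is absorbed by the exponent
    [1 + rho]. *)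
Lemma incr_mean : exists2 C : R, 0 <= C &
  forall d n (V : 'rV[R]_d -> R) (P : probability 'rV[R]_d R) (Q : probability (n.-tuple 'rV[R]_d) R),
  regular_sample L M m V P Q -> forall rho A w, 0 < rho <= 1 -> 0 <= A -> enorm w <= kap * A ->
  mean_le P (incr V n rho A w) (C * A ^+ 2 * (n%:R^-1 ^+ 2 + (d%:R / n%:R ^+ 2) `^ (1 + rho))).
Proof.
have [K K0 hK] := score_increment_moment L m M0 2.
pose c1 : R := 4 * expR M * kap ^+ 2.
pose c2 : R := (kap * (2 * M * r)) ^+ 2.
pose c3 : R := (kap * (L * k1 ^+ 2)) ^+ 2.
pose c4 : R := (2 * k1 * (1 + k1)) ^+ 2.
have c10 : 0 <= c1 by rewrite mulr_ge0 ?sqr_ge0// mulr_ge0// expR_ge0.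
have c20 : 0 <= c2 by exact: sqr_ge0.
have c30 : 0 <= c3 by exact: sqr_ge0.
have c40 : 0 <= c4 by exact: sqr_ge0.
exists (4 * (c1 + c2 + c3 * K + c4 * (1 + K))) => [|d n V P Q RS rho A w r01 A0 wA].
  have K1 : 0 <= 1 + K by rewrite addr_ge0.
  by do !(assumption || apply: addr_ge0 || apply: mulr_ge0).
have [rho0 rho1] := andP r01; have [PV A1 d0 dn QP] := RS; have n0 := leq_trans d0 dn.
have [V_sc V_C2 _ _ _] := A1.
have nn : 0 < n%:R :> R by rewrite ltr0n.
have dd : 0 < d%:R :> R by rewrite ltr0n.
have A20 : 0 <= A ^+ 2 by exact: sqr_ge0.
set q : R := d%:R / n%:R ^+ 2.
have q0 : 0 < q by rewrite divr_gt0// exprn_gt0.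
have q1 : q <= 1.
  rewrite ler_pdivrMr ?exprn_gt0// mul1r -natrX ler_nat.
  by apply: leq_trans dn _; rewrite leq_pmulr// leqW.
set u := fun y => n%:R^-1 * (enorm (gradient V y) + 1).
have u0 y : 0 <= u y by rewrite mulr_ge0 ?invr_ge0// addr_ge0.
have mu : measurable_fun setT u.
  apply: measurable_funM => //; apply: measurable_funD => //.
  by apply: measurable_fun_enorm; exact: measurable_gradient.
have d1 : 0 <= (1 : R) <= Num.sqrt d%:R.
  by rewrite ler01 /= -[leLHS]sqrtr1 ler_wsqrtr// ler1n.
have h4 : mean_le P (fun y => u y ^+ 4) (K * q ^+ 2).
  rewrite (_ : (fun y => _) = fun y => n%:R^-1 ^+ 4 * (enorm (gradient V y) + 1) ^+ 4); last first.
    by apply/funext => y; rewrite /u exprMn.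
  have -> : K * q ^+ 2 = n%:R^-1 ^+ 4 * (K * d%:R ^+ 2) by rewrite /q; field; rewrite gt_eqF.
  by apply: mean_leZ; [rewrite exprn_ge0 ?invr_ge0|exact: (hK _ _ _ _ _ RS 1 d1)].
have ar : 0 <= 1 + rho <= 2 by rewrite addr_ge0 ?(ltW rho0)//= -natr1 lerD2l.
have hr : mean_le P (fun y => (u y ^+ 2) `^ (1 + rho)) (q `^ (1 + rho) * (1 + K)).
  apply: (@mean_leS _ _ _ _ _ (fun y => q `^ (1 + rho) * (1 + (q ^+ 2)^-1 * u y ^+ 4))).
  - apply: (@measurableT_comp _ _ _ _ _ _ (fun t : R => t `^ (1 + rho))).
      exact: measurable_powR.
    exact: measurable_funX.
  - by move=> y; exact: powR_ge0.
  - move=> y; have := powR_le_sqr (sqr_ge0 (u y)) q0 ar.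
    by rewrite -exprM [_ / _]mulrC.
  apply: mean_leZ; first exact: powR_ge0.
  apply: mean_leD; first exact: mean_le_cst.
  have -> : K = (q ^+ 2)^-1 * (K * q ^+ 2) by field; rewrite gt_eqF.
  by apply: mean_leZ => //; rewrite invr_ge0 sqr_ge0.
have q2 : q ^+ 2 <= q `^ (1 + rho).
  rewrite -powR_mulrn ?(ltW q0)//; apply: ger_powR; first by rewrite q0.
  by rewrite -natr1 lerD2l.
have hw := score_square_mean RS w.
have N0 : 0 <= n%:R^-1 ^+ 2 :> R by rewrite exprn_ge0// invr_ge0.
have p0 : 0 <= q `^ (1 + rho) by exact: powR_ge0.
apply: (@mean_le_weak _ _ _ _ _ (4 * (n%:R^-1 ^+ 2 * (c1 * A ^+ 2) + A ^+ 2 * c2 * n%:R^-1 ^+ 2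
    + A ^+ 2 * c3 * (K * q ^+ 2) + A ^+ 2 * c4 * (q `^ (1 + rho) * (1 + K))))).
  have e : 4 * (c1 + c2 + c3 * K + c4 * (1 + K)) * A ^+ 2 * (n%:R^-1 ^+ 2 + q `^ (1 + rho)) =
    4 * (n%:R^-1 ^+ 2 * (c1 * A ^+ 2) + A ^+ 2 * c2 * n%:R^-1 ^+ 2
    + A ^+ 2 * c3 * (K * q `^ (1 + rho)) + A ^+ 2 * c4 * (q `^ (1 + rho) * (1 + K))) +
    4 * A ^+ 2 * ((c3 * K + c4 * (1 + K)) * n%:R^-1 ^+ 2 + (c1 + c2) * q `^ (1 + rho)) by ring.
  rewrite e -[leLHS]addr0; apply: lerD; last first.
    by do !(assumption || apply: addr_ge0 || apply: mulr_ge0).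
  rewrite ler_wpM2l// lerD2r lerD2l; apply: ler_wpM2l; first exact: mulr_ge0.
  exact: ler_wpM2l.
apply: mean_leZ => //; apply: mean_leD; last first.
  by apply: mean_leZ => //; exact: mulr_ge0.
apply: mean_leD; last by apply: mean_leZ => //; exact: mulr_ge0.
apply: mean_leD; last by apply: mean_le_cst; apply: mulr_ge0 => //; exact: mulr_ge0.
apply: mean_leZ => //; apply: mean_le_weak hw.
have -> : c1 * A ^+ 2 = 4 * expR M * (kap * A) ^+ 2 by rewrite /c1; ring.
apply: ler_wpM2l; first by rewrite mulr_ge0// expR_ge0.
exact: ler_exprn.
Qed.

End variance.

(** * Mean squared error of a smooth functional of the estimator *)

Section mean_square.
Context {R : realType}.
Variables (L M m : R).
Hypotheses (L0 : 0 < L) (M0 : 0 < M) (m0 : 0 < m).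

(** The total over [n] replacements of, respectively, the terms of order [1 / n ^ 2], the Taylor
    remainders and the cutoff increments. *)
Definition variance_rate (d n : nat) (rho : R) (p : nat) : R :=
  n%:R^-1 + n%:R * (d%:R / n%:R ^+ 2) `^ (1 + rho) + (d%:R / n%:R) ^+ p.+1.

Section one_sample.
Context {d n : nat} (V : 'rV[R]_d -> R) (P : probability 'rV[R]_d R)
  (Q : probability (n.-tuple 'rV[R]_d) R).
Hypothesis RS : regular_sample L M m V P Q.
Local Notation Z x := (@mle R d V n (tnth x)).
Local Notation tau := (@dev R L m d n V P).
Variables (rho A : R) (F : seq 'rV[R]_d -> 'rV[R]_d -> R) (theta : 'rV[R]_d).
Hypotheses (rho0 : 0 < rho) (rho1 : rho <= 1) (A0 : 0 <= A) (jF : jet 1 rho A F).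
Local Notation T := (@truncated R L m d n V P F theta).

Lemma bounded_measurable_cutoff : bounded_measurable (fun x => cutoff (tau x)).
Proof.
split; first by apply: measurable_cutoff_comp; exact: measurable_dev RS.
by exists 1 => x; rewrite ger0_norm ?cutoff_ge0// cutoff_le1.
Qed.

Lemma bounded_measurable_mle_jet : bounded_measurable (fun x => F [::] (theta + Z x)).
Proof. exact: (jet_measurable (measurable_mle M0 RS) rho0 rho1 A0 jF theta (isT : unit_seq [::]) isT). Qed.

Lemma bounded_measurable_truncated : bounded_measurable T.
Proof. exact: bounded_measurableM bounded_measurable_cutoff bounded_measurable_mle_jet. Qed.

Lemma bounded_measurable_comp_upd i z (g : n.-tuple 'rV[R]_d -> R) :
  bounded_measurable g -> bounded_measurable (fun x => g (upd i z x)).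
Proof.
move=> [mg [K gK]]; split; last by exists K.
exact: (measurableT_comp mg (measurable_updr i z)).
Qed.

(** Redraw observation [i] first: the replaced sample, hence its dual vector [w], does not change,
    so a single [w] serves for the whole inner integral. *)
Lemma leave_one_out_error i z B B' : gradient V z = 0 ->
  (forall w, enorm w <= grad_cst m * A -> mean_le P (incr L M m V n rho A w) B) ->
  mean_le Q (fun x => (cutoff (tau x) - cutoff (tau (upd i z x))) ^+ 2) B' ->
  \int[Q]_x ((T x - T (upd i z x)) ^+ 2) <= 2 * B + 2 * A ^+ 2 * B'.
Proof.
have [PV A1 d0 dn QP] := RS; move=> z0 hB hB'.
pose D x := (T x - T (upd i z x)) ^+ 2.
pose E x := (cutoff (tau x) - cutoff (tau (upd i z x))) ^+ 2.
have bD : bounded_measurable D.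
  apply: bounded_measurable_sqr; apply: bounded_measurableB; first exact: bounded_measurable_truncated.
  by apply: bounded_measurable_comp_upd; exact: bounded_measurable_truncated.
have bE : bounded_measurable E.
  apply: bounded_measurable_sqr; apply: bounded_measurableB; first exact: bounded_measurable_cutoff.
  by apply: (bounded_measurable_comp_upd i z (g := fun x => cutoff (tau x))); exact: bounded_measurable_cutoff.
have A20 : 0 <= 2 * A ^+ 2 by rewrite mulr_ge0// sqr_ge0.
have key x : cexp P i D x <= 2 * B + 2 * A ^+ 2 * cexp P i E x.
  have [w wA hw] : exists2 w, enorm w <= grad_cst m * A & tau (upd i z x) <= 1 ->
      forall h, dot w (h *m hessian_at V (tnth (upd i z x)) (Z (upd i z x))) =
        dot (jet_grad F (theta + Z (upd i z x))) h.
    have [t1|t1] := leP (tau (upd i z x)) 1.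
      by have [w w1 w2] := dev_solve L0 M0 m0 RS A0 jF theta t1; exists w.
    (* A dummy: the replaced sample has [dev > 1], so only the size of [w] is constrained. *)
    exists 0; first by rewrite enorm0 mulr_ge0 ?grad_cst_ge0.
    by [].
  have pw y : D (upd i y x) <= 2 * incr L M m V n rho A w y + 2 * A ^+ 2 * E (upd i y x).
    have hw' : tau (upd i z (upd i y x)) <= 1 -> enorm w <= grad_cst m * A /\
        forall h, dot w (h *m hessian_at V (tnth (upd i z (upd i y x))) (Z (upd i z (upd i y x)))) =
          dot (jet_grad F (theta + Z (upd i z (upd i y x)))) h.
      by rewrite upd_upd => t1; split; [|exact: hw].
    have h := truncated_increment L0 M0 m0 RS z0 rho0 rho1 A0 jF hw'.
    rewrite upd_upd tnth_upd eqxx in h; rewrite /D /E upd_upd; exact: h.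
  have mB := hB _ wA.
  have iD := bounded_measurable_integrable P (bounded_measurable_upd i x bD).
  have iE := bounded_measurable_integrable P (bounded_measurable_upd i x bE).
  have i1 := integrable_realZ 2 (mean_le_integrable mB).
  have i2 := integrable_realZ (2 * A ^+ 2) iE.
  apply: (@le_trans _ _ (\int[P]_y (2 * incr L M m V n rho A w y + 2 * A ^+ 2 * E (upd i y x)))).
    by apply: le_Rintegral => //; exact: integrable_realD.
  rewrite RintegralD// RintegralZl//; last exact: mean_le_integrable mB.
  rewrite RintegralZl// lerD2r; apply: ler_wpM2l => //; exact: (mean_le_Rintegral mB).
rewrite (resample QP i bD).
have bc := bounded_measurable_cexp P Q i bE.
have ic := bounded_measurable_integrable Q bc.
apply: (@le_trans _ _ (\int[Q]_x (2 * B + 2 * A ^+ 2 * cexp P i E x))).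
  apply: le_Rintegral => //.
  - exact/bounded_measurable_integrable/(bounded_measurable_cexp P Q i bD).
  - by apply: integrable_realD; [exact: integrable_real_cst|exact: integrable_realZ].
rewrite RintegralD//; last 2 first.
- exact: integrable_real_cst.
- exact: integrable_realZ.
rewrite Rintegral_cst1 RintegralZl// -(resample QP i bE) lerD2l ler_wpM2l//.
exact: mean_le_Rintegral hB'.
Qed.

Lemma truncated_variance B B' :
  (forall w, enorm w <= grad_cst m * A -> mean_le P (incr L M m V n rho A w) B) ->
  (forall i z, gradient V z = 0 ->
    mean_le Q (fun x => (cutoff (tau x) - cutoff (tau (upd i z x))) ^+ 2) B') ->
  \int[Q]_x ((T x - \int[Q]_y T y) ^+ 2) <= n%:R * (2 * B + 2 * A ^+ 2 * B').
Proof.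
have [PV A1 d0 dn QP] := RS; have [V_sc V_C2 V_M _ _] := A1; move=> hB hB'.
have [z z0] := V_critical_point M0 V_sc V_C2 V_M (V_no_recession PV A1).
have bT := bounded_measurable_truncated.
apply: le_trans (efron_stein QP (c := fun i x => T (upd i z x)) bT _ _) _.
- by move=> i; exact: bounded_measurable_comp_upd.
- by move=> i x y; rewrite upd_upd.
apply: (@le_trans _ _ (\sum_(i < n) (2 * B + 2 * A ^+ 2 * B'))).
  by apply: ler_sum => i _; apply: leave_one_out_error => //; exact: hB'.
by rewrite sumr_const card_ord -[leLHS]mulr_natl.
Qed.

(** The two functionals agree while [dev] is at most 1/2; beyond, [2 * dev] exceeds 1 and any power
    of it serves, as in Markov's inequality. *)
Lemma truncation_error K p : mean_le Q (fun x => tau x ^+ (2 * p)) K ->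
  mean_le Q (fun x => (F [::] (theta + Z x) - T x) ^+ 2) (A ^+ 2 * (2 ^+ (2 * p) * K)).
Proof.
move=> hK; have [h1 _ _ _] := jF; have A20 := sqr_ge0 A.
apply: (@mean_leS _ _ _ _ _ (fun x => A ^+ 2 * (2 ^+ (2 * p) * tau x ^+ (2 * p)))).
- have [mB _] := bounded_measurableB bounded_measurable_mle_jet bounded_measurable_truncated.
  exact: measurable_funX.
- by move=> x; exact: sqr_ge0.
- move=> x; rewrite /truncated -exprMn.
  have t0 : 0 <= tau x by exact: dev_ge0.
  have [t1|t1] := leP (tau x) 2^-1.
    rewrite (cutoff_eq1 t1) mul1r subrr expr0n/= mulr_ge0// exprn_ge0// mulr_ge0//.
  have hF := h1 [::] (theta + Z x) isT isT.
  move: (F [::] _) hF => f fA.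
  have c0 := cutoff_ge0 (tau x); have c1 := cutoff_le1 (tau x).
  have -> : f - cutoff (tau x) * f = (1 - cutoff (tau x)) * f by ring.
  have fA2 : f ^+ 2 <= A ^+ 2 by rewrite -real_normK ?num_real//; exact: ler_exprn.
  have cc : (1 - cutoff (tau x)) ^+ 2 <= (2 * tau x) ^+ (2 * p).
    apply: (@le_trans _ _ 1); first by rewrite exprn_ile1//; lra.
    by apply: exprn_ege1; lra.
  have := ler_pM (sqr_ge0 f) (sqr_ge0 (1 - cutoff (tau x))) fA2 cc.
  by rewrite -[X in X <= _]exprMn [f * _]mulrC.
by apply: mean_leZ => //; apply: mean_leZ => //; rewrite exprn_ge0.
Qed.

(** Three terms: the truncation, the fluctuation of the truncated functional, and the distance of
    its mean from [c]. The last is controlled by the bias [b] and, once more, the truncation. *)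
Lemma mean_square_split c b B E : `|\int[Q]_x F [::] (theta + Z x) - c| <= b ->
  \int[Q]_x ((T x - \int[Q]_y T y) ^+ 2) <= B ->
  mean_le Q (fun x => (F [::] (theta + Z x) - T x) ^+ 2) E ->
  mean_le Q (fun x => (F [::] (theta + Z x) - c) ^+ 2) (9 * E + 3 * B + 6 * b ^+ 2).
Proof.
move=> hb hB hE.
have bF := bounded_measurable_mle_jet; have bT := bounded_measurable_truncated.
set mu := \int[Q]_y T y in hB *.
have iF := bounded_measurable_integrable Q bF; have iT := bounded_measurable_integrable Q bT.
have bFT := bounded_measurableB bF bT.
have bTm := bounded_measurableB bT (bounded_measurable_cst mu).
have hmu : (mu - c) ^+ 2 <= 2 * b ^+ 2 + 2 * E.
  have e1 : (\int[Q]_x (F [::] (theta + Z x) - T x)) ^+ 2 <= E.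
    by apply: le_trans (Rintegral_sqr_le Q bFT) _; exact: mean_le_Rintegral hE.
  rewrite RintegralB// -/mu in e1.
  have e2 : (\int[Q]_x F [::] (theta + Z x) - c) ^+ 2 <= b ^+ 2.
    by rewrite -real_normK ?num_real//; exact: ler_exprn.
  move: e1 e2; move: (\int[Q]_x F [::] (theta + Z x)) => s e1 e2.
  have := sqr_ge0 ((s - mu) + (s - c)); have -> : mu - c = (s - c) - (s - mu) by ring.
  by rewrite sqrrB sqrrD; lra.
have hV : mean_le Q (fun x => (T x - mu) ^+ 2) B.
  have bV := bounded_measurable_sqr bTm.
  split; [by case: bV|by move=> x; exact: sqr_ge0|].
  by rewrite -EFin_Rintegral ?lee_fin//; exact: bounded_measurable_integrable.
apply: (@mean_leS _ _ _ _ _ (fun x => 3 * ((F [::] (theta + Z x) - T x) ^+ 2 + (T x - mu) ^+ 2 + (2 * b ^+ 2 + 2 * E)))).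
- by have [] := bounded_measurable_sqr (bounded_measurableB bF (bounded_measurable_cst c)).
- by move=> x; exact: sqr_ge0.
- move=> x; have -> : F [::] (theta + Z x) - c = (F [::] (theta + Z x) - T x) + (T x - mu) + (mu - c) by ring.
  by apply: le_trans (sqr3_le _ _ _) _; rewrite ler_wpM2l// lerD2l.
have -> : 9 * E + 3 * B + 6 * b ^+ 2 = 3 * (E + B + (2 * b ^+ 2 + 2 * E)) by ring.
apply: mean_leZ => //; apply: mean_leD; first exact: mean_leD.
by apply: mean_le_cst; apply: le_trans hmu; exact: sqr_ge0.
Qed.

End one_sample.

Lemma jet_mean_square (p : nat) : exists2 C : R, 0 <= C &
  forall d n (V : 'rV[R]_d -> R) (P : probability 'rV[R]_d R) (Q : probability (n.-tuple 'rV[R]_d) R),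
  regular_sample L M m V P Q -> forall rho A F theta c b, 0 < rho <= 1 -> 0 <= A -> jet 1 rho A F ->
  `|\int[Q]_x F [::] (theta + mle V (tnth x)) - c| <= b ->
  mean_le Q (fun x => (F [::] (theta + mle V (tnth x)) - c) ^+ 2)
    (C * A ^+ 2 * variance_rate d n rho p + 6 * b ^+ 2).
Proof.
have [C1 C10 h1] := incr_mean L m M0.
have [C2 C20 h2] := cutoff_increment L0 M0 m0 p.
(* The order [p.+1] matches the rate [(d / n) ^+ p.+1] of the summed cutoff increments. *)
have [C3 C30 h3] := dev_moment L0 M0 m0 p.+1.
pose K : R := 9 * (2 ^+ (2 * p.+1) * C3) + 6 * C1 + 6 * C2.
have c30 : 0 <= 2 ^+ (2 * p.+1) * C3 by rewrite mulr_ge0// exprn_ge0.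
have K0 : 0 <= K by rewrite /K !addr_ge0 ?mulr_ge0.
exists K => // d n V P Q RS rho A F theta c b r01 A0 jF hb.
have [rho0 rho1] := andP r01; have [PV A1 d0 dn QP] := RS; have n0 := leq_trans d0 dn.
have nn : 0 < n%:R :> R by rewrite ltr0n.
have hV := truncated_variance RS theta rho0 rho1 A0 jF (fun w wA => h1 _ _ _ _ _ RS rho A w r01 A0 wA)
  (fun i z z0 => h2 _ _ _ _ _ RS i z z0).
have hT := truncation_error RS theta rho0 rho1 A0 jF (h3 _ _ _ _ _ RS).
apply: mean_le_weak (mean_square_split RS rho0 rho1 A0 jF hb hV hT).
rewrite lerD2r /variance_rate.
set a := n%:R^-1; set q := (d%:R / n%:R) ^+ p.+1; set e := (_ `^ _).
have e0 : 0 <= e by exact: powR_ge0.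
have q0 : 0 <= q by rewrite exprn_ge0// divr_ge0.
have a0 : 0 <= a by rewrite invr_ge0.
have na : n%:R * a = 1 by rewrite mulfV// gt_eqF.
have -> : n%:R * (2 * (C1 * A ^+ 2 * (a ^+ 2 + e)) + 2 * A ^+ 2 * (C2 * (q / n%:R))) =
  A ^+ 2 * (2 * C1 * ((n%:R * a) * a + n%:R * e) + 2 * C2 * ((n%:R * a) * q)) by rewrite -/a; ring.
rewrite na !mul1r.
have ne0 : 0 <= n%:R * e by rewrite mulr_ge0.
have A20 := sqr_ge0 A.
have -> : K * A ^+ 2 * (a + n%:R * e + q) =
   9 * (A ^+ 2 * (2 ^+ (2 * p.+1) * (C3 * q))) +
   3 * (A ^+ 2 * (2 * C1 * (a + n%:R * e) + 2 * C2 * q)) +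
   A ^+ 2 * (9 * (2 ^+ (2 * p.+1) * C3) * (a + n%:R * e) + 6 * C1 * q + 6 * C2 * (a + n%:R * e)).
  by rewrite /K; move: (2 ^+ (2 * p.+1)) (n%:R * e) => w u; ring.
by rewrite lerDl mulr_ge0// !addr_ge0 ?mulr_ge0 ?addr_ge0.
Qed.

End mean_square.

(** * Transfer from the error law to the statistical model *)

Section model_transfer.
Context {R : realType} {d n : nat} (V : 'rV[R]_d -> R) (L M m : R) (P : probability 'rV[R]_d R).
Hypotheses (M0 : 0 < M) (n0 : (0 < n)%N).
Hypothesis PV : has_density P (fun x => expR (- V x)).
Hypothesis A1 : assumption1 V P L M m.
Context {disp : measure_display} {Omega : measurableType disp}.
Variables (PP : 'rV[R]_d -> probability Omega R) (X : 'I_n -> Omega -> 'rV[R]_d).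
Hypothesis LS : location_sample V PP X.
Variable Q : probability (n.-tuple 'rV[R]_d) R.
Hypothesis law : forall theta (f : n.-tuple 'rV[R]_d -> \bar R), measurable_fun setT f ->
  (forall x, (0 <= f x)%E) ->
  (\int[PP theta]_w f (errors X theta w) = \int[Q]_x f x)%E.

Local Notation Z := (fun x : n.-tuple 'rV[R]_d => mle V (tnth x)).

Let V_sc : strictly_convex V. Proof. by case: A1. Qed.
Let V_C2 : twice_continuously_differentiable V. Proof. by case: A1. Qed.
Let V_M : (ereal_sup [set (opnorm (hessian V x))%:E | x in [set: 'rV[R]_d]] <= M%:E)%E.
Proof. by case: A1. Qed.
Let mZ : measurable_fun [set: n.-tuple 'rV[R]_d] Z.
Proof. exact: measurable_mle_tuple M0 PV A1 n0. Qed.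

Lemma mle_stat_errors theta w : mle_stat V X w = theta + mle V (tnth (errors X theta w)).
Proof.
have := mle_shift M0 V_sc V_C2 V_M (V_no_recession PV A1) n0 (tnth (errors X theta w)) theta.
rewrite [theta + _]addrC => <-; rewrite /mle_stat; congr (mle V _).
by apply/funext => j; rewrite tnth_errors subrK.
Qed.

Lemma law_bounded theta (g : n.-tuple 'rV[R]_d -> R) : bounded_measurable g ->
  \int[PP theta]_w g (errors X theta w) = \int[Q]_x g x.
Proof.
move=> bg; have [mg [K gK]] := bg.
have bgw : bounded_measurable (fun w => g (errors X theta w)).
  split; last by exists K => w; exact: gK.
  exact: (measurableT_comp mg (measurable_errors LS theta)).
(* [law] is about nonnegative functions; adding the bound [K] makes [g] one. *)
have bgK := bounded_measurableD bg (bounded_measurable_cst K).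
have bgwK := bounded_measurableD bgw (bounded_measurable_cst K).
have e : \int[PP theta]_w (g (errors X theta w) + K) = \int[Q]_x (g x + K).
  apply: EFin_inj; rewrite !EFin_Rintegral; try exact: bounded_measurable_integrable.
  apply: (law theta (f := fun x => (g x + K)%:E)).
    by apply/measurable_EFinP; case: bgK.
  move=> x; rewrite lee_fin; have := gK x; rewrite ler_norml => /andP[+ _].
  by rewrite -lerBlDr sub0r.
have ig := bounded_measurable_integrable Q bg.
have igw := bounded_measurable_integrable (PP theta) bgw.
move: e; rewrite RintegralD//; last exact: integrable_real_cst.
rewrite RintegralD//; last exact: integrable_real_cst.
by rewrite !Rintegral_cst1 => /addIr.
Qed.

Lemma T_opE (g : 'rV[R]_d -> R) theta : bounded_measurable (fun x => g (theta + Z x)) ->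
  T_op V PP X g theta = \int[Q]_x g (theta + Z x).
Proof.
move=> bg; rewrite -(law_bounded theta bg) /T_op unlock /Rintegral; congr fine.
by apply: eq_integral => w _; rewrite (mle_stat_errors theta).
Qed.

(** The jet carried along the iteration supplies the boundedness and measurability that [T_opE] asks
    for. *)
Lemma iter_B_opE l rho A (f : 'rV[R]_d -> R) j : 0 < rho <= 1 -> 0 <= A -> jet l rho A (iter_diff f) ->
  iter j (B_op V PP X) f = iter j (avg Q Z) (iter_diff f) [::].
Proof.
move=> r01 A0 jf; have [rho0 rho1] := andP r01.
elim: j => [//|j IH]; apply/funext => theta; rewrite !iterS IH /B_op T_opE//.
have A0' : 0 <= 2 ^+ j * A by rewrite mulr_ge0// exprn_ge0.
exact: (jet_measurable mZ rho0 rho1 A0' (jet_iter_avg Q mZ j r01 A0 jf) theta (isT : unit_seq [::]) isT).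
Qed.

Lemma f_redE l rho A (f : 'rV[R]_d -> R) k : 0 < rho <= 1 -> 0 <= A -> jet l rho A (iter_diff f) ->
  f_red V PP X k f = reduced Q Z k (iter_diff f) [::].
Proof.
move=> r01 A0 jf; apply/funext => theta; apply: eq_bigr => j _.
by rewrite (iter_B_opE j r01 A0 jf).
Qed.

Lemma L2_error_le (g f : 'rV[R]_d -> R) theta B c : 0 <= c -> B <= c ^+ 2 ->
  mean_le Q (fun x => (g (theta + Z x) - f theta) ^+ 2) B ->
  (L2_error V PP X g f theta <= c%:E)%E.
Proof.
move=> c0 Bc [mg g0 gB].
have e : (\int[PP theta]_w (`|((g (mle_stat V X w) - f theta)%R)%:E| `^ 2) =
    \int[Q]_x ((g (theta + Z x) - f theta) ^+ 2)%:E)%E.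
  rewrite -(law theta (f := fun x => ((g (theta + Z x) - f theta) ^+ 2)%:E)).
  - apply: eq_integral => w _; rewrite (mle_stat_errors theta).
    by rewrite abse_EFin poweR_EFin powR_mulrn// real_normK// num_real.
  - exact/measurable_EFinP.
  - by move=> x; rewrite lee_fin sqr_ge0.
rewrite /L2_error unlock /= [X in (X `^ _)%E](_ : _ = \int[Q]_x ((g (theta + Z x) - f theta) ^+ 2)%:E)%E//.
have i0 : (0 <= \int[Q]_x ((g (theta + Z x) - f theta) ^+ 2)%:E)%E.
  by apply: integral_ge0 => x _; rewrite lee_fin sqr_ge0.
have -> : c%:E = ((c ^+ 2)%:E `^ 2^-1)%E.
  by rewrite poweR_EFin powR12_sqrt ?sqr_ge0// sqrtr_sqr ger0_norm.
have i1 : (\int[Q]_x ((g (theta + Z x) - f theta) ^+ 2)%:E <= (c ^+ 2)%:E)%E.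
  by apply: le_trans gB _; rewrite lee_fin.
apply: (gt0_ler_poweR _ _ _ i1); rewrite ?invr_ge0// in_itv /= leey andbT//.
by rewrite lee_fin sqr_ge0.
Qed.

End model_transfer.

(** * Comparison of the rates *)

Section rates.
Context {R : realType}.

Lemma le_sqr1D (a c : R) : 0 <= a -> 0 <= c -> c <= (1 + a + c) ^+ 2.
Proof. by move=> a0 c0; nra. Qed.

Lemma jet_lower_first {d} l rho A (G : seq 'rV[R]_d -> 'rV[R]_d -> R) :
  0 < rho <= 1 -> 0 <= A -> jet l.+2 rho A G -> jet 1 1 A G.
Proof.
move=> r01 A0 /(jet_lower r01 A0); have o1 : 0 < (1 : R) <= 1 by rewrite ltr01 lexx.
by elim: l => [//|l IH] /(jet_lower o1 A0).
Qed.

(** The split is on the modulus of the gradient. For [k = 0] the middle term is at most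
    [q ^ (1 + rho)], the square of the nonparametric rate. For larger [k] the gradient is Lipschitz
    and the term is [q ^ 2 / n], below the parametric [1 / n]. The order [k.+1] gives [q ^+ k.+2],
    small enough because the smoothness is at most [k.+2]. *)
Lemma variance_rate_le (d n : nat) (k : nat) (rho rho' : R) : (0 < d)%N -> (d <= n)%N ->
  0 < rho <= 1 -> rho' = (if k is _.+1 then 1 else rho) ->
  variance_rate d n rho' k.+1 <=
    3 * Num.max (Num.sqrt n%:R)^-1 (Num.sqrt (d%:R / n%:R) `^ (k.+1%:R + rho)) ^+ 2.
Proof.
move=> d0 dn /andP[r0 r1] er; have n0 := leq_trans d0 dn.
have nn : 0 < n%:R :> R by rewrite ltr0n.
have dd : 0 < d%:R :> R by rewrite ltr0n.
set q : R := d%:R / n%:R; have q0 : 0 < q by rewrite divr_gt0.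
have q1 : q <= 1 by rewrite ler_pdivrMr// mul1r ler_nat.
set D := Num.sqrt q; have D0 : 0 < D by rewrite sqrtr_gt0.
have DD : D ^+ 2 = q by rewrite sqr_sqrtr// ltW.
have D1 : D <= 1 by rewrite -[leRHS]sqrtr1 ler_wsqrtr.
set s := k.+1%:R + rho; set E := Num.max _ _.
have E1 : n%:R^-1 <= E ^+ 2.
  have -> : n%:R^-1 = (Num.sqrt n%:R)^-1 ^+ 2 :> R by rewrite exprVn sqr_sqrtr// ltW.
  by apply: ler_exprn; rewrite ?invr_ge0 ?sqrtr_ge0// le_max lexx.
have E2 : (D `^ s) ^+ 2 <= E ^+ 2.
  by apply: ler_exprn; rewrite ?powR_ge0// le_max lexx orbT.
have E3 : q ^+ k.+2 <= E ^+ 2.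
  apply: le_trans E2; rewrite -DD -exprM mulnC exprM; apply: ler_exprn; first by rewrite exprn_ge0// ltW.
  rewrite -powR_mulrn ?(ltW D0)//; apply: ger_powR; first by rewrite D0.
  by rewrite /s -[k.+2%:R]natr1 lerD2l.
have n1 : n%:R^-1 <= 1 :> R by rewrite invf_le1// ler1n.
have ni : 0 < n%:R^-1 :> R by rewrite invr_gt0.
suff E4 : n%:R * (d%:R / n%:R ^+ 2) `^ (1 + rho') <= E ^+ 2.
  by rewrite /variance_rate -/q; move: E1 E3 E4; move: (_ * _ `^ _) => a *; lra.
have eq2 : d%:R / n%:R ^+ 2 = q * n%:R^-1 by rewrite /q; field; rewrite gt_eqF.
case: k @s @E E1 E2 E3 er => [|k] s E E1 E2 E3 ->.
  apply: le_trans E2; rewrite eq2 (powRM _ (ltW q0) (ltW ni)) -DD.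
  have -> : (D ^+ 2) `^ (1 + rho) = (D `^ s) ^+ 2.
    by rewrite -(powR_mulrn 2 (ltW D0)) -(powR_mulrn 2 (powR_ge0 D s)) powRAC.
  rewrite mulrCA ler_piMr ?sqr_ge0//.
  apply: (@le_trans _ _ (n%:R * n%:R^-1)); last by rewrite mulfV// gt_eqF.
  rewrite ler_pM2l// -{2}(powRr1 (ltW ni)); apply: ger_powR; first by rewrite ni.
  by rewrite lerDl ltW.
apply: le_trans E1; have -> : (1 + 1 : R) = 2%:R by [].
rewrite powR_mulrn; last by rewrite divr_ge0// ltW// exprn_gt0.
have -> : n%:R * (d%:R / n%:R ^+ 2) ^+ 2 = q ^+ 2 * n%:R^-1 by rewrite /q; field; rewrite gt_eqF.
by rewrite ler_piMl ?(ltW ni)// exprn_ile1// ltW.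
Qed.

End rates.

(** * Assembly of the two bounds *)

Section theorem.
Context {R : realType}.

Lemma hoelder_rate (L M m s : R) : 0 < L -> 0 < M -> 0 < m -> 0 < s <= 1 ->
  exists C : R, 0 < C /\
    forall (n d : nat), (0 < n)%N -> (0 < d)%N ->
    forall (V : 'rV[R]_d -> R) (P : probability 'rV[R]_d R),
      has_density P (fun x => expR (- V x)) -> assumption1 V P L M m ->
    forall (disp : measure_display) (Omega : measurableType disp)
      (PP : 'rV[R]_d -> probability Omega R) (X : 'I_n -> Omega -> 'rV[R]_d),
      location_sample V PP X -> forall f theta, hoelder_ball 0 s f ->
      (L2_error V PP X f f theta <= (C * Num.min (Num.sqrt (d%:R / n%:R) `^ s) 1)%:E)%E.
Proof.
move=> L0 M0 m0 s01; have [s0 s1] := andP s01.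
have [C C0 hC] := hoelder_estimator_error L0 M0 m0; exists (2 + C); split; first by rewrite ltr_wpDr.
move=> n d n0 d0 V P PV A1 disp Omega PP X LS f theta /(hoelder_ball_jet s0) jf.
have V_C2 : twice_continuously_differentiable V by case: A1.
have [Q [QP law]] := sample_law PV V_C2 LS.
have D0 : 0 <= Num.sqrt (d%:R / n%:R) `^ s :> R by exact: powR_ge0.
have min0 : 0 <= Num.min (Num.sqrt (d%:R / n%:R) `^ s) 1 :> R by rewrite le_min D0 ler01.
have C2 : 0 <= 2 + C by rewrite addr_ge0.
have [dn|nd] := leqP d n.
  have RS : regular_sample L M m V P Q by split.
  have /andP[R0 R1] := rate_gt0 RS.
  have hm := hC _ _ _ _ _ RS s f theta s01 jf.
  apply: (L2_error_le M0 n0 PV A1 law _ _ hm); first exact: mulr_ge0.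
  have -> : rate d n `^ (2 * s) = (Num.sqrt (d%:R / n%:R) `^ s) ^+ 2.
    by rewrite mulrC powRrM powR_mulrn// powR_ge0.
  rewrite (min_idPl _); last first.
    have e1 : 1 `^ s = 1 :> R by rewrite powR1.
    by rewrite -[leRHS]e1; apply: ge0_ler_powR; rewrite ?nnegrE ?sqrtr_ge0// ltW.
  by rewrite exprMn ler_wpM2r ?sqr_ge0//; move: C0; clear; nra.
(* Case [n < d]: the right side is a constant, and the error is at most 2. *)
have [h1 _ _ _] := jf.
have mZ : measurable_fun setT (fun x : n.-tuple 'rV[R]_d => mle V (tnth x)).
  exact: measurable_mle_tuple M0 PV A1 n0.
have [mf _] := jet_measurable mZ s0 s1 ler01 jf theta (isT : unit_seq [::]) isT.
have hm : mean_le Q (fun x : n.-tuple 'rV[R]_d => (f (theta + mle V (tnth x)) - f theta) ^+ 2) 4.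
  apply: (@mean_leS _ _ _ _ _ (fun=> 4)); last exact: mean_le_cst.
  - by apply: measurable_funX; apply: measurable_funB.
  - by move=> x; exact: sqr_ge0.
  - move=> x; rewrite -real_normK ?num_real//.
    have -> : (4 : R) = 2 ^+ 2 by rewrite -natrX.
    apply: ler_exprn => //; apply: le_trans (ler_normB _ _) _.
    by have := h1 [::] (theta + mle V (tnth x)) isT isT; have := h1 [::] theta isT isT; rewrite /=; lra.
apply: (L2_error_le M0 n0 PV A1 law _ _ hm); first exact: mulr_ge0.
rewrite (min_idPr _); last first.
  have e1 : 1 `^ s = 1 :> R by rewrite powR1.
  rewrite -[leLHS]e1; apply: ge0_ler_powR; rewrite ?nnegrE ?sqrtr_ge0 ?(ltW s0)//.
  by rewrite -[leLHS]sqrtr1 ler_wsqrtr// ler_pdivlMr ?ltr0n// mul1r ler_nat ltnW.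
by rewrite mulr1; move: C0; clear; nra.
Qed.

Lemma reduced_rate (L M m : R) (k : nat) (rho : R) : 0 < L -> 0 < M -> 0 < m -> 0 < rho <= 1 ->
  exists C : R, 0 < C /\
    forall (n d : nat), (0 < n)%N -> (0 < d)%N ->
    forall (V : 'rV[R]_d -> R) (P : probability 'rV[R]_d R),
      has_density P (fun x => expR (- V x)) -> assumption1 V P L M m ->
    forall (disp : measure_display) (Omega : measurableType disp)
      (PP : 'rV[R]_d -> probability Omega R) (X : 'I_n -> Omega -> 'rV[R]_d),
      location_sample V PP X -> forall f theta, hoelder_ball k.+1 rho f ->
      (L2_error V PP X (f_red V PP X k f) f theta <= (C * Num.min (Num.max (Num.sqrt n%:R)^-1
        (Num.sqrt (d%:R / n%:R) `^ (k.+1%:R + rho))) 1)%:E)%E.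
Proof.
move=> L0 M0 m0 r01; have [rho0 rho1] := andP r01.
have [K K0 hK] := jet_mean_square L0 M0 m0 k.+1.
have [B B0 hB] := reduced_estimator_bias L0 M0 m0 k.
(* A bound for the jet of [f_red]: each average at most doubles a bound, and [2 ^+ k.+1] exceeds the
   geometric sum. *)
pose A : R := 2 ^+ k.+1.
have A0 : 0 <= A by rewrite exprn_ge0.
pose C : R := 3 * K * A ^+ 2 + 6 * B ^+ 2.
have C0 : 0 <= C by rewrite addr_ge0// !mulr_ge0 ?sqr_ge0.
exists (1 + A + C); split; first by rewrite -addrA ltr_wpDr// addr_ge0.
move=> n d n0 d0 V P PV A1 disp Omega PP X LS f theta /(hoelder_ball_jet rho0) jf.
have V_C2 : twice_continuously_differentiable V by case: A1.
have [Q [QP law]] := sample_law PV V_C2 LS.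
have mZ : measurable_fun setT (fun x : n.-tuple 'rV[R]_d => mle V (tnth x)).
  exact: measurable_mle_tuple M0 PV A1 n0.
rewrite (f_redE M0 n0 PV A1 LS law k r01 ler01 jf).
pose F := reduced Q (fun x : n.-tuple 'rV[R]_d => mle V (tnth x)) k (iter_diff f).
have s0 : 0 <= k.+1%:R + rho by rewrite addr_ge0// ltW.
set D := Num.sqrt (d%:R / n%:R); set s := k.+1%:R + rho in s0 *.
have D0 : 0 <= D by exact: sqrtr_ge0.
set E := Num.max _ _.
have E0 : 0 <= E by rewrite le_max powR_ge0 orbT.
have min0 : 0 <= Num.min E 1 :> R by rewrite le_min E0 ler01.
have C2 : 0 <= 1 + A + C by apply: addr_ge0 => //; apply: addr_ge0.
have e1 : 1 `^ s = 1 :> R by rewrite powR1.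
have [dn|nd] := leqP d n.
  have RS : regular_sample L M m V P Q by split.
  have /andP[R0 R1] := rate_gt0 RS.
  (* For [k > 0] the function has a bounded second derivative, so its first-order jet is Lipschitz
     and the exponent 1 is available. *)
  pose rho' : R := if k is _.+1 then 1 else rho.
  have [r01' jf'] : 0 < rho' <= 1 /\ jet 1 rho' 1 (iter_diff f).
    rewrite /rho'; move: jf; clear -r01; case: k => [//|k] jf; split; first by rewrite ltr01 lexx.
    exact: jet_lower_first r01 ler01 jf.
  have jF : jet 1 rho' A F by have := jet_reduced Q mZ k r01' ler01 jf'; rewrite mulr1.
  have hb := hB _ _ _ _ _ RS rho _ theta r01 jf.
  have hm := hK _ _ _ _ _ RS rho' A F theta (f theta) _ r01' A0 jF hb.
  apply: (L2_error_le M0 n0 PV A1 law _ _ hm); first exact: mulr_ge0.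
  have vr := variance_rate_le d0 dn r01 (erefl rho').
  rewrite -/D -/s -/E in vr.
  have Es : (rate d n `^ s) ^+ 2 <= E ^+ 2.
    by apply: ler_exprn; rewrite ?powR_ge0// le_max lexx orbT.
  rewrite (min_idPl _); last first.
    rewrite ge_max; apply/andP; split.
      by rewrite invf_le1 ?sqrtr_gt0 ?ltr0n// -[leLHS]sqrtr1 ler_wsqrtr// ler1n.
    by rewrite -[leRHS]e1; apply: ge0_ler_powR; rewrite ?nnegrE.
  apply: (@le_trans _ _ (C * E ^+ 2)).
    have -> : C * E ^+ 2 = K * A ^+ 2 * (3 * E ^+ 2) + 6 * (B ^+ 2 * E ^+ 2) by rewrite /C; ring.
    rewrite -/s [(B * _) ^+ 2]exprMn; apply: lerD.
      by apply: ler_wpM2l => //; rewrite mulr_ge0 ?sqr_ge0.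
    by apply: ler_wpM2l => //; apply: ler_wpM2l => //; exact: sqr_ge0.
  by rewrite [leRHS]exprMn ler_wpM2r ?sqr_ge0//; exact: le_sqr1D.
(* Case [n < d]: the right side is a constant, and boundedness of [f_red] and [f] suffices. *)
have jF : jet k.+1 rho A F by have := jet_reduced Q mZ k r01 ler01 jf; rewrite mulr1.
have [h1 _ _ _] := jf; have [hF _ _ _] := jF.
have [mF _] := jet_measurable mZ rho0 rho1 A0 jF theta (isT : unit_seq [::]) isT.
have hm : mean_le Q (fun x : n.-tuple 'rV[R]_d => (F [::] (theta + mle V (tnth x)) - f theta) ^+ 2) ((1 + A) ^+ 2).
  apply: (@mean_leS _ _ _ _ _ (fun=> (1 + A) ^+ 2)); last by apply: mean_le_cst; exact: sqr_ge0.
  - by apply: measurable_funX; apply: measurable_funB.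
  - by move=> x; exact: sqr_ge0.
  - move=> x; rewrite -real_normK ?num_real//.
    apply: ler_exprn => //; apply: le_trans (ler_normB _ _) _; rewrite [leRHS]addrC.
    by apply: lerD; [exact: hF|exact: (h1 [::] theta isT isT)].
apply: (L2_error_le M0 n0 PV A1 law _ _ hm); first exact: mulr_ge0.
rewrite (min_idPr _); last first.
  rewrite le_max; apply/orP; right.
  rewrite -[leLHS]e1; apply: ge0_ler_powR; rewrite ?nnegrE//.
  by rewrite -[leLHS]sqrtr1 ler_wsqrtr// ler_pdivlMr ?ltr0n// mul1r ler_nat ltnW.
by rewrite mulr1; apply: ler_exprn; rewrite ?addr_ge0// lerDl.
Qed.

End theorem.

Theorem proposition2p1 (R : realType) :
  (forall L M m s : R, 0 < L -> 0 < M -> 0 < m -> 0 < s <= 1 ->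
    exists C : R, 0 < C /\
      forall (n d : nat), (0 < n)%N -> (0 < d)%N ->
      forall (V : 'rV[R]_d -> R) (P : probability 'rV[R]_d R),
        has_density P (fun x => expR (- V x)) ->
        assumption1 V P L M m ->
      forall (disp : measure_display) (Omega : measurableType disp)
             (PP : 'rV[R]_d -> probability Omega R)
             (X : 'I_n -> Omega -> 'rV[R]_d),
        location_sample V PP X ->
        (ereal_sup [set ereal_sup [set L2_error V PP X f f theta
                                  | theta in [set: 'rV[R]_d]]
                   | f in hoelder_ball 0 s]
         <= (C * Num.min (Num.sqrt (d%:R / n%:R) `^ s) 1)%:E)%E)
  /\
  (forall (L M m : R) (k : nat) (rho s c1 c2 : R),
    0 < L -> 0 < M -> 0 < m -> 0 < rho <= 1 -> s = k.+1%:R + rho ->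
    0 < c1 -> 0 < c2 ->
    exists C : R, 0 < C /\
      forall (n d : nat), (0 < n)%N -> (0 < d)%N ->
      forall (V : 'rV[R]_d -> R) (P : probability 'rV[R]_d R),
        has_density P (fun x => expR (- V x)) ->
        assumption1 V P L M m ->
        opnorm (covariance_matrix P) <= c1 ->
      forall alpha : R, 0 < alpha < 1 -> d%:R <= c2 * n%:R `^ alpha ->
      forall (disp : measure_display) (Omega : measurableType disp)
             (PP : 'rV[R]_d -> probability Omega R)
             (X : 'I_n -> Omega -> 'rV[R]_d),
        location_sample V PP X ->
        (ereal_sup [set ereal_sup [set L2_error V PP X (f_red V PP X k f) f theta
                                  | theta in [set: 'rV[R]_d]]
                   | f in hoelder_ball k.+1 rho]
         <= (C * Num.min (Num.max (Num.sqrt n%:R)^-1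
                                  (Num.sqrt (d%:R / n%:R) `^ s)) 1)%:E)%E).
Proof.
split=> [L M m s L0 M0 m0 s01|L M m k rho s c1 c2 L0 M0 m0 r01 -> _ _].
  have [C [C0 hC]] := hoelder_rate L0 M0 m0 s01; exists C; split=> //.
  move=> n d n0 d0 V P PV A1 disp Omega PP X LS.
  apply: ge_ereal_sup => _ [f hf <-]; apply: ge_ereal_sup => _ [theta _ <-].
  exact: (hC n d n0 d0 V P PV A1 _ _ PP X LS f theta hf).
have [C [C0 hC]] := reduced_rate k L0 M0 m0 r01; exists C; split=> //.
move=> n d n0 d0 V P PV A1 _ alpha _ _ disp Omega PP X LS.
apply: ge_ereal_sup => _ [f hf <-]; apply: ge_ereal_sup => _ [theta _ <-].
exact: (hC n d n0 d0 V P PV A1 _ _ PP X LS f theta hf).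
Qed.
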